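(* Let $(F,A)$ be a graph structure pair such that $F$ has no isolated vertices, and let $m\in[m^*]$, $t=m\,n^{-3/2}$. Then, with probability at least $1-n^{-2\log n}$, either the event $\mathcal K^{\mathcal E}(m-1)=\mathcal Y(m-1)\cap\mathcal Z(m-1)\cap\mathcal Q(m-1)$ fails, or the following holds for every injection $\phi:A\to V(G_m)$ which is faithful at time $t$: (a) if $0<t\le\omega<t_A(F)$, then $N_\phi(F)(m)\in\tilde N_A(F)(m)\pm f_{F,A}(t)\,\tilde N_A(F)(n^{3/2})$; (b) if $\omega<t\le t_A(F)$, then $N_\phi(F)(m)\in\big(1\pm g_{F,A}(t)\big)\tilde N_A(F)(m)$; (c) if $t>t_A(F)$, then $N_\phi(F)(m)\le(\log n)^{\Delta(F,H,A)}\,\tilde N_H(F)(m^+)$, where $H$ is the minimal induced sub-structure with $A\subsetneq H\subseteq F$ such that $t<t_H(F)$, and $m^+=\max\{m,n^{3/2}\}$.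
   Context: Triangle-free process on $[n]$ ($G_0$ empty; $G_m$ obtained from $G_{m-1}$ by adding a uniformly random non-edge creating no triangle). $\varepsilon>0$ is a fixed sufficiently small constant, $C=C(\varepsilon)$ a sufficiently large constant, $\omega=\omega(n)\to\infty$ sufficiently slowly, and $n$ is sufficiently large. $t=m n^{-3/2}$, $t^*=(\frac1{2\sqrt2}-\varepsilon)\sqrt{\log n}$, $m^*=t^*n^{3/2}$. Open edges $O(G_m)=\{e\notin E(G_m):e\not\subseteq N_{G_m}(v)\ \forall v\}$, $Q(m)=|O(G_m)|$; $Y_e(m)$, $X_e(m)$ = number of open $f$ forming with open $e$ two sides of a triangle whose third side is in $E(G_m)$, resp. in $O(G_m)$; $\overline X,\overline Y$ their averages over $O(G_m)$; $Z_e(m)=|N_{G_m}(u)\cap N_{G_m}(v)|$ for $e=\{u,v\}$. $\tilde Q(m)=e^{-4t^2}\binom n2$, $\tilde X(m)=2e^{-8t^2}n$, $\tilde Y(m)=4te^{-4t^2}\sqrt n$, $f_y(t)=e^{Ct^2}n^{-1/4}(\log n)^{5/2}$, $g_y(t)=e^{2t^2}n^{-1/4}(\log n)^4$, $g_q(t)=e^{2t^2}n^{-1/4}(\log n)^3$. Events: $\mathcal Y(m')$: $Y_e(m)\in\tilde Y(m)\pm f_y(t)\tilde Y(n^{3/2})$ for all $e\in O(G_m)$, $m\le\min\{\omega n^{3/2},m'\}$, and $Y_e(m)\in(1\pm g_y(t))\tilde Y(m)$ for all $e\in O(G_m)$, $\omega n^{3/2}<m\le m'$. $\mathcal Z(m')$: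 $Z_e(m)\le(\log n)^2$ for all $e$ and $m\le m'$. $\mathcal Q(m')$: $Q(m)\in\tilde Q(m)\pm\varepsilon f_y(t)\tilde Q(n^{3/2})$ for $m\le\min\{\omega n^{3/2},m'\}$, and $\overline X(m)/\tilde X(m),\ \overline Y(m)/\tilde Y(m),\ Q(m)/\tilde Q(m)\in1\pm g_q(t)$ for $\omega n^{3/2}<m\le m'$. Graph structures: $F$ has labelled vertices $V(F)$ and disjoint sets $E(F)$, $O(F)$ of pairs; permissible if every triangle in $E(F)\cup O(F)$ has at least two elements of $O(F)$. A graph structure pair $(F,A)$: $F$ permissible, $A\subseteq V(F)$ independent. Sub-structures are induced, identified with vertex sets. For induced $H\subseteq F$: $v_H(F)=|V(F)|-|V(H)|$ and $\tilde N_H(F)(m)=(e^{-4t^2})^{o(F)-o(H)}(2t/\sqrt n)^{e(F)-e(H)}n^{v_H(F)}$ (edges/open edges inside $H$ are discarded). $t_H^*(F)=\inf\{t>0:\tilde N_H(F)(m)\le(2t)^{e(F)-e(H)}\}$; $t_H(F)=\min\{\min\{t^*_H(H'):H\subsetneq H'\subseteq F\},t^*\}$. For $t_A(F)>0$: $c(F,A)=\max\{\max_{A\subsetneq H\subseteq F}\frac{2o(H)}{2v_A(H)-e(H)},2\}$. $\Delta(F,H)=\big(C^3v_H(F)^2+2(e(F)-e(H))+(o(F)-o(H))\big)^C$; $\Delta(F,H,A)=\Delta(F,H)+\Delta(H,A)$; $\gamma(F,A)=\Delta(F,A)-e(F)-2$; $f_{F,A}(t)=e^{C(o(F)+1)(t^2+1)}n^{-1/4}(\log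 n)^{\Delta(F,A)-\sqrt{\Delta(F,A)}}$; $g_{F,A}(t)=e^{c(F,A)t^2}n^{-1/4}(\log n)^{\gamma(F,A)}$. Faithful: $\phi:A\to V(G_m)$ injective is faithful at time $t$ if the structure on $V(F)$ with open edges $O(F)$ and edges $E(F)\cup\{ab: a,b\in A,\ \phi(a)\phi(b)\in E(G_m)\}$ is permissible. $N_\phi(F)(m)$ = number of injective $\psi:V(F)\to V(G_m)$ with $\psi|_A=\phi$ mapping $E(F)$ into $E(G_m)$ and $O(F)$ into $O(G_m)$. *)

(* Defs.v *)
(* MathComp / MathComp-Analysis *)
From HB Require Import structures.
From mathcomp Require Export all_boot all_order all_algebra.
From mathcomp Require Export all_classical all_reals all_analysis.
Set Implicit Arguments.
Unset Strict Implicit.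
Unset Printing Implicit Defensive.
Import Order.TTheory GRing.Theory Num.Theory.
Import numFieldNormedType.Exports.
Local Open Scope ring_scope.

(* [in_pm x a b] is x \in a ± b. *)
Definition in_pm (R : realType) (x a b : R) : Prop := a - b <= x <= a + b.

(* The three sides of a triangle: three distinct pairs inside a 3-set. *)
Definition triangle (V : finType) (e f g : {set V}) : bool :=
  [&& #|e| == 2%N, #|f| == 2%N, #|g| == 2%N, uniq [:: e; f; g]
    & #|e :|: f :|: g| == 3%N].

(** * The triangle-free process on [n] *)

(* A graph on 'I_n is identified with its edge set. *)
Definition graph (n : nat) := {set {set 'I_n}}.

Definition nbrs n (G : graph n) (v : 'I_n) : {set 'I_n} :=
  [set u | (u != v) && ([set u; v] \in G)].

Definition open_edges n (G : graph n) : {set {set 'I_n}} :=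
  [set e : {set 'I_n} | [&& #|e| == 2%N, e \notin G
                          & [forall v, ~~ (e \subset nbrs G v)]]].

(* Once no open edge is left the process stays where it is. *)
Definition tfp_step (R : realType) n (G G' : graph n) : R :=
  if open_edges G == finset.set0 then (G' == G)%:R
  else #|[set e in open_edges G | G' == e |: G]|%:R / #|open_edges G|%:R.

(* Law of the trajectory (G_0, ..., G_m). *)
Definition tfp_law (R : realType) n m (w : {ffun 'I_m.+1 -> graph n}) : R :=
  (w ord0 == finset.set0)%:R *
  \prod_(i < m) tfp_step R (w (inord i)) (w (inord i.+1)).

(* Probability of an event about (G_0, ..., G_m), written as a predicate on
   [G : nat -> graph n] that should only inspect [G i] for i <= m. *)
Definition tfp_prob (R : realType) n m (E : (nat -> graph n) -> Prop) : R :=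
  \sum_(w : {ffun 'I_m.+1 -> graph n} | `[< E (fun i => w (inord i)) >])
    tfp_law R w.

Definition Y_ n (G : graph n) (e : {set 'I_n}) : nat :=
  #|[set f in open_edges G | [exists g in G, triangle e f g]]|.

Definition X_ n (G : graph n) (e : {set 'I_n}) : nat :=
  #|[set f in open_edges G | [exists g in open_edges G, triangle e f g]]|.

Definition Z_ n (G : graph n) (u v : 'I_n) : nat :=
  #|nbrs G u :&: nbrs G v|.

Definition Q_ n (G : graph n) : nat := #|open_edges G|.

Definition open_avg (R : realType) n (G : graph n) (W : {set 'I_n} -> nat) : R :=
  (\sum_(e in open_edges G) (W e)%:R) / (Q_ G)%:R.

(** * Scaling and trajectories

   The tilde functions take a real number of steps [m], since they are also
   evaluated at [n^(3/2)]. *)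

Definition n32 (R : realType) (n : nat) : R := n%:R `^ (3 / 2).

Definition time (R : realType) (n : nat) (m : R) : R := m * n%:R `^ (- (3 / 2)).

Definition tmax (R : realType) (eps : R) (n : nat) : R :=
  ((2 * Num.sqrt 2)^-1 - eps) * Num.sqrt (ln n%:R).

Definition mmax (R : realType) (eps : R) (n : nat) : R := tmax eps n * n32 R n.

Definition Qtilde (R : realType) (n : nat) (m : R) : R :=
  expR (- (4 * time n m ^+ 2)) * 'C(n, 2)%:R.

Definition Xtilde (R : realType) (n : nat) (m : R) : R :=
  2 * expR (- (8 * time n m ^+ 2)) * n%:R.

Definition Ytilde (R : realType) (n : nat) (m : R) : R :=
  4 * time n m * expR (- (4 * time n m ^+ 2)) * Num.sqrt n%:R.

Definition f_y (R : realType) (C : R) (n : nat) (t : R) : R :=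
  expR (C * t ^+ 2) * n%:R `^ (- (1 / 4)) * ln n%:R `^ (5 / 2).

Definition g_y (R : realType) (n : nat) (t : R) : R :=
  expR (2 * t ^+ 2) * n%:R `^ (- (1 / 4)) * ln n%:R ^+ 4.

Definition g_q (R : realType) (n : nat) (t : R) : R :=
  expR (2 * t ^+ 2) * n%:R `^ (- (1 / 4)) * ln n%:R ^+ 3.

(** * The events; [w] stands for the value of omega at [n] *)

Definition event_Y (R : realType) (C w : R) n (m' : nat) (G : nat -> graph n) : Prop :=
  (forall m e, (m <= m')%N -> m%:R <= w * n32 R n -> e \in open_edges (G m) ->
     in_pm (R := R) (Y_ (G m) e)%:R (Ytilde n m%:R)
           (f_y C n (time n m%:R) * Ytilde n (n32 R n))) /\
  (forall m e, (m <= m')%N -> w * n32 R n < m%:R -> e \in open_edges (G m) ->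
     in_pm (R := R) (Y_ (G m) e)%:R (Ytilde n m%:R)
           (g_y n (time n m%:R) * Ytilde n m%:R)).

Definition event_Z (R : realType) n (m' : nat) (G : nat -> graph n) : Prop :=
  forall m (u v : 'I_n), (m <= m')%N -> u != v ->
    (Z_ (G m) u v)%:R <= ln n%:R ^+ 2 :> R.

Definition event_Q (R : realType) (eps C w : R) n (m' : nat) (G : nat -> graph n) : Prop :=
  (forall m, (m <= m')%N -> m%:R <= w * n32 R n ->
     in_pm (R := R) (Q_ (G m))%:R (Qtilde n m%:R)
           (eps * f_y C n (time n m%:R) * Qtilde n (n32 R n))) /\
  (forall m, (m <= m')%N -> w * n32 R n < m%:R ->
     [/\ in_pm (open_avg R (G m) (X_ (G m)) / Xtilde n m%:R) 1 (g_q n (time n m%:R)),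
         in_pm (open_avg R (G m) (Y_ (G m)) / Ytilde n m%:R) 1 (g_q n (time n m%:R))
       & in_pm (R := R) ((Q_ (G m))%:R / Qtilde n m%:R) 1 (g_q n (time n m%:R))]).

Definition event_K (R : realType) (eps C w : R) n (m' : nat) (G : nat -> graph n) : Prop :=
  [/\ event_Y C w m' G, event_Z R m' G & event_Q eps C w m' G].

(** * Graph structures *)

Record graph_structure (V : finType) := GraphStructure {
  gsE : {set {set V}};
  gsO : {set {set V}};
  gsE_pairs : forall e, e \in gsE -> #|e| = 2%N;
  gsO_pairs : forall e, e \in gsO -> #|e| = 2%N;
  gs_disjoint : [disjoint gsE & gsO] }.

Definition permissible (V : finType) (E O : {set {set V}}) : Prop :=
  forall e f g, e \in E :|: O -> f \in E :|: O -> g \in E :|: O ->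
    triangle e f g -> (2 <= (e \in O) + (f \in O) + (g \in O))%N.

Definition graph_structure_pair (V : finType) (F : graph_structure V)
    (A : {set V}) : Prop :=
  permissible (gsE F) (gsO F) /\
  (forall e, e \in gsE F :|: gsO F -> ~~ (e \subset A)).

Definition no_isolated (V : finType) (F : graph_structure V) : Prop :=
  forall v : V, exists2 e, e \in gsE F :|: gsO F & v \in e.

(* Induced sub-structures of [F] are identified with their vertex sets; [F]
   itself is [setT]. In all the definitions below with arguments [F H K], the
   sets satisfy H \subset K, and the quantity is that of the structure induced
   on [K] relative to [H], so the natural-number subtractions are exact. *)
Definition ecount (V : finType) (F : graph_structure V) (H : {set V}) : nat :=
  #|[set e in gsE F | e \subset H]|.

Definition ocount (V : finType) (F : graph_structure V) (H : {set V}) : nat :=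
  #|[set e in gsO F | e \subset H]|.

Definition e_rel (V : finType) (F : graph_structure V) (H K : {set V}) : nat :=
  (ecount F K - ecount F H)%N.

Definition o_rel (V : finType) (F : graph_structure V) (H K : {set V}) : nat :=
  (ocount F K - ocount F H)%N.

Definition v_rel (V : finType) (H K : {set V}) : nat := (#|K| - #|H|)%N.

Definition Ntilde (R : realType) (V : finType) (F : graph_structure V)
    (H K : {set V}) (n : nat) (m : R) : R :=
  expR (- (4 * time n m ^+ 2)) ^+ o_rel F H K *
  (2 * time n m / Num.sqrt n%:R) ^+ e_rel F H K *
  n%:R ^+ v_rel H K.

(* t^*_H(K), possibly +oo (infimum of the empty set). *)
Definition tstar_rel (R : realType) (V : finType) (F : graph_structure V)
    (H K : {set V}) (n : nat) : \bar R :=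
  ereal_inf [set s%:E | s in
    [set s : R | 0 < s /\
       Ntilde F H K n (s * n32 R n) <= (2 * s) ^+ e_rel F H K]]%classic.

(* t_H(F) *)
Definition t_rel (R : realType) (eps : R) (V : finType) (F : graph_structure V)
    (H : {set V}) (n : nat) : \bar R :=
  mine (\big[mine/+oo%E]_(K : {set V} | H \proper K) tstar_rel R F H K n)
       (tmax eps n)%:E.

Definition c_exp (R : realType) (V : finType) (F : graph_structure V)
    (A : {set V}) : R :=
  \big[Num.max/2]_(H : {set V} | A \proper H)
    (2 * (ocount F H)%:R / (2 * (v_rel A H)%:R - (ecount F H)%:R)).

(* Delta(K, H) *)
Definition Delta (R : realType) (C : R) (V : finType) (F : graph_structure V)
    (H K : {set V}) : R :=
  (C ^+ 3 * (v_rel H K)%:R ^+ 2 + 2 * (e_rel F H K)%:R + (o_rel F H K)%:R) `^ C.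

(* Delta(F, H, A) *)
Definition Delta3 (R : realType) (C : R) (V : finType) (F : graph_structure V)
    (A H : {set V}) : R :=
  Delta C F H [set: V] + Delta C F A H.

Definition gamma_exp (R : realType) (C : R) (V : finType) (F : graph_structure V)
    (A : {set V}) : R :=
  Delta C F A [set: V] - (ecount F [set: V])%:R - 2.

Definition f_err (R : realType) (C : R) (V : finType) (F : graph_structure V)
    (A : {set V}) (n : nat) (t : R) : R :=
  expR (C * ((ocount F [set: V])%:R + 1) * (t ^+ 2 + 1)) * n%:R `^ (- (1 / 4)) *
  ln n%:R `^ (Delta C F A [set: V] - Num.sqrt (Delta C F A [set: V])).

Definition g_err (R : realType) (C : R) (V : finType) (F : graph_structure V)
    (A : {set V}) (n : nat) (t : R) : R :=
  expR (c_exp R F A * t ^+ 2) * n%:R `^ (- (1 / 4)) *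
  ln n%:R `^ gamma_exp C F A.

(* An injection A -> V(G) is represented by a map on all of V that is injective
   on A; only its values on A matter, here and in [Ncopies]. *)
Definition faithful (V : finType) (F : graph_structure V) (A : {set V})
    n (G : graph n) (phi : V -> 'I_n) : Prop :=
  permissible
    (gsE F :|: [set e : {set V} | [&& #|e| == 2%N, e \subset A & phi @: e \in G]])
    (gsO F).

Definition Ncopies (V : finType) (F : graph_structure V) (A : {set V})
    n (G : graph n) (phi : V -> 'I_n) : nat :=
  #|[set psi : {ffun V -> 'I_n} |
      [&& injectiveb psi, [forall a in A, psi a == phi a],
          [forall e in gsE F, psi @: e \in G]
        & [forall e in gsO F, psi @: e \in open_edges G]]]|.

(* The minimal H is taken with respect to inclusion. *)
Definition tracked (R : realType) (eps C w : R) (V : finType)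
    (F : graph_structure V) (A : {set V}) n (m : nat) (G : graph n)
    (phi : V -> 'I_n) : Prop :=
  let t : R := time n m%:R in
  let tA := t_rel eps F A n in
  let N : R := (Ncopies F A G phi)%:R in
  [/\ 0 < t <= w -> (w%:E < tA)%E ->
        in_pm N (Ntilde F A [set: V] n m%:R)
              (f_err C F A n t * Ntilde F A [set: V] n (n32 R n)),
      w < t -> (t%:E <= tA)%E ->
        in_pm N (Ntilde F A [set: V] n m%:R)
              (g_err C F A n t * Ntilde F A [set: V] n m%:R)
    & (tA < t%:E)%E ->
        forall H : {set V},
          minset (fun K : {set V} => (A \proper K) && (t%:E < t_rel eps F K n)%E) H ->
          N <= ln n%:R `^ Delta3 C F A H *
               Ntilde F H [set: V] n (Num.max m%:R (n32 R n))].

(* Main.v *)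
Require Import Defs.
From mathcomp Require Import ring lra zify.
Set Implicit Arguments.
Unset Strict Implicit.
Unset Printing Implicit Defensive.
Import Order.TTheory GRing.Theory Num.Theory.
Import numFieldNormedType.Exports.
Local Open Scope ring_scope.

(** Fix a copy pattern and give every injective extension the weight equal to its
    conditional expected future: each pair still to be closed into an edge counts
    [kap] times the remaining number of steps, each pair that must stay open counts
    [exp(4 t^2)] relative to the final time.  The weighted sum is almost a
    martingale on the event K.  Moment bounds for all sub-copies control its jumps,
    so an exponential supermartingale gives the concentration, and the number of
    copies past [t_A(F)] is bounded by the same moments, the dominating term being
    the minimiser of a submodular exponent. *)

(** The structure [F] is quantified after [n], so its size is unbounded, and the proof splits
    according to whether |V| + e(F) + o(F) exceeds log n. Above log n every claim is deterministic:
    [Delta] grows at least like the fourth power of e(F) + o(F), and log n raised to such an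
    exponent outweighs the trivial bound n^|V - A|. Below it, factors such as 2^|V| are powers of
    log n which [Delta] absorbs.

    No stopping times occur: each supermartingale carries the indicator of a good past.

    Two effects disturb the martingale property. Choosing a missing edge can close another pair of
    the same copy; this needs an edge outside the pattern, hence is rarer by a factor rho. An edge
    between images of [A] may close pairs in too many copies at once; this makes phi unfaithful, so
    an indicator of faithfulness is carried along. The same rho governs the jumps: a copy affected
    by one new edge has a further root, a further edge, or a pendant edge to a vertex outside it.
    Moments of order (log n)^3 of these enriched counts pay for a union bound over all of them. *)

(** * Expectations along trajectories and exponential supermartingales *)

Section Trajectories.
Variables (R : realType) (n : nat).
Implicit Types (G : graph n) (g : nat -> graph n).

Definition Estep G (F : graph n -> R) : R := \sum_G' tfp_step R G G' * F G'.

Lemma EstepE G F : open_edges G != finset.set0 ->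
  Estep G F = (\sum_(f in open_edges G) F (f |: G)) / (Q_ G)%:R.
Proof.
move=> Oneq; rewrite /Estep /tfp_step (negbTE Oneq).
under eq_bigr => G' _.
  rewrite -sum1_card natr_sum mulrAC big_distrl /=.
  under eq_bigl => e do rewrite inE.
  rewrite big_mkcondr /=.
  over.
rewrite -mulr_suml exchange_big /= /Q_; congr (_ / _).
apply: eq_bigr => f _; rewrite (bigD1 (f |: G)) //= eqxx mul1r big1 ?addr0 // => G'.
by move=> /negbTE ->.
Qed.

Lemma tfp_step_ge0 G G' : 0 <= tfp_step R G G'.
Proof. by rewrite /tfp_step; case: ifP => _; rewrite ?divr_ge0 ?ler0n. Qed.

Lemma Estep_cst G (c : R) : Estep G (fun=> c) = c.
Proof.
have [z0|nz0] := eqVneq (open_edges G) finset.set0; last first.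
  rewrite EstepE // sumr_const -[c *+ _]mulr_natr -mulrA divff ?mulr1 //.
  by rewrite pnatr_eq0 cards_eq0.
rewrite /Estep /tfp_step z0 eqxx (bigD1 G) //= eqxx mul1r big1 ?addr0 //.
by move=> G' /negbTE ->; rewrite mul0r.
Qed.

Lemma ler_Estep G (F F' : graph n -> R) :
  (forall G', F G' <= F' G') -> Estep G F <= Estep G F'.
Proof. by move=> le; apply: ler_sum => G' _; rewrite ler_wpM2l ?tfp_step_ge0. Qed.

Definition EX m (H : (nat -> graph n) -> R) : R :=
  \sum_(w : {ffun 'I_m.+1 -> graph n}) tfp_law R w * H (fun i => w (inord i)).

Definition looks_to m (H : (nat -> graph n) -> R) : Prop :=
  forall g g', (forall i, (i <= m)%N -> g i = g' i) -> H g = H g'.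

Definition upd g m G i := if i == m then G else g i.

Lemma tfp_law_ge0 m (w : {ffun 'I_m.+1 -> graph n}) : 0 <= tfp_law R w.
Proof.
by rewrite /tfp_law mulr_ge0 ?ler0n // prodr_ge0 // => i _; exact: tfp_step_ge0.
Qed.

Definition extend m (p : {ffun 'I_m.+1 -> graph n} * graph n) :
    {ffun 'I_m.+2 -> graph n} :=
  [ffun i : 'I_m.+2 => if val i == m.+1 then p.2 else p.1 (inord i)].

Definition retract m (w : {ffun 'I_m.+2 -> graph n}) :
    {ffun 'I_m.+1 -> graph n} * graph n :=
  ([ffun i : 'I_m.+1 => w (inord i)], w (inord m.+1)).

Lemma extendK m : cancel (@extend m) (@retract m).
Proof.
case=> w G; rewrite /retract /extend /=; congr (_, _); last by rewrite ffunE inordK ?eqxx.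
apply/ffunP => i; rewrite !ffunE /= inordK; last by rewrite ltnS ltnW.
by rewrite ltn_eqF // inord_val.
Qed.

Lemma retractK m : cancel (@retract m) (@extend m).
Proof.
move=> w; apply/ffunP => i; rewrite !ffunE /=; case: eqP => [im|/eqP im].
  by congr (w _); apply: val_inj; rewrite /= inordK.
congr (w _); apply: val_inj => /=.
have im' : (i < m.+1)%N by rewrite ltn_neqAle im /= -ltnS; exact: (ltn_ord i).
by rewrite !inordK // ltnW.
Qed.

Lemma tfp_law_extend m (w : {ffun 'I_m.+1 -> graph n}) (G : graph n) :
  tfp_law R (extend (w, G)) = tfp_law R w * tfp_step R (w (inord m)) G.
Proof.
have lo i : (i <= m)%N -> (extend (w, G) : {ffun 'I_m.+2 -> graph n}) (inord i) = w (inord i).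
  by move=> im; rewrite ffunE /= inordK ?ltnS ?leqW // ltn_eqF.
rewrite /tfp_law big_ord_recr /= -mulrA; congr (_ * _); last congr (_ * _).
- have -> : ord0 = inord 0 :> 'I_m.+2 by apply: val_inj; rewrite /= inordK.
  rewrite lo //; congr ((w _ == _)%:R).
  by apply: val_inj; rewrite /= inordK.
- by apply: eq_bigr => i _; rewrite !lo // ltnW.
- by rewrite lo // ffunE /= inordK ?eqxx.
Qed.

(** Tower property: a trajectory of length m+1 is a trajectory of length m with one more graph
    ([extend], [retract]), and the law factors accordingly. *)
Lemma EX_S m H : looks_to m.+1 H ->
  EX m.+1 H = EX m (fun g => Estep (g m) (fun G' => H (upd g m.+1 G'))).
Proof.
move=> dH; rewrite /EX (reindex (@extend m)) /=; last first.
  by exists (@retract m) => w _; rewrite ?extendK ?retractK.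
rewrite -(pair_bigA _ (fun w G => tfp_law R (extend (w, G)) *
  H (fun i => (extend (w, G) : {ffun 'I_m.+2 -> graph n}) (inord i)))) /=.
apply: eq_bigr => w _; rewrite /Estep big_distrr /=; apply: eq_bigr => G _.
rewrite tfp_law_extend -mulrA; congr (_ * (_ * _)); apply: dH => i im.
by rewrite /upd ffunE /= inordK.
Qed.

Lemma EX0 H : EX 0 H = H (fun=> finset.set0).
Proof.
rewrite /EX (bigD1 [ffun=> finset.set0]) //= big1 ?addr0.
  rewrite /tfp_law big_ord0 ffunE eqxx !mul1r; congr H.
  by apply: funext => i; rewrite ffunE.
move=> w nw; rewrite /tfp_law; case: eqP => [w0|]; last by rewrite !mul0r.
case/eqP: nw; apply/ffunP => i; rewrite ffunE -w0; congr (w _).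
by apply: val_inj; case: i => [] [].
Qed.

Lemma ler_EX m H H' : (forall g, H g <= H' g) -> EX m H <= EX m H'.
Proof. by move=> le; apply: ler_sum => w _; rewrite ler_wpM2l ?tfp_law_ge0. Qed.

Lemma EX_marginal m k H : looks_to m H -> EX (m + k) H = EX m H.
Proof.
move=> dH; elim: k => [|k IHk]; first by rewrite addn0.
rewrite addnS EX_S => [|g g' gg']; last by apply: dH => i im; rewrite gg' // leqW // (leq_trans im) ?leq_addr.
rewrite -IHk; congr EX; apply: funext => g.
rewrite -[RHS](Estep_cst (g (m + k)%N)); congr Estep; apply: funext => G'.
apply: dH => i im; rewrite /upd ltn_eqF //.
by rewrite ltnS (leq_trans im) ?leq_addr.
Qed.

Lemma EX_cst m (c : R) : EX m (fun=> c) = c.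
Proof. by rewrite -[m]add0n EX_marginal // EX0. Qed.

Lemma EXZ m (c : R) H : EX m (fun g => c * H g) = c * EX m H.
Proof. by rewrite /EX big_distrr /=; apply: eq_bigr => w _; rewrite mulrCA. Qed.

Lemma EX_sum m (I : finType) (P : pred I) (H : I -> (nat -> graph n) -> R) :
  EX m (fun g => \sum_(j | P j) H j g) = \sum_(j | P j) EX m (H j).
Proof.
by rewrite /EX exchange_big /=; apply: eq_bigr => w _; rewrite big_distrr.
Qed.

Lemma tfp_probE m (E : (nat -> graph n) -> Prop) :
  tfp_prob R m E = EX m (fun g => `[< E g >]%:R).
Proof.
rewrite /tfp_prob /EX big_mkcond; apply: eq_bigr => w _.
by case: ifP; rewrite ?mulr1 ?mulr0.
Qed.

Lemma tfp_probC m (E : (nat -> graph n) -> Prop) :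
  tfp_prob R m E = 1 - tfp_prob R m (fun g => ~ E g).
Proof.
apply/eqP; rewrite eq_sym subr_eq !tfp_probE; apply/eqP.
rewrite -[LHS](EX_cst m) /EX -big_split /=; apply: eq_bigr => w _.
rewrite -mulrDr; congr (_ * _).
by rewrite asbool_neg; case: `[< E _ >]; rewrite /= ?addr0 ?add0r.
Qed.

Lemma ler_tfp_prob m (E E' : (nat -> graph n) -> Prop) :
  (forall g, E g -> E' g) -> tfp_prob R m E <= tfp_prob R m E'.
Proof.
move=> EE'; rewrite !tfp_probE; apply: ler_EX => g; rewrite ler_nat.
by case: (asboolP (E g)) => // /EE' E'g; case: asboolP.
Qed.

Lemma tfp_prob_exists m (I : finType) (E : I -> (nat -> graph n) -> Prop) (c : R) :
  (forall j, tfp_prob R m (E j) <= c) ->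
  tfp_prob R m (fun g => exists j, E j g) <= #|I|%:R * c.
Proof.
move=> le; rewrite mulr_natl -sumr_const tfp_probE.
apply: (@le_trans _ _ (\sum_(j in I) tfp_prob R m (E j))); last exact: ler_sum.
under eq_bigr do rewrite tfp_probE.
rewrite -EX_sum; apply: ler_EX => g.
case: asboolP => [[j Ej]|_]; last by apply: sumr_ge0 => j _; rewrite ler0n.
by rewrite (bigD1 j) //= (asboolT Ej) lerDl sumr_ge0 // => i _; rewrite ler0n.
Qed.

Lemma tfp_prob_or m (E E' : (nat -> graph n) -> Prop) :
  tfp_prob R m (fun g => E g \/ E' g) <= tfp_prob R m E + tfp_prob R m E'.
Proof.
rewrite !tfp_probE /EX -big_split /=; apply: ler_sum => w _.
rewrite -mulrDr ler_wpM2l ?tfp_law_ge0 //.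
by rewrite asbool_or; do 2![case: `[< _ >]]; rewrite /= ?addr0 ?add0r // lerDl.
Qed.

(** The indicator of a good past replaces a stopping time: after a bad step the integrand vanishes
    for ever, so the one-step inequality is needed only at good graphs. The last graph [g m] need
    not be good. *)
Lemma EX_supermartingale m (good : nat -> graph n -> Prop) (f : nat -> graph n -> R)
    (c : nat -> R) :
  (forall i G, 0 <= f i G) ->
  (forall i G, (i < m)%N -> good i G -> Estep G (f i.+1) <= expR (c i) * f i G) ->
  EX m (fun g => `[< forall i, (i < m)%N -> good i (g i) >]%:R * f m (g m)) <=
  expR (\sum_(i < m) c i) * f 0%N finset.set0.
Proof.
move=> f0; elim: m => [|m IHm] step.
  rewrite EX0 big_ord0 expR0 mul1r ler_piMl //.
  by case: `[< _ >]; rewrite ?lexx ?ler01.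
rewrite EX_S; last first.
  move=> g g' gg'; rewrite gg' //; congr ((nat_of_bool _)%:R * _).
  by apply: asbool_equiv_eq; split=> H i im; move: (H i im); rewrite gg' // ltnW.
rewrite big_ord_recr /= addrC expRD -mulrA.
apply: (@le_trans _ _ (expR (c m) * EX m (fun g =>
   `[< forall i, (i < m)%N -> good i (g i) >]%:R * f m (g m)))); last first.
  by rewrite ler_pM2l ?expR_gt0 // IHm // => i G im; apply: step; rewrite ltnW.
rewrite -EXZ; apply: ler_EX => g.
case: (asboolP (forall i, (i < m.+1)%N -> good i (g i))) => gd.
  rewrite asboolT ?mul1r; last by move=> i im; apply: gd; rewrite ltnW.
  apply: le_trans (step m (g m) (ltnSn m) (gd m (ltnSn m))).
  apply: ler_Estep => G'; rewrite /upd eqxx.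
  by case: `[< _ >]; rewrite ?mul1r ?mul0r.
rewrite (_ : Estep _ _ = 0) ?mulr_ge0 ?expR_ge0 ?ler0n //.
rewrite -(Estep_cst (g m) 0); congr Estep; apply: funext => G'.
rewrite asboolF ?mul0r // => gd'; apply: gd => i im.
by have := gd' i im; rewrite /upd ltn_eqF.
Qed.

(** Markov's inequality at a time [j] inside a trajectory of length [m]; the steps after [j]
    integrate out. *)
Lemma tfp_prob_markov m j (good : nat -> graph n -> Prop) (bad : graph n -> Prop)
    (f : nat -> graph n -> R) (c : nat -> R) (s : R) :
  (j <= m)%N ->
  (forall i G, 0 <= f i G) ->
  (forall i G, (i < j)%N -> good i G -> Estep G (f i.+1) <= expR (c i) * f i G) ->
  (forall G, bad G -> s <= f j G) ->
  s * tfp_prob R m (fun g => (forall i, (i < j)%N -> good i (g i)) /\ bad (g j)) <=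
  expR (\sum_(i < j) c i) * f 0%N finset.set0.
Proof.
move=> jm f0 step bf; apply: le_trans (EX_supermartingale f0 step).
rewrite tfp_probE -(subnKC jm) EX_marginal -?EXZ; last first.
  move=> g g' gg'; congr ((nat_of_bool _)%:R); rewrite (gg' j) //.
  by apply: asbool_equiv_eq; split=> [] [H1 H2]; split=> // i ij;
     move: (H1 i ij); rewrite gg' // ltnW.
apply: ler_EX => g; rewrite asbool_and.
case: (asboolP (forall i, _)) => _; last by rewrite mulr0 mul0r.
by case: (asboolP (bad _)) => [/bf|_]; rewrite ?mulr1 ?mulr0 ?mul1r.
Qed.

End Trajectories.

(** * Triangles and a Bonferroni inequality *)

Section Triangles.
Variable V : finType.
Implicit Types (e f g : {set V}) (a b c : V).

Lemma pair_other e a : #|e| = 2%N -> a \in e -> exists2 b, a != b & e = [set a; b].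
Proof.
move=> /eqP /cards2P [x [y [xy ->]]]; rewrite !inE => /orP [] /eqP ->; first by exists y.
by exists x; rewrite 1?eq_sym // finset.setUC.
Qed.

Lemma triangleP e f g :
  reflect (exists a b c, [/\ a != b, a != c & b != c] /\
             [/\ e = [set a; b], f = [set a; c] & g = [set b; c]])
          (triangle e f g).
Proof.
apply: (iffP idP); last first.
  move=> [a [b [c [[ab ac bc] [-> -> ->]]]]]; rewrite /triangle !cards2 ab ac bc /=.
  apply/andP; split; rewrite ?inE ?negb_or -?andbA.
    apply/and4P; split=> //; apply/eqP => /setP E.
    - by move: (E b); rewrite !inE eqxx orbT [b == a]eq_sym (negbTE ab) (negbTE bc).
    - by move: (E a); rewrite !inE eqxx (negbTE ab) (negbTE ac).
    - by move: (E a); rewrite !inE eqxx (negbTE ab) (negbTE ac).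
  rewrite (_ : _ :|: _ = [set a; b; c]).
    by rewrite -finset.setUA cardsU1 cards2 bc !inE negb_or ab ac.
  by apply/setP => x; rewrite !inE; do 3![case: (x == _)].
rewrite /triangle => /and5P [/eqP e2 /eqP f2 /eqP g2].
rewrite /= !inE negb_or andbT => /andP [/andP [ef eg] fg] /eqP u3.
have efle : (#|e :|: f| <= 3)%N by rewrite -u3 subset_leq_card ?finset.subsetUl.
have /card_gt0P [a] : (0 < #|e :&: f|)%N.
  by have := cardsUI e f; rewrite e2 f2; lia.
rewrite inE => /andP [ae af].
have [b ab eE] := pair_other e2 ae; have [c ac fE] := pair_other f2 af.
have bc : b != c by apply: contraNneq ef => bc; rewrite eE fE bc.
have ef3 : #|e :|: f| = 3%N.
  rewrite eE fE (_ : _ :|: _ = [set a; b; c]).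
    by rewrite -finset.setUA cardsU1 cards2 bc !inE negb_or ab ac.
  by apply/setP => x; rewrite !inE; do 3![case: (x == _)].
have gs : g \subset e :|: f.
  have /eqP -> : e :|: f == e :|: f :|: g by rewrite eqEcard finset.subsetUl u3 ef3.
  by rewrite finset.subsetUr.
exists a, b, c; split=> //; split=> //.
have ag : a \notin g.
  apply/negP => ag; have [d ad gE] := pair_other g2 ag.
  have : d \in e :|: f by rewrite (fintype.subsetP gs) // gE !inE eqxx orbT.
  rewrite eE fE !inE ![d == a]eq_sym (negbTE ad) /= => /orP [] /eqP dd.
    by move: eg; rewrite eE gE dd eqxx.
  by move: fg; rewrite fE gE dd eqxx.
apply/eqP; rewrite eqEcard g2 cards2 bc andbT; apply/fintype.subsetP => x xg.
have := fintype.subsetP gs x xg; rewrite eE fE !inE.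
have -> : x == a = false by apply: contraNF ag => /eqP <-.
by [].
Qed.

Lemma triangle_sym e f g : triangle e f g = triangle f e g.
Proof.
by apply/triangleP/triangleP => -[a [b [c [[ab ac bc] [eE fE gE]]]]];
   exists a, c, b; split; split=> //; rewrite 1?eq_sym // finset.setUC.
Qed.
End Triangles.

(** Pointwise: a point lying in s >= 1 of the sets contributes s on the left and 1 + s(s-1) on the
    right, as the pairs are ordered. *)
Lemma bonferroni (I T : finType) (D : {set I}) (B : I -> {set T}) :
  (\sum_(r in D) #|B r| <= #|\bigcup_(r in D) B r| +
     \sum_(r in D) \sum_(r' in D | r' != r) #|B r :&: B r'|)%N.
Proof.
have cE (X : {set T}) : #|X| = (\sum_t (t \in X))%N.
  by rewrite -sum1_card big_mkcond; apply: eq_bigr => t _; case: (t \in X).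
under eq_bigr do rewrite cE.
rewrite exchange_big /= cE.
under [X in (_ + X)%N]eq_bigr => r _.
  under eq_bigr do rewrite cE.
  rewrite exchange_big /=; over.
rewrite [X in (_ + X)%N]exchange_big /= -big_split /=.
apply: leq_sum => t _.
pose S := [set r in D | t \in B r].
have -> : (\sum_(r in D) (t \in B r))%N = #|S|.
  rewrite -sum1_card [RHS](eq_bigl (fun r => (r \in D) && (t \in B r))) => [|r]; last by rewrite inE.
  by rewrite big_mkcondr; apply: eq_bigr => r _; case: (t \in B r).
have [->|S0] := posnP #|S|; first by [].
have /card_gt0P [r0] := S0; rewrite inE => /andP [r0D tr0].
have -> : (t \in \bigcup_(r in D) B r) by apply/finset.bigcupP; exists r0.
have -> : (\sum_(r in D) \sum_(r' in D | r' != r) (t \in B r :&: B r') = \sum_(r in S) (#|S| - 1))%N.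
  rewrite [RHS](eq_bigl (fun r => (r \in D) && (t \in B r))) => [|r]; last by rewrite inE.
  rewrite [RHS]big_mkcondr; apply: eq_bigr => r rD.
  case: ifP => tr; last by rewrite big1 // => r' _; rewrite inE tr.
  rewrite (cardsD1 r S) inE rD tr addKn -sum1_card.
  rewrite [RHS](eq_bigl (fun r' => ((r' \in D) && (r' != r)) && (t \in B r'))) => [|r']; last first.
    by rewrite !inE; case: (r' == r); rewrite ?andbF ?andbT.
  by rewrite [RHS]big_mkcondr; apply: eq_bigr => r' _; rewrite inE tr; case: (t \in B r').
rewrite sum_nat_const; case: #|S| S0 => // d _; rewrite subn1 /= add1n ltnS.
by rewrite mulSn leq_addr.
Qed.

(** * Open pairs closed by a new edge *)

Section Kills.
Variable n : nat.
Implicit Types (G : graph n) (e f r : {set 'I_n}).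

Definition kills G f r := (f == r) || [exists g in G, triangle r f g].

Lemma open_edgesP G r :
  reflect [/\ #|r| = 2%N, r \notin G & forall v, ~~ (r \subset nbrs G v)] (r \in open_edges G).
Proof.
rewrite inE; apply: (iffP and3P) => [[/eqP ? ? /forallP ?]|[r2 rG rv]] //.
by split; rewrite ?r2 //; apply/forallP.
Qed.

(** A pair that stops being open either is [f] or acquires a common neighbour one of whose two links
    is the new edge [f]; the other link is then an edge of [G]. *)
Lemma open_add G f r : f \in open_edges G ->
  (r \in open_edges (f |: G)) = (r \in open_edges G) && ~~ kills G f r.
Proof.
move=> fO; have [f2 fG _] := open_edgesP _ _ fO.
have sub v : nbrs G v \subset nbrs (f |: G) v.
  by apply/fintype.subsetP => u; rewrite !inE => /andP [-> ->]; rewrite orbT.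
apply/idP/andP.
  move=> /open_edgesP [r2]; rewrite !inE negb_or => /andP [rf rG] rv; split.
    by apply/and3P; split; rewrite ?r2 //; apply/forallP => v;
       apply: contra (rv v) => /fintype.subset_trans; apply.
  rewrite /kills negb_or eq_sym rf /=; apply/existsP => -[g /andP [gG]].
  move=> /triangleP [a [b [c [[ab ac bc] [rE fE gE]]]]].
  move/negP: (rv c); apply; apply/fintype.subsetP => x.
  by rewrite rE !inE => /orP [] /eqP ->; rewrite ?ac ?bc -?fE -?gE ?eqxx ?gG ?orbT.
move=> [rO]; rewrite /kills negb_or => /andP [fr nk].
have [r2 rG rv] := open_edgesP _ _ rO.
apply/open_edgesP; split=> // [|v]; first by rewrite !inE negb_or eq_sym fr.
apply/negP => rs; have /eqP /cards2P [a [b [ab rE]]] := r2.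
have tri (x y : 'I_n) : r = [set x; y] -> x != y -> [set x; v] = f -> [set y; v] \in f |: G ->
    x != v -> y != v -> False.
  move=> rxy xy xv yv xv' yv'; move/negP: nk; apply; apply/existsP; exists [set y; v].
  move: yv; rewrite !inE -xv => /orP [/eqP /setP /(_ x)|-> /=].
    by rewrite !inE eqxx (negbTE xy) (negbTE xv').
  by apply/triangleP; exists x, y, v; rewrite xy xv' yv'.
have mem x : x \in r -> (x != v) && ([set x; v] \in f |: G).
  by move=> xr; have := fintype.subsetP rs x xr; rewrite [x \in nbrs _ _]inE.
have /andP [av avG] : (a != v) && ([set a; v] \in f |: G) by apply: mem; rewrite rE !inE eqxx.
have /andP [bv bvG] : (b != v) && ([set b; v] \in f |: G) by apply: mem; rewrite rE !inE eqxx orbT.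
have [/esym avf|avf] := eqVneq [set a; v] f.
  by apply: (tri a b).
have [/esym bvf|bvf] := eqVneq [set b; v] f.
  by apply: (tri b a); rewrite // 1?eq_sym // rE finset.setUC.
move/negP: (rv v); apply; apply/fintype.subsetP => x.
move: avG bvG; rewrite !in_setU1 (negbTE avf) (negbTE bvf) /= => avG bvG.
by rewrite rE !inE => /orP [] /eqP ->; rewrite ?av ?bv.
Qed.

Definition kill_set G r := [set f in open_edges G | kills G f r].

(** The extra one is [r] itself: choosing it also removes it from the open pairs. *)
Lemma card_kill_set G r : r \in open_edges G -> #|kill_set G r| = (Y_ G r).+1.
Proof.
move=> rO; rewrite (cardsD1 r) inE rO /kills eqxx add1n; congr (_.+1).
apply: eq_card => f; rewrite !inE; case: (eqVneq f r) => [->|fr] /=; last first.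
  by rewrite /kills (negbTE fr).
apply/esym/negbTE; rewrite negb_and; apply/orP; right.
by apply/negP => /existsP [g /andP [_]]; rewrite /triangle /= !inE eqxx /= !andbF.
Qed.

(** A common closing pair either lies inside [r :|: r'], which leaves at most 16 ordered choices of
    its ends, or joins the common vertex [a] of [r] and [r'] to some [c] outside; then [c] is a
    common neighbour of the two other ends, so codegrees bound the number. *)
Lemma card_kill_setI G r r' : #|r| = 2%N -> #|r'| = 2%N -> r != r' ->
  (#|kill_set G r :&: kill_set G r'| <= 16)%N \/
  exists u u', u != u' /\ (#|kill_set G r :&: kill_set G r'| <= 16 + Z_ G u u')%N.
Proof.
move=> r2 r'2 rr'; set S := _ :&: _.
pose P4 := [set [set p.1; p.2] | p : 'I_n * 'I_n in finset.setX (r :|: r') (r :|: r')].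
have P4le : (#|P4| <= 16)%N.
  apply: leq_trans (leq_imset_card _ _) _; rewrite cardsX.
  have : (#|r :|: r'| <= 4)%N by have := cardsUI r r'; rewrite r2 r'2; lia.
  by move=> h4; rewrite (leq_trans (leq_mul h4 h4)).
have inS f : f \in S -> f \notin P4 -> exists a b b' c,
   [/\ a != b, a != b', a != c & [/\ r = [set a; b], r' = [set a; b'], f = [set a; c] &
       c \in nbrs G b :&: nbrs G b']].
  rewrite !inE => /andP [/andP [/and3P [/eqP f2 _ _] kr] /andP [_ kr']] fP4.
  have fU : ~~ (f \subset r :|: r').
    apply: contra fP4 => fs; have /eqP /cards2P [p [q [pq fE]]] := f2.
    apply/imsetP; exists (p, q) => //; rewrite inE /=.
    by apply/andP; split; apply: (fintype.subsetP fs); rewrite fE !inE eqxx ?orbT.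
  move: kr kr'; rewrite /kills.
  case: eqP => [fr|_ /=]; first by rewrite fr finset.subsetUl in fU.
  case: eqP => [fr|_ /=]; first by rewrite fr finset.subsetUr in fU.
  move=> /existsP [g /andP [gG /triangleP [a [b [c [[ab ac bc] [rE fE gE]]]]]]].
  move=> /existsP [g' /andP [g'G /triangleP [a' [b' [c' [[ab' ac' bc'] [rE' fE' gE']]]]]]].
  have cU : c \notin r :|: r'.
    apply: contra fU => cU; apply/fintype.subsetP => x; rewrite fE !inE => /orP [] /eqP -> //.
      by rewrite rE !inE eqxx.
    by move: cU; rewrite !inE.
  have a'c : a' != c by apply: contraNneq cU => <-; rewrite rE' !inE eqxx !orbT.
  have : a' \in f by rewrite fE' !inE eqxx.
  rewrite fE !inE (negbTE a'c) orbF => /eqP aa'.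
  have : c \in f by rewrite fE !inE eqxx orbT.
  rewrite fE' !inE eq_sym (negbTE a'c) /= => /eqP cc'.
  exists a, b, b', c; split=> //; first by rewrite -aa'.
  split=> //; first by rewrite -aa'.
  by rewrite !inE ![c == _]eq_sym bc ![[set c; _]]finset.setUC -gE gG cc' bc' -gE' g'G.
have [S0|[f fS]] := set_0Vmem (S :\: P4).
  left; apply: leq_trans P4le; apply: subset_leq_card.
  by move/eqP: S0; rewrite finset.setD_eq0.
right; move: fS; rewrite inE => /andP [fP fS].
have [a [b [b' [c [ab ab' ac [rE rE' fE cN]]]]]] := inS f fS fP.
have bb' : b != b' by apply: contraNneq rr' => bb; rewrite rE rE' bb.
exists b, b'; split=> //.
have sub : S \subset P4 :|: [set [set a; x] | x in nbrs G b :&: nbrs G b'].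
  apply/fintype.subsetP => f1 f1S; rewrite finset.in_setU; case: (boolP (f1 \in P4)) => //= f1P.
  have [a1 [b1 [b1' [c1 [ab1 ab1' ac1 [rE1 rE1' fE1 c1N]]]]]] := inS f1 f1S f1P.
  have a1a : a1 = a.
    apply/eqP; have : a1 \in r by rewrite rE1 !inE eqxx.
    have : a1 \in r' by rewrite rE1' !inE eqxx.
    rewrite rE rE' !inE; case: (a1 == a) => //= /eqP -> /eqP bb1.
    by rewrite bb1 eqxx in bb'.
  have b1b : b1 = b.
    apply/eqP; have : b1 \in r by rewrite rE1 !inE eqxx orbT.
    by rewrite rE !inE -a1a eq_sym (negbTE ab1).
  have b1b' : b1' = b'.
    apply/eqP; have : b1' \in r' by rewrite rE1' !inE eqxx orbT.
    by rewrite rE' !inE -a1a eq_sym (negbTE ab1').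
  by apply/imsetP; exists c1; rewrite -?b1b -?b1b' // fE1 a1a.
apply: leq_trans (subset_leq_card sub) _; rewrite cardsU.
apply: leq_trans (leq_subr _ _) _; apply: leq_add => //.
exact: leq_imset_card.
Qed.

Definition kill_any G (S : {set {set 'I_n}}) := \bigcup_(r in S) kill_set G r.

Lemma kill_anyP G (S : {set {set 'I_n}}) f : f \in open_edges G ->
  reflect (exists2 r, r \in S & kills G f r) (f \in kill_any G S).
Proof.
move=> fO; apply: (iffP finset.bigcupP) => [[r rS]|[r rS kr]].
  by rewrite inE => /andP [_ kr]; exists r.
by exists r; rewrite // inE fO.
Qed.

Lemma kill_any_ub G (S : {set {set 'I_n}}) : S \subset open_edges G ->
  (#|kill_any G S| <= \sum_(r in S) (Y_ G r).+1)%N.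
Proof.
move=> SO; apply: (@leq_trans (\sum_(r in S) #|kill_set G r|)%N).
  rewrite /kill_any; elim/big_rec2: _ => [|r y1 y2 _ le]; first by rewrite cards0.
  by rewrite cardsU (leq_trans (leq_subr _ _)) // leq_add2l.
by apply: leq_sum => r rS; rewrite card_kill_set // (fintype.subsetP SO).
Qed.

(** Bonferroni with the overlaps bounded by codegrees. This is where the event Z enters. *)
Lemma kill_any_lb (R : realType) G (S : {set {set 'I_n}}) (z : R) :
  S \subset open_edges G -> 0 <= z ->
  (forall u v : 'I_n, u != v -> (Z_ G u v)%:R <= z) ->
  \sum_(r in S) (Y_ G r)%:R - #|S|%:R ^+ 2 * (16 + z) <= #|kill_any G S|%:R :> R.
Proof.
move=> SO z0 Zz; rewrite lerBlDr.
have := bonferroni S (kill_set G); rewrite -(ler_nat R) natrD => bf.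
apply: (@le_trans _ _ ((\sum_(r in S) #|kill_set G r|)%N%:R)).
  rewrite natr_sum; apply: ler_sum => r rS.
  by rewrite card_kill_set ?(fintype.subsetP SO) // ler_nat.
apply: le_trans bf _; rewrite lerD2l natr_sum.
have S2 r : r \in S -> #|r| = 2%N by move=> /(fintype.subsetP SO) /open_edgesP [].
apply: (@le_trans _ _ (\sum_(r in S) #|S|%:R * (16 + z))); last first.
  by rewrite sumr_const -[X in X <= _]mulr_natl expr2 mulrA.
apply: ler_sum => r rS; rewrite natr_sum.
apply: (@le_trans _ _ (\sum_(r' in S | r' != r) (16 + z))); last first.
  rewrite sumr_const -[X in X <= _]mulr_natl ler_wpM2r ?addr_ge0 // ler_nat.
  by apply: subset_leq_card; apply/fintype.subsetP => x /andP [].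
apply: ler_sum => r' /andP [r'S r'r].
have [le|[u [u' [uu' le]]]] := card_kill_setI G (S2 _ rS) (S2 _ r'S) (introN eqP (fun E => negP r'r (introT eqP (esym E)))).
  by rewrite (le_trans (y := 16%:R)) ?ler_nat // lerDl.
apply: (@le_trans _ _ (16 + Z_ G u u')%:R); first by rewrite ler_nat.
by rewrite natrD lerD2l Zz.
Qed.

Section Valid.
Variables E T : {set {set 'I_n}}.
Hypothesis disjET : [disjoint E & T].

(** State of one potential copy that can still be completed: the pairs of [T] are to be open at the
    end, hence are open now, and a pair of [E] must be open until it is chosen. *)
Definition valid G := (T \subset open_edges G) && (E :\: G \subset open_edges G).
Definition pending G := T :|: (E :\: G).

(** Choosing a pending pair of [E] advances the copy only if it does not close another pending pair
    by means of an edge of [G]. *)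
Definition harmless G := [set f in E :\: G | [forall r in pending G, kills G f r ==> (r == f)]].

(** A copy survives the step in two exclusive ways: [f] closes nothing that is pending, or [f] is
    itself a pending pair of [E] and closes nothing else. *)
Lemma valid_add G f : f \in open_edges G -> valid G ->
  valid (f |: G) = (f \notin kill_any G (pending G)) || (f \in harmless G).
Proof.
move=> fO /andP [TO EO]; have [_ fG _] := open_edgesP _ _ fO.
apply/idP/idP.
  move=> /andP [TO' EO'].
  case: (kill_anyP (pending G) fO) => //= -[r rP kr].
  have nk r1 : r1 \in pending G -> kills G f r1 -> r1 = f /\ f \in E :\: G.
    rewrite inE => /orP [r1T|r1E] kr1.
      by have := fintype.subsetP TO' r1 r1T; rewrite open_add // kr1 andbF.
    have [fr1|fr1] := eqVneq r1 f; first by rewrite -fr1.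
    have : r1 \in E :\: (f |: G).
      by move: r1E; rewrite !inE negb_or fr1 => /andP [-> ->].
    by move=> /(fintype.subsetP EO'); rewrite open_add // kr1 andbF.
  have [_ fE] := nk r rP kr; rewrite /harmless !inE; move: (fE); rewrite !inE => -> /=.
  by apply/forall_inP => r1 r1P; apply/implyP => /(nk _ r1P) [-> _].
move=> H; have nk r : r \in pending G -> r != f -> ~~ kills G f r.
  move=> rP rf; apply/negP => kr; case/orP: H => [/(kill_anyP _ fO)|].
    by apply; exists r.
  rewrite inE => /andP [_ /forall_inP /(_ r rP) /implyP /(_ kr)].
  by rewrite (negbTE rf).
have fT : f \notin T.
  apply/negP => fT; case/orP: H => [/(kill_anyP _ fO)|].
    by apply; exists f; rewrite ?inE ?fT // /kills eqxx.
  by rewrite inE => /andP [/finset.setDP [fE _] _]; move/disjoint_setI0: disjET => /setP /(_ f); rewrite !inE fE fT.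
apply/andP; split; apply/fintype.subsetP => r.
  move=> rT; rewrite open_add // (fintype.subsetP TO) // nk // ?inE ?rT //.
  by apply: contraNneq fT => <-.
rewrite finset.in_setD finset.in_setU1 negb_or -andbA => /and3P [rf rG rE].
have rEG : r \in E :\: G by rewrite inE rG.
by rewrite open_add // (fintype.subsetP EO) // nk // inE rEG orbT.
Qed.

Lemma valid_del G f : f \in open_edges G -> valid (f |: G) -> valid G.
Proof.
move=> fO /andP [TO EO]; apply/andP; split; apply/fintype.subsetP => r rS.
  by have := fintype.subsetP TO r rS; rewrite open_add // => /andP [].
have [-> //|rf] := eqVneq r f.
have : r \in E :\: (f |: G) by move: rS; rewrite !inE negb_or rf.
by move=> /(fintype.subsetP EO); rewrite open_add // => /andP [].
Qed.

Lemma pending_add G f : f \notin G ->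
  #|E :\: (f |: G)| = (#|E :\: G| - (f \in E :\: G))%N.
Proof.
move=> fG; rewrite (cardsD1 f (E :\: G)) addKn; apply: eq_card => r.
by rewrite !inE negb_or andbA.
Qed.

Lemma pending_subset G : valid G -> pending G \subset open_edges G.
Proof. by move=> /andP [TO EO]; rewrite finset.subUset TO. Qed.

Lemma card_pending G : #|pending G| = (#|T| + #|E :\: G|)%N.
Proof.
rewrite cardsU (_ : T :&: _ = finset.set0) ?cards0 ?subn0 //.
by apply/setP => x; move/disjoint_setI0: disjET => /setP /(_ x); rewrite !inE;
   case: (x \in T); rewrite ?andbF // andbT => ->; rewrite andbF.
Qed.

Lemma harmless_kill_any G : harmless G \subset E :\: G.
Proof. by apply/fintype.subsetP => f; rewrite inE => /andP []. Qed.
End Valid.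
End Kills.

(** * One-step drift of the weight of a single copy *)

Lemma expR_le1D2x (R : realType) (u : R) : 0 <= u <= 1 / 2 -> expR u <= 1 + 2 * u.
Proof.
move=> /andP [u0 u1].
have := expR_ge1Dx (- u); rewrite expRN => h1.
have h2 : 0 < expR u by exact: expR_gt0.
have : (1 - u) * expR u <= 1 by rewrite -ler_pdivlMr // div1r.
nra.
Qed.

Lemma sum_indicator (R : realType) (T : finType) (X Y : {set T}) : Y \subset X ->
  \sum_(f in X) (f \in Y)%:R = #|Y|%:R :> R.
Proof.
move=> sYX; rewrite -sum1_card natr_sum big_mkcond [RHS]big_mkcond /=.
apply: eq_bigr => f _; case: (boolP (f \in Y)) => [/(fintype.subsetP sYX) -> //|_].
by case: ifP.
Qed.

Lemma kill_any_open n (G : graph n) S : kill_any G S \subset open_edges G.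
Proof. by apply/finset.bigcupsP => r _; apply/fintype.subsetP => f; rewrite inE => /andP []. Qed.

Section Arithmetic.
Variable R : realType.
Implicit Types (x y p h t e r q g M X : R).

Lemma kill_expo x p h t e : p * h * (8 * t - 2 * e) <= x ->
  - x + p * h * (8 * t + e) <= 3 * e * (p * h).
Proof. lra. Qed.

Lemma quarter_le1 e : e <= 1 / 4 -> e <= 1. Proof. lra. Qed.

Lemma near1 r e : `|r - 1| <= e -> 1 - e <= r /\ r <= 1 + e.
Proof. by rewrite ler_norml => /andP [? ?]; split; lra. Qed.

Lemma sqr_1D e : 0 <= e <= 1 / 4 -> (1 + e) * (1 + e) <= 1 + 3 * e.
Proof. by move=> /andP [? ?]; nra. Qed.

Lemma combine_ub y X M q g e : y * (M - q) <= X * (M - q) -> g <= q * (1 + 3 * e) ->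
  q * (1 + 3 * e) <= X * (q * (1 + 3 * e)) -> y * (M - q) + g <= X * (M + 3 * e * q).
Proof. lra. Qed.

Lemma survival_lb x p h t e : x <= p * h * (8 * t + 2 * e) ->
  x * (p * h * (8 * t)) <= p * h * (e / 2) -> 0 <= p * h * e ->
  1 - 3 * e * (p * h) <= (1 - x) * (1 + p * h * (8 * t)).
Proof. lra. Qed.

Lemma combine_lb y M q g e c C P X : (1 - c) * (M - q) <= y -> g * (1 - e) <= X ->
  c * (M - q) <= C -> g * e <= P * e -> 0 <= P * e -> g <= q ->
  M - (C + 3 * e * P) - 2 * (q - g) <= y + X.
Proof. lra. Qed.
End Arithmetic.

Section OneStep.
Variables (R : realType) (n m : nat) (h kap eta P z : R).
Implicit Types (G : graph n) (i p q : nat).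

Definition tm i : R := i%:R * h.
Definition Aw i : R := expR (4 * tm i ^+ 2).
(** A heuristic conditional probability. The [q] missing edges are chosen at distinct later steps,
    whence the falling factorial. A pair open at step i is still open at step j with chance
    [Aw i / Aw j] and is then chosen with chance about [kap * Aw j]; the factors [Aw j] cancel and
    leave [Aw i * kap] for each missing edge and each step. The survival factors at the final time
    are put into [tau]. *)
Definition weight (tau : R) i p q : R := Aw i ^+ p * tau * kap ^+ q * ((m - i) ^_ q)%:R.

(** What a single step needs from the event K: each open pair is closed at rate about [8 t h], and
    the chance 1/Q of a given open pair is about [Aw i * kap]. *)
Definition goodK i G : Prop :=
  [/\ (0 < Q_ G)%N,
      forall r, r \in open_edges G -> `|(Y_ G r)%:R / (Q_ G)%:R - 8 * tm i * h| <= eta * h,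
      `|((Q_ G)%:R * Aw i * kap)^-1 - 1| <= eta
    & forall u v : 'I_n, u != v -> (Z_ G u v)%:R <= z].

(** [P] bounds the number of pairs being followed. The first inequality of the second group makes
    overlaps of kill sets cost at most [eta h]; the other two absorb the second-order terms of exp(4
    t^2) and of the product of survival and growth. *)
Definition step_regime : Prop :=
  [/\ 0 < h, 0 < kap, 0 <= eta <= 1 / 4 & 1 <= P /\ 0 <= z] /\
  [/\ (P * (16 + z) + 1) * (2 * Aw m * kap) <= eta * h,
      4 * h <= eta & P * h * (8 * tm m + 2) * (8 * tm m + 1) <= eta / 2].

Hypothesis reg : step_regime.

Lemma Aw_gt0 i : 0 < Aw i. Proof. exact: expR_gt0. Qed.

Let h0 : 0 < h. Proof. by case: reg => -[]. Qed.
Let kap0 : 0 < kap. Proof. by case: reg => -[]. Qed.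
Let eta0 : 0 <= eta. Proof. by case: reg => -[_ _ /andP []]. Qed.
Let eta1 : eta <= 1 / 4. Proof. by case: reg => -[_ _ /andP []]. Qed.
Let P1 : 1 <= P. Proof. by case: reg => -[_ _ _ []]. Qed.
Let z0 : 0 <= z. Proof. by case: reg => -[_ _ _ []]. Qed.

Let hge : 0 <= h. Proof. exact: ltW. Qed.
Let kge : 0 <= kap. Proof. exact: ltW. Qed.
Let Pge : 0 <= P. Proof. exact: le_trans P1. Qed.

Ltac use_regime := have ? := h0; have ? := kap0; have ? := eta0; have ? := eta1;
  have ? := P1; have ? := z0.

Lemma Aw_ge0 i : 0 <= Aw i. Proof. exact: expR_ge0. Qed.
Let Age := Aw_ge0.

Lemma tm_ge0 i : 0 <= tm i. Proof. by rewrite mulr_ge0. Qed.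

Lemma ler_tm i j : (i <= j)%N -> tm i <= tm j.
Proof. by move=> ij; rewrite ler_wpM2r // ler_nat. Qed.

Lemma ler_Aw i j : (i <= j)%N -> Aw i <= Aw j.
Proof. by move=> ij; rewrite ler_expR ler_wpM2l // lerXn2r ?nnegrE ?tm_ge0 // ler_tm. Qed.

Lemma AwS i : Aw i.+1 = Aw i * expR (8 * tm i * h + 4 * h ^+ 2).
Proof. by rewrite /Aw -expRD /tm -[i.+1%:R]natr1; congr expR; ring. Qed.

Lemma goodK_invQ i G : (i <= m)%N -> goodK i G -> (Q_ G)%:R^-1 * (P * (16 + z) + 1) <= eta * h.
Proof.
use_regime.
move=> im [Q0 _ rho _]; have Q0' : 0 < (Q_ G)%:R :> R by rewrite ltr0n.
case: reg => _ [r1 _ _]; apply: le_trans r1; rewrite mulrC ler_wpM2l //.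
  by rewrite addr_ge0 // mulr_ge0 ?addr_ge0.
have -> : (Q_ G)%:R^-1 = ((Q_ G)%:R * Aw i * kap)^-1 * Aw i * kap.
  by field; rewrite !gt_eqF ?Aw_gt0.
have iv0 : 0 <= ((Q_ G)%:R * Aw i * kap)^-1 by rewrite invr_ge0 !mulr_ge0.
set iv := (_ * kap)^-1 in rho iv0 *.
rewrite -!mulrA; apply: ler_pM; rewrite ?mulr_ge0 //.
  by have := le_trans (ler_norm _) rho; lra.
by rewrite ler_wpM2r // ler_Aw.
Qed.

(** The p pending pairs are each closed at rate [8 t h] up to [eta h]; the second [eta] pays, in the
    lower bound, for closing pairs counted several times and, in the upper bound, for the choice of
    the pending pair itself. *)
Lemma kill_fraction E T i G : (i <= m)%N -> goodK i G -> valid E T G -> [disjoint E & T] ->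
  (#|T| + #|E :\: G|)%:R <= P ->
  (#|T| + #|E :\: G|)%:R * h * (8 * tm i - 2 * eta)
    <= #|kill_any G (pending E T G)|%:R / (Q_ G)%:R
    <= (#|T| + #|E :\: G|)%:R * h * (8 * tm i + 2 * eta).
Proof.
use_regime.
move=> im gK vG dis pP; set p : R := (#|T| + _)%:R; set x := (_ / _).
have iQ := goodK_invQ im gK.
have [Q0 gY _ gZ] := gK; have Q0' : 0 < (Q_ G)%:R :> R by rewrite ltr0n.
set Q := (Q_ G)%:R in Q0' gY iQ x *.
have iQ0 : 0 < Q^-1 by rewrite invr_gt0.
have p0 : 0 <= p by rewrite ler0n.
have iQge : 0 <= Q^-1 by exact: ltW.
have cp : #|pending E T G|%:R = p :> R by rewrite card_pending.
have SO := pending_subset vG.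
have sc (c : R) : \sum_(r in pending E T G) c = p * c.
  by rewrite sumr_const -[LHS]mulr_natl cp.
have sumY : `|\sum_(r in pending E T G) (Y_ G r)%:R / Q - p * (8 * tm i * h)| <= p * (eta * h).
  rewrite -!sc -sumrB.
  apply: le_trans (ler_norm_sum _ _ _) _; apply: ler_sum => r rS.
  by apply: gY; apply: (fintype.subsetP SO).
move: sumY; rewrite -mulr_suml ler_norml => /andP [lo hi].
have up := kill_any_ub SO; have := up; rewrite -(ler_nat R) natr_sum => {}up.
have lb := kill_any_lb SO z0 gZ.
have pos : 0 <= P * (16 + z) by rewrite mulr_ge0 ?addr_ge0 // (le_trans _ P1).
apply/andP; split.
  have : (\sum_(r in pending E T G) (Y_ G r)%:R - p ^+ 2 * (16 + z)) / Q <= x.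
    by rewrite ler_wpM2r // -cp.
  have : p ^+ 2 * (16 + z) / Q <= p * (eta * h).
    rewrite expr2 -!mulrA ler_wpM2l // mulrA.
    apply: le_trans iQ; rewrite mulrC ler_wpM2l //.
    apply: (@le_trans _ _ (P * (16 + z))); last by rewrite lerDl.
    by rewrite ler_wpM2r ?addr_ge0.
  by rewrite mulrBl; move: lo; set S := (_ / Q); nra.
have : x <= (\sum_(r in pending E T G) ((Y_ G r)%:R + 1)) / Q.
  rewrite ler_wpM2r //; apply: le_trans up _.
  by apply: ler_sum => r _; rewrite natr1.
rewrite big_split /= sc mulr1 mulrDl.
have : p / Q <= p * (eta * h).
  rewrite ler_wpM2l //; apply: le_trans iQ; rewrite ler_peMr //; lra.
by move: hi; set S := (_ / Q); nra.
Qed.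

(** Here [al] is the ratio [Aw i.+1 / Aw i], the growth per pair meant to offset the closing
    rate. *)
Lemma expR_alpha i (p : nat) : (i <= m)%N -> p%:R <= P ->
  let al : R := expR (8 * tm i * h + 4 * h ^+ 2) in
  [/\ 1 <= al ^+ p, al ^+ p <= 1 + eta, al ^+ p <= 1 + 2 * (P * (h * (8 * tm m + 4)))
     & 1 + p%:R * h * (8 * tm i) <= al ^+ p /\ al ^+ p <= expR (p%:R * h * (8 * tm i + eta))].
Proof.
use_regime.
move=> im pP al; case: reg => _ [_ r2 r3].
have ti := tm_ge0 i; have tim := ler_tm im.
have alE : al ^+ p = expR (p%:R * (8 * tm i * h + 4 * h ^+ 2)) by rewrite expRM_natl.
have p0 : 0 <= p%:R :> R by rewrite ler0n.
have h1 : h <= 1 / 16 by lra.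
set u := p%:R * _ in alE.
have v0 : 0 <= 8 * tm i * h + 4 * h ^+ 2 by rewrite addr_ge0 ?mulr_ge0 ?exprn_ge0.
have u0 : 0 <= u by rewrite mulr_ge0.
have hP : 0 <= P * h by rewrite mulr_ge0.
have ule : u <= P * (h * (8 * tm m + 4 * h)).
  by apply: ler_pM => //; rewrite mulrDr; nra.
have ule' : P * (h * (8 * tm m + 4 * h)) <= eta / 2.
  apply: le_trans r3; rewrite mulrA -[leRHS]mulrA ler_wpM2l //.
  by have tm0 := tm_ge0 m; nra.
have ub : expR u <= 1 + 2 * u by apply: expR_le1D2x; rewrite u0; lra.
split; first by rewrite alE (le_trans _ (expR_ge1Dx _)) // lerDl.
- by rewrite alE; lra.
- rewrite alE (le_trans ub) // lerD2l ler_pM2l // (le_trans ule) //.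
  by rewrite mulrA [X in _ <= X]mulrA ler_wpM2l //; lra.
have e1 : 0 <= p%:R * h ^+ 2 by rewrite mulr_ge0 ?exprn_ge0.
have e2 : 0 <= p%:R * h * (eta - 4 * h) by rewrite !mulr_ge0 ?subr_ge0.
split; first by rewrite alE (le_trans _ (expR_ge1Dx _)) // lerD2l /u; nra.
rewrite alE ler_expR /u; nra.
Qed.

Section Weights.
Variables (E T : {set {set 'I_n}}) (tau : R).
Hypothesis disjET : [disjoint E & T].
Hypothesis tau0 : 0 <= tau.
Hypothesis sizeET : (#|T| + #|E|)%:R <= P.

Definition Phi i G : R :=
  if valid E T G then weight tau i (#|T| + #|E :\: G|) #|E :\: G| else 0.

Lemma weight_ge0 i p q : 0 <= weight tau i p q.
Proof. by rewrite /weight !mulr_ge0 ?ler0n ?exprn_ge0 //. Qed.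

Lemma Phi_ge0 i G : 0 <= Phi i G.
Proof. by rewrite /Phi; case: ifP => // _; exact: weight_ge0. Qed.

Lemma Phi_add i G f : f \in open_edges G -> valid E T G ->
  let p := (#|T| + #|E :\: G|)%N in let q := #|E :\: G| in
  Phi i G = (f \notin kill_any G (pending E T G))%:R * weight tau i p q +
            (f \in kill_any G (pending E T G))%:R * weight tau i p q /\
  Phi i (f |: G) = (f \notin kill_any G (pending E T G))%:R * weight tau i p q +
                   (f \in harmless E T G)%:R * weight tau i p.-1 q.-1.
Proof.
move=> fO vG p q; split.
  by rewrite /Phi vG; case: (f \in _); rewrite !(mul1r, mul0r, add0r, addr0).
rewrite /Phi (valid_add disjET fO vG).
have [_ fG _] := open_edgesP _ _ fO.
rewrite (pending_add E fG).
have hk : f \in harmless E T G -> f \in kill_any G (pending E T G).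
  move=> fh; apply/(kill_anyP _ fO); exists f; last by rewrite /kills eqxx.
  by move: fh; rewrite inE => /andP [fE _]; rewrite inE fE orbT.
have nkE : f \notin kill_any G (pending E T G) -> f \notin E :\: G.
  apply: contra => fE; apply/(kill_anyP _ fO); exists f; last by rewrite /kills eqxx.
  by rewrite inE fE orbT.
case: (boolP (f \in kill_any _ _)) nkE hk => /= [_ _ _|nk /(_ isT) fE hk].
  rewrite mul0r add0r; case: ifP => [fh|_]; last by rewrite mul0r.
  have fE : f \in E :\: G by move: fh; rewrite inE => /andP [].
  rewrite fE mul1r subn1; congr weight.
  by rewrite /p (cardsD1 f (E :\: G)) fE addnS.
rewrite (negbTE fE) subn0 mul1r; case: (boolP (f \in harmless E T G)) => [/hk //|_].
by rewrite mul0r addr0.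
Qed.

Lemma Estep_Phi i G : (0 < Q_ G)%N -> valid E T G ->
  let p := (#|T| + #|E :\: G|)%N in let q := #|E :\: G| in
  Estep G (Phi i) =
    (1 - #|kill_any G (pending E T G)|%:R / (Q_ G)%:R) * weight tau i p q +
    #|harmless E T G|%:R / (Q_ G)%:R * weight tau i p.-1 q.-1.
Proof.
move=> Q0 vG p q; rewrite EstepE -?card_gt0 //.
have Qn0 : (Q_ G)%:R != 0 :> R by rewrite pnatr_eq0 -lt0n.
rewrite (eq_bigr (fun f => (f \notin kill_any G (pending E T G))%:R * weight tau i p q +
                   (f \in harmless E T G)%:R * weight tau i p.-1 q.-1)); last first.
  by move=> f fO; rewrite (Phi_add i fO vG).2.
rewrite big_split /= -!mulr_suml.
have cK : \sum_(f in open_edges G) (f \notin kill_any G (pending E T G))%:R =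
   (Q_ G)%:R - #|kill_any G (pending E T G)|%:R :> R.
  apply/eqP; rewrite eq_sym subr_eq; apply/eqP.
  rewrite -(sum_indicator R (kill_any_open G (pending E T G))).
  rewrite -big_split /= /Q_ -sum1_card natr_sum; apply: eq_bigr => f _.
  by rewrite -natrD; case: (_ \in _).
have cH : \sum_(f in open_edges G) (f \in harmless E T G)%:R = #|harmless E T G|%:R :> R.
  apply: sum_indicator; apply: fintype.subset_trans (harmless_kill_any _ _ _) _.
  by case/andP: vG.
rewrite cK cH mulrDl; congr (_ + _); last by rewrite mulrAC.
by rewrite mulrAC mulrBl divff.
Qed.

Lemma harmless_le G : (#|harmless E T G| <= #|E :\: G|)%N.
Proof. exact: subset_leq_card (harmless_kill_any E T G). Qed.

Lemma pend_size G : (#|T| + #|E :\: G|)%:R <= P.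
Proof.
apply: le_trans sizeET; rewrite ler_nat leq_add2l.
by apply: subset_leq_card; rewrite finset.subsetDl.
Qed.

(* The common factor of the three weights met in one step; the recursion
   [M^_q = (M-1)^_q + q (M-1)^_(q-1)] makes the selection term exact. *)
Lemma weight_split i p q : (i < m)%N ->
  let al : R := expR (8 * tm i * h + 4 * h ^+ 2) in
  let c := Aw i ^+ p * tau * kap ^+ q * ((m - i.+1) ^_ q.-1)%:R in
  let M : R := (m - i)%:R in
  0 <= c /\
  (weight tau i p q = c * (if q is 0 then 1 else M) /\
   weight tau i.+1 p q = c * (al ^+ p * (if q is 0 then 1 else M - q%:R)) /\
   ((0 < q)%N -> (0 < p)%N ->
    weight tau i.+1 p.-1 q.-1 * (Aw i * kap) = c * al ^+ p.-1)).
Proof.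
move=> im al c M.
have MS : (m - i = (m - i.+1).+1)%N by rewrite subnSK.
have c0 : 0 <= c by rewrite /c !mulr_ge0 ?ler0n ?exprn_ge0 //.
split=> //; rewrite /weight AwS -/al.
(* For [q = 0] the predecessor is 0 too, so [c] is already the whole weight and the ratio is 1
   instead of M. *)
case: q @c c0 => [|q] c c0.
  by rewrite /c /= !ffactn0 !mulr1 exprMn; split; [|split] => //; ring.
split; first by rewrite MS ffactSS natrM /c /M MS /=; ring.
split.
  rewrite exprMn ffactnSr natrM /c /M MS /=.
  have [qm|qm] := leqP q (m - i.+1).
    by rewrite natrB // -[(_).+1%:R]natr1 -[q.+1%:R]natr1; ring.
  by rewrite ffact_small //; ring.
case: p @c c0 => // p c c0 _ _; rewrite exprMn /c /= !exprS; ring.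
Qed.

(** The growth [al ^+ p] cancels the closing rate up to [3 eta P h]. A choice is made with chance
    about q/M relative to the weight, M the number of steps left, so its relative error [3 eta]
    contributes only [3 eta P / M]. Summed over the steps, the latter gives a harmonic sum. *)
Lemma Phi_step_ub i G : (i < m)%N -> goodK i G ->
  Estep G (Phi i.+1) <= expR (3 * eta * P * (h + (m - i)%:R^-1)) * Phi i G.
Proof.
use_regime.
move=> im gK; have [Q0 _ rho _] := gK; have Q0' : 0 < (Q_ G)%:R :> R by rewrite ltr0n.
case: (boolP (valid E T G)) => [vG|nv]; last first.
  rewrite EstepE -?card_gt0 // {1}/Phi big1 ?mul0r.
    by rewrite mulr_ge0 ?expR_ge0 ?Phi_ge0.
  by move=> f fO; case: ifP => // /(valid_del fO); rewrite (negbTE nv).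
rewrite Estep_Phi //= /Phi vG.
have pP := pend_size G.
have /andP [xlo xhi] := kill_fraction (ltnW im) gK vG disjET pP.
have [a1 a2 _ [a3 a4]] := expR_alpha (ltnW im) pP.
have b2 : expR (8 * tm i * h + 4 * h ^+ 2) ^+ (#|T| + #|E :\: G|).-1 <= 1 + eta.
  have pP' : (#|T| + #|E :\: G|).-1%:R <= P.
    by apply: le_trans pP; rewrite ler_nat leq_pred.
  by have [] := expR_alpha (ltnW im) pP'.
have [c0 [w1 [w2 w3]]] := weight_split (#|T| + #|E :\: G|) #|E :\: G| im.
have hl := harmless_le G.
set q := #|E :\: G| in w1 w2 w3 hl *.
set p := (#|T| + q)%N in pP xlo xhi a1 a2 a3 a4 b2 c0 w1 w2 w3 *.
set x := (_ / _) in xlo xhi *; set g := #|harmless E T G| in hl *.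
set c := (Aw i ^+ p * tau * kap ^+ q * ((m - i.+1) ^_ q.-1)%:R) in c0 w1 w2 w3.
rewrite w1 w2.
set al := expR (8 * tm i * h + 4 * h ^+ 2) in a1 a2 a3 a4 b2 w2 w3 *.
have M0 : 0 < (m - i)%:R :> R by rewrite ltr0n subn_gt0.
set M := (m - i)%:R in M0 w1 w2 *.
set p' : R := p%:R in pP xlo xhi a3 a4 *.
have p0 : 0 <= p' by rewrite ler0n.
have x1 : x <= 1.
  rewrite /x ler_pdivrMr // mul1r ler_nat; exact: subset_leq_card (kill_any_open _ _).
(* By 1 - x <= exp(-x), the main terms of the two exponents cancel. *)
have first : (1 - x) * al ^+ p <= expR (3 * eta * P * h).
  apply: (@le_trans _ _ (expR (- x) * expR (p' * h * (8 * tm i + eta)))).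
    by apply: ler_pM; rewrite ?subr_ge0 // ?(le_trans _ a1) // expR_ge1Dx.
  rewrite -expRD ler_expR.
  apply: (@le_trans _ _ (3 * eta * (p' * h))); first exact: kill_expo.
  by rewrite -[leRHS]mulrA ler_wpM2l ?mulr_ge0 // ler_wpM2r.
case: (posnP q) => [q0|q0].
  move: hl w1 w2; rewrite q0 leqn0 => /eqP -> _ _.
  rewrite !mul0r addr0 !mulr1 mulrCA [leRHS]mulrC ler_wpM2l //.
  by apply: le_trans first _; rewrite ler_expR ler_wpM2l ?mulr_ge0 // lerDl invr_ge0 ltW.
have -> : (if q is 0 then 1 else M) = M by rewrite -(prednK q0).
have -> : (if q is 0 then 1 else M - q%:R) = M - q%:R by rewrite -(prednK q0).
have pq : (0 < p)%N by rewrite /p addn_gt0 q0 orbT.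
have {}w3 := w3 q0 pq.
have -> : g%:R / (Q_ G)%:R * weight tau i.+1 p.-1 q.-1 =
    c * (g%:R * ((Q_ G)%:R * Aw i * kap)^-1 * al ^+ p.-1).
  rewrite [RHS]mulrC -[RHS]mulrA [_ * c]mulrC -w3.
  by field; rewrite !gt_eqF // Aw_gt0.
have rho' : 0 <= ((Q_ G)%:R * Aw i * kap)^-1 <= 1 + eta.
  by have [_ ->] := near1 rho; rewrite invr_ge0 !mulr_ge0 ?ler0n.
set rh := ((Q_ G)%:R * Aw i * kap)^-1 in rho' *.
move: (rho') => /andP [rh0 rh1].
have bal : 0 <= al ^+ p.-1 by rewrite exprn_ge0 // expR_ge0.
have second : g%:R * rh * al ^+ p.-1 <= q%:R * (1 + 3 * eta).
  rewrite -mulrA; apply: ler_pM; rewrite ?ler_nat ?mulr_ge0 //.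
  apply: (@le_trans _ _ ((1 + eta) * (1 + eta))); first exact: ler_pM.
  by apply: sqr_1D; rewrite eta0 eta1.
(* With fewer steps left than missing edges, the falling factorial, and with it every weight,
   vanishes. *)
have [qM|qM] := leqP q (m - i); last first.
  suff -> : c = 0 by rewrite !mul0r !mulr0 addr0.
  by rewrite /c ffact_small ?mulr0 // -ltnS prednK // (leq_trans _ qM) // ltnS subnSK.
have qM' : q%:R <= M by rewrite ler_nat.
have e1 : 1 <= expR (3 * eta * P * h) by rewrite (le_trans _ (expR_ge1Dx _)) // lerDl !mulr_ge0.
have key : (1 - x) * (al ^+ p * (M - q%:R)) + g%:R * rh * al ^+ p.-1 <=
   expR (3 * eta * P * (h + M^-1)) * M.
  rewrite mulrA [3 * eta * P * _]mulrDr expRD.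
  apply: (@le_trans _ _ (expR (3 * eta * P * h) * (M + 3 * eta * q%:R))).
    have : (1 - x) * al ^+ p * (M - q%:R) <= expR (3 * eta * P * h) * (M - q%:R).
      by rewrite ler_wpM2r // subr_ge0.
    have : q%:R * (1 + 3 * eta) <= expR (3 * eta * P * h) * (q%:R * (1 + 3 * eta)).
      by rewrite ler_peMl // mulr_ge0 ?ler0n // addr_ge0 // mulr_ge0.
    by move=> ? ?; apply: combine_ub.
  rewrite -[leRHS]mulrA ler_pM2l ?expR_gt0 //.
  apply: (@le_trans _ _ ((1 + 3 * eta * P * M^-1) * M)); last first.
    by rewrite ler_pM2r // expR_ge1Dx.
  rewrite [leRHS]mulrDl mul1r divfK ?gt_eqF // lerD2l ler_wpM2l ?mulr_ge0 //.
  by apply: le_trans pP; rewrite ler_nat leq_addl.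
by rewrite [X in X + _ <= _]mulrCA -mulrDr [leRHS]mulrCA ler_wpM2l.
Qed.

(** The same cancellation from below, except that choosing a pending edge which is not harmless
    destroys the copy. Each such edge costs a share of order 1/(m - i) of the weight. *)
Lemma Phi_step_lb i G : (i < m)%N -> goodK i G -> valid E T G ->
  (1 - 3 * eta * P * (h + (m - i)%:R^-1)
     - 2 * (#|E :\: G| - #|harmless E T G|)%:R / (m - i)%:R) * Phi i G
  <= Estep G (Phi i.+1).
Proof.
use_regime.
move=> im gK vG; have [Q0 _ rho _] := gK; have Q0' : 0 < (Q_ G)%:R :> R by rewrite ltr0n.
rewrite Estep_Phi //= /Phi vG.
have pP := pend_size G.
have /andP [xlo xhi] := kill_fraction (ltnW im) gK vG disjET pP.
have [a1 a2 _ [a3 a4]] := expR_alpha (ltnW im) pP.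
have [b1 b2] : 1 <= expR (8 * tm i * h + 4 * h ^+ 2) ^+ (#|T| + #|E :\: G|).-1 <= 1 + eta /\ true.
  have pP' : (#|T| + #|E :\: G|).-1%:R <= P.
    by apply: le_trans pP; rewrite ler_nat leq_pred.
  by have [-> ->] := expR_alpha (ltnW im) pP'.
have [c0 [w1 [w2 w3]]] := weight_split (#|T| + #|E :\: G|) #|E :\: G| im.
have hl := harmless_le G.
set q := #|E :\: G| in w1 w2 w3 hl *.
set p := (#|T| + q)%N in pP xlo xhi a1 a2 a3 a4 b1 c0 w1 w2 w3 *.
set x := (#|kill_any _ _|%:R / _) in xlo xhi *; set g := #|harmless E T G| in hl *.
set c := (Aw i ^+ p * tau * kap ^+ q * ((m - i.+1) ^_ q.-1)%:R) in c0 w1 w2 w3.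
rewrite w1 w2.
set al := expR (8 * tm i * h + 4 * h ^+ 2) in a1 a2 a3 a4 b1 w2 w3 *.
have M0 : 0 < (m - i)%:R :> R by rewrite ltr0n subn_gt0.
set M := (m - i)%:R in M0 w1 w2 *.
set p' : R := p%:R in pP xlo xhi a3 a4 *.
have p0 : 0 <= p' by rewrite ler0n.
have x1 : x <= 1.
  rewrite /x ler_pdivrMr // mul1r ler_nat; exact: subset_leq_card (kill_any_open _ _).
have x0 : 0 <= x by rewrite divr_ge0.
have ti := tm_ge0 i; have tim := ler_tm (ltnW im).
have first : 1 - 3 * eta * (p' * h) <= (1 - x) * al ^+ p.
  apply: (@le_trans _ _ ((1 - x) * (1 + p' * h * (8 * tm i)))); last first.
    by rewrite ler_wpM2l // subr_ge0.
  have hp : 0 <= p' * h by rewrite mulr_ge0.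
  have r3 : P * h * (8 * tm m + 2) * (8 * tm m + 1) <= eta / 2 by case: reg => _ [].
  apply: survival_lb => //; last by rewrite mulr_ge0.
  rewrite [leLHS]mulrC -[leLHS]mulrA ler_wpM2l //.
  apply: le_trans r3; rewrite [leLHS]mulrC; apply: ler_pM => //; first by rewrite mulr_ge0.
    apply: le_trans xhi _; apply: ler_pM => //.
    - by rewrite addr_ge0 ?mulr_ge0.
    - by rewrite ler_wpM2r.
    - by apply: lerD; [rewrite ler_wpM2l | rewrite ler_piMr // quarter_le1].
  by apply: (@le_trans _ _ (8 * tm m)); rewrite ?ler_wpM2l ?lerDl.
move: (b1) => /andP [b1' b2'].
have rho' : 1 - eta <= ((Q_ G)%:R * Aw i * kap)^-1 <= 1 + eta.
  by have [-> ->] := near1 rho.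
case: (posnP q) => [q0|q0].
  move: hl w1 w2; rewrite q0 leqn0 => /eqP g0 _ _; rewrite g0 subn0.
  rewrite !mul0r addr0 mulr0 mul0r subr0 !mulr1 mulrC [leRHS]mulrCA ler_wpM2l //.
  apply: le_trans first; rewrite lerD2l lerN2 -[leRHS]mulrA ler_wpM2l ?mulr_ge0 //.
  by apply: ler_pM; rewrite ?lerDl ?invr_ge0 ?(ltW M0).
have -> : (if q is 0 then 1 else M) = M by rewrite -(prednK q0).
have -> : (if q is 0 then 1 else M - q%:R) = M - q%:R by rewrite -(prednK q0).
have pq : (0 < p)%N by rewrite /p addn_gt0 q0 orbT.
have {}w3 := w3 q0 pq.
have -> : g%:R / (Q_ G)%:R * weight tau i.+1 p.-1 q.-1 =
    c * (g%:R * ((Q_ G)%:R * Aw i * kap)^-1 * al ^+ p.-1).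
  rewrite [RHS]mulrC -[RHS]mulrA [_ * c]mulrC -w3.
  by field; rewrite !gt_eqF // Aw_gt0.
set rh := ((Q_ G)%:R * Aw i * kap)^-1 in rho' *.
move: (rho') => /andP [rh0 rh1].
have [qM|qM] := leqP q (m - i); last first.
  suff -> : c = 0 by rewrite !mul0r !mulr0 addr0.
  by rewrite /c ffact_small ?mulr0 // -ltnS prednK // (leq_trans _ qM) // ltnS subnSK.
have qM' : q%:R <= M by rewrite ler_nat.
rewrite [leLHS]mulrCA [X in _ <= X + _]mulrCA -mulrDr ler_wpM2l //.
have second : g%:R * (1 - eta) <= g%:R * rh * al ^+ p.-1.
  have rh00 : 0 <= rh by rewrite (le_trans _ rh0) // subr_ge0 quarter_le1.
  by rewrite -mulrA ler_wpM2l ?ler0n //; apply: le_trans rh0 _; rewrite ler_peMr.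
have fst : (1 - 3 * eta * (p' * h)) * (M - q%:R) <= (1 - x) * al ^+ p * (M - q%:R).
  by rewrite ler_wpM2r // subr_ge0.
have -> : (1 - 3 * eta * P * (h + M^-1) - 2 * (q - g)%:R / M) * M =
    M - (3 * eta * P * h * M + 3 * eta * P) - 2 * (q%:R - g%:R).
  by rewrite natrB //; field; rewrite gt_eqF.
have gq : g%:R <= q%:R :> R by rewrite ler_nat.
have qp : q%:R <= P by apply: le_trans pP; rewrite ler_nat leq_addl.
have hc : 3 * eta * (p' * h) * (M - q%:R) <= 3 * eta * P * h * M.
  rewrite -!mulrA ler_wpM2l // ler_wpM2l //; apply: ler_pM => //.
    by rewrite mulr_ge0 ?subr_ge0.
  by rewrite ler_wpM2l // gerBl.
have hg : g%:R * eta <= P * eta by rewrite ler_wpM2r // (le_trans gq).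
have hPe : 0 <= P * eta by rewrite mulr_ge0.
by rewrite [X in _ <= X + _]mulrA; apply: (combine_lb fst second hc hg hPe gq).
Qed.
End Weights.
End OneStep.

(** * High moments of the number of copies *)

Lemma mulr4_shuffle (R : comRingType) (x y z t : R) : x * y * z * t = x * t * (y * z).
Proof. ring. Qed.

Section Copies.
Variables (V : finType) (n : nat).
Implicit Types (E O : {set {set V}}) (D A K : {set V}) (phi psi : {ffun V -> 'I_n}) (w : 'I_n).

Definition img psi E : {set {set 'I_n}} := (fun e : {set V} => psi @: e) @: E.

Definition pendants psi D w : {set {set 'I_n}} := [set [set psi b; w] | b in D].

Definition extends D A phi w psi :=
  [&& injectiveb psi, [forall a in A, psi a == phi a] & [forall b in D, [forall c, psi c != w]]].

(* Copies of [(E, O)] over [phi] in which, moreover, every vertex of [D] is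
   adjacent to the fixed vertex [w], which lies outside the copy. *)
Definition copies E O D A phi w (G : graph n) : {set {ffun V -> 'I_n}} :=
  [set psi | [&& extends D A phi w psi, img psi E :|: pendants psi D w \subset G
               & img psi O \subset open_edges G]].

Definition cnt E K : nat := #|[set e in E | ~~ (e \subset K)]|.

Lemma img_cnt psi E K (U : {set 'I_n}) (E0 : {set {set 'I_n}}) : injective psi ->
  (forall e, e \in E0 -> e \subset U) -> psi @^-1: U = K ->
  img psi [set e in E | ~~ (e \subset K)] \subset img psi E :\: E0.
Proof.
move=> inj sU KE; apply/fintype.subsetP => x /imsetP [e]; rewrite inE => /andP [eE eK] ->.
rewrite inE (imset_f (fun e : {set V} => psi @: e)) // andbT; apply: contra eK => /sU sub.
apply/fintype.subsetP => v ve; rewrite -KE inE; apply: (fintype.subsetP sub).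
exact: imset_f.
Qed.

Lemma card_img_cnt psi E K : injective psi ->
  #|img psi [set e in E | ~~ (e \subset K)]| = cnt E K.
Proof. by move=> inj; rewrite card_imset //; exact: imset_inj. Qed.

(** Sorting by the set [K] of pattern vertices that land in [U]: those in [K :\: A] have |U|
    choices, those outside [K] have n. *)
Lemma card_extensions D A phi w (U : {set 'I_n}) K : A \subset K ->
  (#|[set psi | extends D A phi w psi && (psi @^-1: U == K)]| <= #|U| ^ #|K :\: A| * n ^ #|~: K|)%N.
Proof.
move=> AK.
pose F v : {set 'I_n} := if v \in A then [set phi v] else if v \in K then U else [set: 'I_n].
apply: (@leq_trans #|family F|).
  apply: subset_leq_card; apply/fintype.subsetP => psi; rewrite inE.
  move=> /andP [/and3P [_ /forall_inP agr _] /eqP KE].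
  apply/familyP => v; rewrite /F; case: ifP => [vA|_]; first by rewrite inE agr.
  by case: ifP; rewrite ?inE // -KE inE.
rewrite card_family foldrE big_map big_enum /=.
rewrite (bigID (mem A)) /= big1 ?mul1n; last by move=> v vA; rewrite /F vA cards1.
rewrite (bigID (mem K)) /=; apply: leq_mul.
  rewrite (eq_bigr (fun=> #|U|)); last by move=> v /andP [/negbTE vA vK]; rewrite /F vA vK.
  rewrite (eq_bigl (fun v => v \in K :\: A)) => [|v]; last by rewrite /= !inE.
  by rewrite prod_nat_const.
rewrite (eq_bigr (fun=> n)); last first.
  by move=> v /andP [/negbTE vA /negbTE vK]; rewrite /F vA vK cardsT card_ord.
rewrite (eq_bigl (fun v => v \in ~: K)) => [|v]; last first.
  rewrite /= !inE; case: (boolP (v \in K)) => vK; rewrite ?andbF ?andbT //=.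
  by apply: contra vK; exact: (fintype.subsetP AK).
by rewrite prod_nat_const.
Qed.

Section Moments.
Variables (R : realType) (j : nat) (h kap eta P z : R).
Hypothesis reg : step_regime j h kap eta P z.
Variables (E O : {set {set V}}) (D A : {set V}) (phi : {ffun V -> 'I_n}) (w : 'I_n).
Variable kk : nat.

Let a : R := (Aw h j)^-1.
Let b : R := kap * j%:R.
Hypothesis b1 : kap * j%:R <= 1.
Hypothesis delta1 : \sum_(i < j) 3 * eta * P * (h + (j - i)%:R^-1) <= 1.

(** Bound for the expected number of copies when a configuration on at most [kk] vertices is already
    prescribed, split by the set [K] of pattern vertices mapped into it. Only pairs leaving [K] are
    new and are paid for: [a] for a pair that must be open, [b] for an edge. *)
Definition Bsum (a b : R) : R := \sum_(K : {set V} | A \subset K)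
  kk%:R ^+ #|K :\: A| * a ^+ cnt O K * b ^+ (cnt E K + #|D :\: K|) * n%:R ^+ #|~: K|.

Let a0 : 0 <= a. Proof. by rewrite invr_ge0 Aw_ge0. Qed.
Let a1 : a <= 1.
Proof.
rewrite invf_le1 ?Aw_gt0 // /Aw (le_trans _ (expR_ge1Dx _)) // lerDl mulr_ge0 //.
exact: sqr_ge0.
Qed.
Let b0 : 0 <= b.
Proof. by case: reg => -[_ k0 _ _] _; rewrite mulr_ge0 ?ler0n // ltW. Qed.

Lemma new_pairs_sum (U : {set 'I_n}) (E0 T0 : {set {set 'I_n}}) :
  (forall v, v \in A -> phi v \in U) -> w \in U -> (#|U| <= kk)%N ->
  (forall e, e \in E0 -> e \subset U) -> (forall e, e \in T0 -> e \subset U) ->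
  \sum_(psi | extends D A phi w psi)
     a ^+ #|img psi O :\: T0| * b ^+ #|(img psi E :|: pendants psi D w) :\: E0| <= Bsum a b.
Proof.
move=> AU wU Ukk E0U T0U.
rewrite (partition_big (fun psi : {ffun V -> 'I_n} => psi @^-1: U) (fun K : {set V} => A \subset K)) /=; last first.
  move=> psi /and3P [_ /forall_inP agr _]; apply/fintype.subsetP => v vA.
  by rewrite inE (eqP (agr v vA)) AU.
apply: ler_sum => K AK.
apply: (@le_trans _ _ (\sum_(psi | extends D A phi w psi && (psi @^-1: U == K))
   a ^+ cnt O K * b ^+ (cnt E K + #|D :\: K|))).
  apply: ler_sum => psi /andP [/and3P [/injectiveP inj _ /forall_inP wD] /eqP KE].
  apply: ler_pM; rewrite ?exprn_ge0 //.
    rewrite ler_wiXn2l // -(card_img_cnt O K inj).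
    exact: subset_leq_card (img_cnt O inj T0U KE).
  rewrite ler_wiXn2l // -(card_img_cnt E K inj).
  have cD : #|[set [set psi b; w] | b in D :\: K]| = #|D :\: K|.
    rewrite card_in_imset // => x y; rewrite !inE => /andP [_ xD] /andP [_ yD] /setP /(_ (psi x)).
    rewrite !inE eqxx /= => /esym /orP [/eqP /inj //|].
    by move/forallP: (wD x xD) => /(_ x) /negbTE ->.
  rewrite -cD -cardsUI (_ : _ :&: _ = finset.set0) ?cards0 ?addn0; last first.
    apply/setP => x; rewrite !inE; apply/negP => /andP [/imsetP [e _ ->] /imsetP [y]].
    rewrite inE => /andP [_ yD] /setP /(_ w); rewrite !inE eqxx orbT => /imsetP [v _ wv].
    by move/forallP: (wD y yD) => /(_ v); rewrite wv eqxx.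
  apply: subset_leq_card; rewrite finset.subUset; apply/andP; split.
    apply: fintype.subset_trans (img_cnt E inj E0U KE) _.
    by apply: finset.setSD; rewrite finset.subsetUl.
  apply/fintype.subsetP => x /imsetP [y]; rewrite inE => /andP [yK yD] ->.
  rewrite finset.in_setD finset.in_setU (imset_f (fun b => [set psi b; w])) // orbT andbT.
  apply: contra yK => /E0U /fintype.subsetP /(_ (psi y)); rewrite !inE eqxx => /(_ isT).
  by rewrite -KE inE.
rewrite sumr_const -[leLHS]mulr_natl mulr4_shuffle ler_wpM2r ?mulr_ge0 ?exprn_ge0 //.
rewrite -!natrX -natrM ler_nat.
apply: leq_trans (leq_trans _ (card_extensions D phi w U AK)) _.
  by apply: eq_leq; apply: eq_card => psi; rewrite inE.
by rewrite leq_mul2r; apply/orP; right; case: #|K :\: A| => // d; rewrite leq_exp2r.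
Qed.

Definition goods i g : Prop := goodK h kap eta z i (g : graph n).

Definition holds (E0 T0 : {set {set 'I_n}}) (G : graph n) : bool :=
  (E0 \subset G) && (T0 \subset open_edges G).

(** [Phi] for the configuration [(E0, T0)] with normalisation [a ^+ #|T0|] equals 1 when the
    configuration is present at time j and starts below the claimed product. The accumulated drift
    costs the single factor e. *)
Lemma first_moment (E0 T0 : {set {set 'I_n}}) :
  (#|T0| + #|E0|)%:R <= P ->
  EX j (fun g => `[< forall i, (i < j)%N -> goods i (g i) >]%:R * (holds E0 T0 (g j))%:R) <=
  expR 1 * (a ^+ #|T0| * b ^+ #|E0|) :> R.
Proof.
move=> sz; have rhs0 : 0 <= expR 1 * (a ^+ #|T0| * b ^+ #|E0|).
  by rewrite !mulr_ge0 ?expR_ge0 ?exprn_ge0.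
(* If a pair is required to be both edge and open, the event is empty. *)
have [dis|ndis] := boolP [disjoint E0 & T0]; last first.
  apply: le_trans rhs0; rewrite -[leRHS](@EX_cst R n j); apply: ler_EX => g.
  rewrite /holds; case: andP => [[sE sT]|_]; last by rewrite mulr0.
  case/negP: ndis; apply/pred0P => x; apply/negP => /= /andP [xE xT].
  have /open_edgesP [_] := fintype.subsetP sT x xT.
  by rewrite (fintype.subsetP sE).
have tau0 : 0 <= a ^+ #|T0| by rewrite exprn_ge0.
apply: (@le_trans _ _ (EX j (fun g => `[< forall i, (i < j)%N -> goods i (g i) >]%:R *
    Phi j h kap E0 T0 (a ^+ #|T0|) j (g j)))).
  apply: ler_EX => g; rewrite ler_wpM2l ?ler0n //.
  rewrite /holds; case: andP => [[sE sT]|_]; last exact: (Phi_ge0 reg).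
  have E0g : E0 :\: g j = finset.set0 by apply/eqP; rewrite finset.setD_eq0.
  rewrite /Phi /valid sT E0g finset.sub0set cards0 addn0 /weight subnn ffactn0 expr0 !mulr1.
  by rewrite -exprMn /a divff ?expr1n // gt_eqF ?Aw_gt0.
apply: le_trans (EX_supermartingale (c := fun i => 3 * eta * P * (h + (j - i)%:R^-1)) _ _) _.
- by move=> i G; exact: (Phi_ge0 reg).
- by move=> i G ij gK; apply: (Phi_step_ub reg).
apply: ler_pM; rewrite ?expR_ge0 ?(Phi_ge0 reg) ?ler_expR //.
rewrite /Phi; case: ifP => _; last by rewrite mulr_ge0 ?exprn_ge0.
rewrite /weight subn0 finset.setD0 /Aw /tm mul0r expr0n /= mulr0 expR0 expr1n mul1r -mulrA.
rewrite ler_wpM2l // /b exprMn ler_wpM2l ?exprn_ge0 //; first by case: reg => -[_ k0 _ _] _; exact: ltW.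
rewrite -natrX ler_nat; elim: #|E0| => [|q IH]; first by rewrite ffactn0.
by rewrite ffactnSr expnSr leq_mul // leq_subr.
Qed.

(** The power is expanded one factor at a time: fixing a copy [psi] adds its pairs to the prescribed
    configuration, and the induction hypothesis, stated for every configuration, applies to the
    remaining k-1 factors. The factor e is paid once, at k = 0, and not at every factor. *)
Lemma moment_bound k (U : {set 'I_n}) (E0 T0 : {set {set 'I_n}}) :
  (forall v, v \in A -> phi v \in U) -> w \in U -> (#|U| + k * #|V| <= kk)%N ->
  (forall e, e \in E0 -> e \subset U) -> (forall e, e \in T0 -> e \subset U) ->
  (#|T0| + #|E0| + k * (#|E| + #|O| + #|D|))%:R <= P ->
  EX j (fun g => `[< forall i, (i < j)%N -> goods i (g i) >]%:R *
     (#|copies E O D A phi w (g j)|%:R ^+ k * (holds E0 T0 (g j))%:R)) <=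
  expR 1 * Bsum a b ^+ k * (a ^+ #|T0| * b ^+ #|E0|) :> R.
Proof.
elim: k U E0 T0 => [|k IHk] U E0 T0 AU wU Ukk E0U T0U sz.
  rewrite expr0 mulr1; have := @first_moment E0 T0; rewrite mul0n addn0 in sz.
  by move=> /(_ sz); apply: le_trans; apply: ler_EX => g; rewrite expr0 mul1r.
pose E1 psi := E0 :|: (img psi E :|: pendants psi D w).
pose T1 psi := T0 :|: img psi O.
rewrite (_ : (fun g => _) = (fun g => \sum_(psi | extends D A phi w psi)
    `[< forall i, (i < j)%N -> goods i (g i) >]%:R *
     (#|copies E O D A phi w (g j)|%:R ^+ k * (holds (E1 psi) (T1 psi) (g j))%:R))); last first.
  apply: funext => g; rewrite -mulr_sumr; congr (_ * _).
  rewrite exprSr -mulrA -mulr_sumr; congr (_ * _).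
  rewrite -sum1_card natr_sum mulr_suml.
  rewrite (eq_bigl (fun psi => extends D A phi w psi &&
    ((img psi E :|: pendants psi D w \subset g j) && (img psi O \subset open_edges (g j)))));
    last by move=> psi; rewrite inE.
  rewrite big_mkcondr /=.
  apply: eq_bigr => psi ext; rewrite /holds /E1 /T1 !finset.subUset mul1r.
  by do 5![case: (_ \subset _)]; rewrite ?mul0r ?mul1r //.
rewrite EX_sum.
apply: (@le_trans _ _ (\sum_(psi | extends D A phi w psi)
   expR 1 * Bsum a b ^+ k * (a ^+ #|T1 psi| * b ^+ #|E1 psi|))).
  apply: ler_sum => psi /and3P [/injectiveP inj /forall_inP agr _].
  pose U1 := U :|: [set psi v | v in V].
  apply: (IHk U1).
  - by move=> v vA; rewrite inE AU.
  - by rewrite inE wU.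
  - have : (#|U1| <= #|U| + #|V|)%N.
      by rewrite cardsU (leq_trans (leq_subr _ _)) // leq_add2l leq_imset_card.
    by move: Ukk; rewrite mulSn; lia.
  - move=> e; rewrite !inE => /orP [/E0U eU|/orP [/imsetP [x _ ->]|/imsetP [x _ ->]]].
    + exact: fintype.subset_trans eU (finset.subsetUl _ _).
    + apply/fintype.subsetP => y /imsetP [v _ ->]; rewrite inE; apply/orP; right.
      exact: imset_f.
    + apply/fintype.subsetP => y; rewrite !inE => /orP [] /eqP ->; rewrite ?wU //.
      by apply/orP; right; exact: imset_f.
  - move=> e; rewrite !inE => /orP [/T0U eU|/imsetP [x _ ->]].
    + exact: fintype.subset_trans eU (finset.subsetUl _ _).
    + apply/fintype.subsetP => y /imsetP [v _ ->]; rewrite inE; apply/orP; right.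
      exact: imset_f.
  - apply: le_trans sz; rewrite ler_nat mulSn.
    have : (#|T1 psi| <= #|T0| + #|O|)%N.
      by rewrite cardsU (leq_trans (leq_subr _ _)) // leq_add2l leq_imset_card.
    have : (#|E1 psi| <= #|E0| + (#|E| + #|D|))%N.
      rewrite cardsU (leq_trans (leq_subr _ _)) // leq_add2l.
      by rewrite cardsU (leq_trans (leq_subr _ _)) // leq_add // leq_imset_card.
    by lia.
rewrite -mulr_sumr exprSr -!mulrA.
have B0 : 0 <= Bsum a b by apply: sumr_ge0 => K _; rewrite !mulr_ge0 ?exprn_ge0 ?ler0n.
rewrite ler_wpM2l ?expR_ge0 // ler_wpM2l ?exprn_ge0 //.
(* Pairs already prescribed are not paid for again; this is what leaves only the differences from
   [T0] and [E0]. *)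
apply: (@le_trans _ _ (a ^+ #|T0| * b ^+ #|E0| * (\sum_(psi | extends D A phi w psi)
     a ^+ #|img psi O :\: T0| * b ^+ #|(img psi E :|: pendants psi D w) :\: E0|))).
  rewrite mulr_sumr; apply: ler_sum => psi _.
  have cU (X Y : {set {set 'I_n}}) : #|X :|: Y| = (#|X| + #|Y :\: X|)%N.
    by rewrite cardsU cardsD finset.setIC addnBA // subset_leq_card // finset.subsetIl.
  by rewrite /T1 /E1 !cU !exprD mulrACA.
rewrite mulrC ler_wpM2r ?mulr_ge0 ?exprn_ge0 //.
apply: new_pairs_sum AU wU _ E0U T0U.
by apply: leq_trans Ukk; rewrite leq_addr.
Qed.

(** Markov's inequality for the k-th power at level e times the bound: the k factors e in the level
    become the factor exp(-k). *)
Lemma copies_tail m k : (j <= m)%N -> (#|A| + 1 + k * #|V| <= kk)%N ->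
  (k * (#|E| + #|O| + #|D|))%:R <= P ->
  tfp_prob R m (fun g => (forall i, (i < j)%N -> goods i (g i)) /\
     expR 1 * Bsum a b < #|copies E O D A phi w (g j)|%:R) <= expR (1 - k%:R).
Proof.
move=> jm Akk sz; rewrite tfp_probE -(subnKC jm) EX_marginal; last first.
  move=> g g' gg'; congr ((nat_of_bool _)%:R); rewrite (gg' j) //.
  by apply: asbool_equiv_eq; split=> [] [H1 H2]; split=> // i ij;
     move: (H1 i ij); rewrite gg' // ltnW.
pose U := w |: [set phi v | v in A].
have := @moment_bound k U finset.set0 finset.set0.
have kk0 : (0 < kk)%N by apply: leq_trans Akk; rewrite addn1.
have B0 : 0 < Bsum a b.
  rewrite /Bsum (bigD1 [set: V]) ?finset.subsetT //= ltr_pwDl //; last first.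
    by apply: sumr_ge0 => K _; rewrite !mulr_ge0 ?exprn_ge0 ?ler0n.
  have c0 X : cnt X [set: V] = 0%N.
    by apply: eq_card0 => e; rewrite inE finset.subsetT andbF.
  rewrite !c0 finset.setCT finset.setDT !cards0 !expr0 !mulr1.
  by rewrite exprn_gt0 // ltr0n.
rewrite !cards0 !expr0 !mulr1 => /(_ _) mb.
have {mb} : EX j (fun g => `[< forall i, (i < j)%N -> goods i (g i) >]%:R *
     (#|copies E O D A phi w (g j)|%:R ^+ k * (holds finset.set0 finset.set0 (g j))%:R)) <=
  expR 1 * Bsum a b ^+ k :> R.
  apply: mb => //.
  - by move=> v vA; rewrite !inE imset_f ?orbT.
  - by rewrite !inE eqxx.
  - apply: leq_trans Akk; rewrite leq_add2r cardsU1 addnC leq_add //; last by case: (_ \notin _).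
    exact: leq_imset_card.
  - by move=> e; rewrite inE.
  - by move=> e; rewrite inE.
move=> mb; set X := EX j _ in mb *.
have Bk : 0 < (expR 1 * Bsum a b) ^+ k by rewrite exprn_gt0 // mulr_gt0 ?expR_gt0.
rewrite -(ler_pM2l Bk).
have -> : (expR 1 * Bsum a b) ^+ k * expR (1 - k%:R) = expR 1 * Bsum a b ^+ k.
  rewrite exprMn -expRM_natl mulr1 expRD -mulrA mulrCA expRN; field.
  by rewrite gt_eqF ?expR_gt0.
apply: le_trans mb; rewrite -EXZ; apply: ler_EX => g; rewrite asbool_and.
case: (asboolP (forall i, _)) => _; last by rewrite mulr0 mul0r.
rewrite /holds !finset.sub0set mulr1 mul1r /=.
case: (asboolP (_ < _)) => [lt|_]; last by rewrite mulr0 exprn_ge0.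
by rewrite mulr1 lerXn2r ?nnegrE ?ler0n ?(ltW lt) // mulr_ge0 ?expR_ge0 ?ltW.
Qed.
End Moments.
End Copies.

(** * Size of the jumps of one weight *)

Section JumpArithmetic.
Variable R : realType.

Lemma jump_cases (w w' s : R) (k hm e : bool) : 0 <= w -> 0 <= s -> 0 <= w' ->
  (hm -> k) -> (hm -> e) ->
  `|(~~ k)%:R * w' + hm%:R * s - w| <= `|w' - w| + k%:R * w + e%:R * s.
Proof.
move=> w0 s0 w'0 hk he; case: k hk => hk.
  rewrite mul0r add0r mul1r; case: hm he {hk} => he.
    rewrite he // !mul1r (le_trans (ler_normB _ _)) // (ger0_norm s0) (ger0_norm w0).
    by have := normr_ge0 (w' - w); lra.
  rewrite mul0r sub0r normrN ger0_norm //.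
  have : 0 <= e%:R * s by rewrite mulr_ge0.
  by have := normr_ge0 (w' - w); lra.
case: hm he hk => he hk; first by have := hk isT.
by rewrite !mul0r !addr0 mul1r lerDl mulr_ge0.
Qed.

Lemma weight_diff_arith (c al M q d : R) : 0 <= c -> 1 <= al -> al <= 1 + d -> 0 <= q -> q <= M ->
  `|c * (al * (M - q)) - c * M| <= d * (c * M) + c * q.
Proof.
move=> c0 al1 ald q0 qM; rewrite -mulrBr normrM (ger0_norm c0).
have -> : d * (c * M) + c * q = c * (d * M + q) by ring.
rewrite ler_wpM2l // ler_norml; apply/andP; split; nra.
Qed.

Lemma expR_quadratic (x : R) : x <= 1 / 2 -> expR x <= 1 + x + 2 * x ^+ 2.
Proof.
move=> x2; have := expR_ge1Dx (- x); rewrite expRN => h1.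
have e0 := expR_gt0 x.
have h2 : (1 - x) * expR x <= 1 by rewrite -ler_pdivlMr // div1r.
have h3 : 1 <= (1 - x) * (1 + x + 2 * x ^+ 2).
  have : 0 <= x ^+ 2 * (1 - 2 * x) by rewrite mulr_ge0 ?sqr_ge0 //; lra.
  nra.
rewrite -(@ler_pM2l _ (1 - x)) ?(le_trans h2) //; lra.
Qed.
End JumpArithmetic.

Section OneStepJump.
Variables (R : realType) (n m : nat) (h kap eta P z : R).
Hypothesis reg : step_regime m h kap eta P z.
Variables (E T : {set {set 'I_n}}) (tau : R).
Hypothesis disjET : [disjoint E & T].
Hypothesis tau0 : 0 <= tau.
Hypothesis sizeET : (#|T| + #|E|)%:R <= P.
Implicit Types (G : graph n) (i p q : nat).

Let wt := weight m h kap tau.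
Let Ph := Phi m h kap E T tau.

Lemma Phi_invalid i G f : f \in open_edges G -> ~~ valid E T G ->
  Ph i (f |: G) = 0 /\ forall k, Ph k G = 0.
Proof.
move=> fO nv; rewrite /Ph /Phi (negbTE nv); split=> //.
by case: ifP => // /(valid_del fO); rewrite (negbTE nv).
Qed.

Lemma Phi_jump i G f p q : f \in open_edges G -> valid E T G ->
  p = (#|T| + #|E :\: G|)%N -> q = #|E :\: G| ->
  `|Ph i.+1 (f |: G) - Ph i G| <= `|wt i.+1 p q - wt i p q| +
     (f \in kill_any G (pending E T G))%:R * wt i p q + (f \in E :\: G)%:R * wt i.+1 p.-1 q.-1.
Proof.
move=> fO vG -> ->; rewrite /Ph (Phi_add m h kap tau disjET i.+1 fO vG).2 /Phi vG.
apply: jump_cases; rewrite ?(weight_ge0 reg) //.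
  move=> fh; apply/(kill_anyP _ fO); exists f; last by rewrite /kills eqxx.
  by move: fh; rewrite inE => /andP [fE _]; rewrite inE fE orbT.
by rewrite inE => /andP [].
Qed.

Lemma weight_diff i p q : (i < m)%N -> p%:R <= P ->
  `|wt i.+1 p q - wt i p q| <=
    2 * (P * (h * (8 * tm h m + 4))) * wt i p q + q%:R / (m - i)%:R * wt i p q.
Proof.
move=> im pP; have [c0 [w1 [w2 _]]] := weight_split reg tau0 p q im.
have [a1 _ a2 _] := expR_alpha reg (ltnW im) pP.
have M0 : 0 < (m - i)%:R :> R by rewrite ltr0n subn_gt0.
set c := (Aw h i ^+ p * tau * kap ^+ q * ((m - i.+1) ^_ q.-1)%:R) in c0 w1 w2.
rewrite /wt w1 w2.
case: (posnP q) => [qz|q0].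
  rewrite qz /= mul0r mul0r addr0 !mulr1.
  by have := weight_diff_arith c0 a1 a2 (lexx 0) ler01; rewrite subr0 !mulr1 mulr0 addr0.
have -> : (if q is 0 then 1 else (m - i)%:R) = (m - i)%:R :> R by rewrite -(prednK q0).
have -> : (if q is 0 then 1 else (m - i)%:R - q%:R) = (m - i)%:R - q%:R :> R by rewrite -(prednK q0).
have -> : q%:R / (m - i)%:R * (c * (m - i)%:R) = c * q%:R by field; rewrite gt_eqF.
have [qM|qM] := leqP q (m - i); last first.
  suff -> : c = 0 by rewrite !mul0r subrr normr0 mulr0 addr0.
  by rewrite /c ffact_small ?mulr0 // -ltnS prednK // (leq_trans _ qM) // ltnS subnSK.
by apply: weight_diff_arith; rewrite ?ler0n ?ler_nat.
Qed.

(** Being chosen has chance 1/Q, about [Aw i * kap], and multiplies the weight by about 1/(Aw i *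
    kap * M), with M steps left; the product is of order 1/M. *)
Lemma weight_select i p q (Q rh : R) : (i < m)%N -> (0 < q)%N -> (0 < p)%N -> p%:R <= P ->
  0 < Q -> `|(Q * Aw h i * kap)^-1 - 1| <= eta ->
  Q^-1 * wt i.+1 p.-1 q.-1 <= 2 / (m - i)%:R * wt i p q.
Proof.
move=> im q0 p0 pP Q0 /near1 [_ rho].
have [[_ k0 /andP [eta0 eta1] _] _] := reg.
have [c0 [w1 [_ w3]]] := weight_split reg tau0 p q im.
have pP' : p.-1%:R <= P by apply: le_trans pP; rewrite ler_nat leq_pred.
have [_ a2 _ _] := expR_alpha reg (ltnW im) pP'.
have M0 : 0 < (m - i)%:R :> R by rewrite ltr0n subn_gt0.
set c := (Aw h i ^+ p * tau * kap ^+ q * ((m - i.+1) ^_ q.-1)%:R) in c0 w1 w3.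
rewrite /wt w1; have {}w3 := w3 q0 p0.
have -> : (if q is 0 then 1 else (m - i)%:R) = (m - i)%:R :> R by rewrite -(prednK q0).
have -> : Q^-1 * weight m h kap tau i.+1 p.-1 q.-1 =
    (Q * Aw h i * kap)^-1 * (weight m h kap tau i.+1 p.-1 q.-1 * (Aw h i * kap)).
  by field; rewrite !gt_eqF ?Aw_gt0.
rewrite w3; set al := (_ ^+ p.-1) in a2 *.
have al0 : 0 <= al by rewrite exprn_ge0 ?expR_ge0.
have -> : 2 / (m - i)%:R * (c * (m - i)%:R) = c * 2 by field; rewrite gt_eqF.
rewrite mulrCA ler_wpM2l //.
have r0 : 0 <= (Q * Aw h i * kap)^-1 by rewrite invr_ge0 !mulr_ge0 ?Aw_ge0 ?ltW.
apply: (@le_trans _ _ ((1 + eta) * (1 + eta))); first exact: ler_pM.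
by apply: (le_trans (sqr_1D _)); [apply/andP | lra].
Qed.

(** Expected absolute change, in which survival and closing do not cancel. Multiplied by a uniform
    jump bound it serves as the variance of the step. *)
Lemma Phi_absstep i G : (i < m)%N -> goodK h kap eta z i G -> valid E T G ->
  (\sum_(f in open_edges G) `|Ph i.+1 (f |: G) - Ph i G|) / (Q_ G)%:R <=
  P * (h * (24 * tm h m + 10) + 3 / (m - i)%:R) * Ph i G.
Proof.
move=> im gK vG; have [Q0 _ rho _] := gK.
have Q0' : 0 < (Q_ G)%:R :> R by rewrite ltr0n.
have pP := pend_size sizeET G.
have M0 : 0 < (m - i)%:R :> R by rewrite ltr0n subn_gt0.
have [[h0 _ /andP [eta0 eta1] [P1 _]] _] := reg.
have P0 : 0 <= P by apply: le_trans P1.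
have h0' := ltW h0.
set p := (#|T| + #|E :\: G|)%N in pP; set q := #|E :\: G| in p pP.
have w0 : 0 <= wt i p q by rewrite (weight_ge0 reg).
have PhE : Ph i G = wt i p q by rewrite /Ph /Phi vG.
rewrite PhE.
apply: (@le_trans _ _ ((\sum_(f in open_edges G) (`|wt i.+1 p q - wt i p q| +
     (f \in kill_any G (pending E T G))%:R * wt i p q +
     (f \in E :\: G)%:R * wt i.+1 p.-1 q.-1)) / (Q_ G)%:R)).
  rewrite ler_wpM2r ?invr_ge0 ?ler0n //; apply: ler_sum => f fO.
  by have := Phi_jump i fO vG (erefl p) (erefl q); rewrite PhE.
rewrite !big_split /= sumr_const -!mulr_suml (sum_indicator R (kill_any_open _ _)).
rewrite (sum_indicator R); last by case/andP: vG.
rewrite -[_ *+ #|_|]mulr_natl [leLHS]mulrDl [X in X + _ <= _]mulrDl.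
have t0 : 0 <= tm h m by exact: (tm_ge0 reg).
have /andP [_ xhi] := kill_fraction reg (ltnW im) gK vG disjET pP.
have ti := ler_tm reg (ltnW im).
have qP : q%:R <= P by apply: le_trans pP; rewrite ler_nat leq_addl.
have t1 : (Q_ G)%:R * `|wt i.+1 p q - wt i p q| / (Q_ G)%:R <=
    2 * (P * (h * (8 * tm h m + 4))) * wt i p q + P / (m - i)%:R * wt i p q.
  rewrite mulrAC divff ?gt_eqF // mul1r; apply: le_trans (weight_diff q im pP) _.
  by rewrite lerD2l !ler_wpM2r // invr_ge0 ltW.
have t2 : #|kill_any G (pending E T G)|%:R * wt i p q / (Q_ G)%:R <=
    P * (h * (8 * tm h m + 1)) * wt i p q.
  rewrite mulrAC ler_wpM2r //; apply: le_trans xhi _; rewrite -mulrA.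
  apply: ler_pM => //; first by rewrite mulr_ge0 ?addr_ge0 ?mulr_ge0 ?(tm_ge0 reg) // ltW.
  rewrite ler_wpM2l ?(ltW h0) // lerD // ?ler_wpM2l //.
  by apply: (@le_trans _ _ (2 * (1 / 4))); [rewrite ler_wpM2l | lra].
have t3 : #|E :\: G|%:R * wt i.+1 p.-1 q.-1 / (Q_ G)%:R <= 2 * (P / (m - i)%:R) * wt i p q.
  case: (posnP q) => [qz|q0].
    have -> : #|E :\: G| = 0%N by exact: qz.
    rewrite mul0r mul0r; apply: mulr_ge0 => //; apply: mulr_ge0 => //.
    by apply: divr_ge0.
  have p0 : (0 < p)%N by rewrite /p addn_gt0 q0 orbT.
  rewrite -mulrA [_ / _]mulrC.
  apply: (@le_trans _ _ (q%:R * (2 / (m - i)%:R * wt i p q))).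
    by rewrite ler_wpM2l ?ler0n // (weight_select 0 im q0 p0 pP Q0' rho).
  by rewrite mulrA ler_wpM2r // mulrCA ler_wpM2l // ler_wpM2r // invr_ge0 ltW.
apply: le_trans (lerD (lerD t1 t2) t3) _.
set Mi := (m - i)%:R^-1; set w := wt i p q in w0 *; set t := tm h m in t0 *.
have -> : P * (h * (24 * t + 10) + 3 * Mi) * w = 2 * (P * (h * (8 * t + 4))) * w + P * Mi * w +
    P * (h * (8 * t + 1)) * w + 2 * (P * Mi) * w + P * h * w by ring.
by rewrite lerDl; apply: mulr_ge0 => //; apply: mulr_ge0.
Qed.

(** A crude bound for steps that are treated separately: unless [f] is one of the missing edges, the
    weight can grow only through the factor [al ^+ p]. *)
Lemma Phi_unselected i G f : (i < m)%N -> f \in open_edges G -> f \notin E :\: G ->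
  Ph i.+1 (f |: G) <= 2 * Ph i G.
Proof.
move=> im fO fE; case: (boolP (valid E T G)) => [vG|nv]; last first.
  by have [-> ->] := Phi_invalid i.+1 fO nv; rewrite mulr0.
rewrite /Ph (Phi_add m h kap tau disjET i.+1 fO vG).2 /Phi vG.
have -> : f \in harmless E T G = false.
  by apply: contraNF fE; rewrite inE => /andP [].
rewrite mul0r addr0; apply: (@le_trans _ _ (wt i.+1 (#|T| + #|E :\: G|) #|E :\: G|)).
  by rewrite ler_piMl ?(weight_ge0 reg) //; case: (_ \notin _).
have pP := pend_size sizeET G.
have [a1 a2 _ _] := expR_alpha reg (ltnW im) pP.
have [[_ _ /andP [_ eta1] _] _] := reg.
have [c0 [w1 [w2 _]]] := weight_split reg tau0 (#|T| + #|E :\: G|) #|E :\: G| im.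
rewrite /wt w1 w2 [leRHS]mulrCA ler_wpM2l //.
have al2 : expR (8 * tm h i * h + 4 * h ^+ 2) ^+ (#|T| + #|E :\: G|) <= 2.
  by apply: le_trans a2 _; rewrite -[2]/(1 + 1) lerD2l quarter_le1.
case: #|E :\: G| al2 => [|q] al2; first by rewrite !mulr1.
apply: (@le_trans _ _ (expR (8 * tm h i * h + 4 * h ^+ 2) ^+ (#|T| + q.+1) * (m - i)%:R)).
  by rewrite ler_wpM2l ?exprn_ge0 ?expR_ge0 // gerBl ler0n.
by rewrite ler_wpM2r ?ler0n.
Qed.
End OneStepJump.

(** * The weighted count as a process: jumps, drift and tail *)

Lemma card_cover_le (T I : finType) (S : {set T}) (C : I -> {set T}) :
  (forall x, x \in S -> exists i, x \in C i) -> (#|S| <= \sum_i #|C i|)%N.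
Proof.
move=> cov; apply: (@leq_trans #|\bigcup_i C i|).
  apply: subset_leq_card; apply/fintype.subsetP => x /cov [i xC].
  by apply/finset.bigcupP; exists i.
elim/big_rec2: _ => [|i y1 y2 _ le]; first by rewrite cards0.
by rewrite cardsU (leq_trans (leq_subr _ _)) // leq_add2l.
Qed.

Lemma imset_pair (T T' : finType) (f : T -> T') (a b : T) : f @: [set a; b] = [set f a; f b].
Proof. by rewrite finset.imsetU !imset_set1. Qed.

Lemma pair_eq (T : finType) (a b x y : T) : x != y -> [set a; b] = [set x; y] ->
  (a = x /\ b = y) \/ (a = y /\ b = x).
Proof.
move=> xy /setP H; have := H a; rewrite !inE eqxx /= => /esym /orP [] /eqP aE; [left|right];
  split=> //; subst a.
- have := H y; rewrite !inE eqxx orbT eq_sym (negbTE xy) /= => /eqP yb; exact/esym.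
- have := H x; rewrite !inE eqxx (negbTE xy) /= => /eqP xb; exact/esym.
Qed.

Lemma split_count (o1 c1 s1 c2 o s j : nat) : (o1 + c1 = o -> s1 + c2 = s -> j <= s1 ->
  o + s - j = (c1 + c2) + (o1 + (s1 - j)))%N.
Proof. lia. Qed.

Section Shuffles.
Variable F : fieldType.
Lemma term_shuffle1 (ai k N a1 a2 t b : F) :
  ai * k * N * (a1 * a2 * t * b) = (ai * a1) * (k * N * (a2 * t * b)).
Proof. ring. Qed.
Lemma term_shuffle2 (b1 d1 N ao aq t bq bS : F) :
  (b1 * d1) * N * ((ao * aq) * t * (bq * bS)) = (d1 * t * (b1 * bS) * N) * (ao * (aq * bq)).
Proof. ring. Qed.
Lemma term_shuffle3 (d A s nk t be bE nc : F) : nk != 0 ->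
  d * (A * s / nk) * (t * (be * bE) * (nk * nc)) = (d * t * bE * nc) * (A * (be * s)).
Proof. by move=> ?; field. Qed.
Lemma term_shuffle4 (k x y w u : F) : k * x * y * w * u = k * (x * y * w * u).
Proof. ring. Qed.
Lemma term_shuffle5 (k N r c : F) : k * c * N * r = k * (c * (r * N)).
Proof. ring. Qed.
Lemma term_shuffle6 (x y t b : F) : x * y * t * b = y * (x * t * b).
Proof. ring. Qed.
End Shuffles.

Section TailArithmetic.
Variable R : realType.

Lemma drift_arith (sg dl Es W Wb' e hr u a S2 : R) : sg = 1 \/ sg = -1 ->
  Es <= e * W -> (1 - dl) * W - hr <= Es -> e * W <= (1 + 2 * dl) * W -> dl * W <= dl * Wb' ->
  0 <= hr -> 0 <= dl -> W <= Wb' -> 0 <= W -> a <= u -> - a <= S2 -> S2 <= a ->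
  sg * (Es - W - S2) <= 2 * dl * Wb' + u + hr.
Proof.
move=> [] -> *; rewrite ?mul1r ?mulN1r ?opprB; have : 0 <= dl * Wb' by apply: mulr_ge0 => //; lra.
  lra.
lra.
Qed.

(** Only one of the two factors [|D|] in the quadratic term is replaced by the jump bound; the other
    is kept for the expected absolute change, which is much smaller than [J]. *)
Lemma exp_arith (sg th J D : R) : sg = 1 \/ sg = -1 -> 0 <= th -> th * J <= 1 / 2 -> `|D| <= J ->
  expR (th * (sg * D)) <= 1 + 2 * th ^+ 2 * J * `|D| + th * (sg * D).
Proof.
move=> sgE th0 thJ DJ; have D0 := normr_ge0 D.
have nsg : `|sg * D| = `|D| by case: sgE => ->; rewrite ?mul1r ?mulN1r ?normrN.
have x2 : th * (sg * D) <= 1 / 2.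
  apply: le_trans (ler_norm _) _; rewrite normrM nsg (ger0_norm th0).
  by apply: le_trans thJ; apply: ler_wpM2l.
apply: le_trans (expR_quadratic x2) _; rewrite addrAC lerD2r lerD2l.
rewrite exprMn -[(sg * D) ^+ 2]real_normK ?num_real // nsg expr2 mulrA -[leRHS]mulrA.
by rewrite !mulrA ler_wpM2r // ler_wpM2l // !mulr_ge0 // sqr_ge0.
Qed.
End TailArithmetic.

Section CopyProcess.
Variables (V : finType) (n m : nat) (R : realType) (h kap eta P z : R) (kk : nat).
Variables (E O : {set {set V}}) (A : {set V}) (phi : {ffun V -> 'I_n}).
Variables (bp sn rho : R).
Implicit Types (G : graph n) (S X : {set {set V}}) (D K : {set V}) (psi : {ffun V -> 'I_n}).

Definition inside X K := #|[set e in X | e \subset K]|.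

Definition faith G : Prop :=
  permissible (E :|: [set e : {set V} | [&& #|e| == 2%N, e \subset A & phi @: e \in G]]) O.

(** The enriched patterns that one new edge brings into play: the edges of [S] are still open, [X]
    holds at most one extra edge, [D] at most one vertex with a pendant edge to [w]. Roots and [w]
    are arbitrary, since they depend on the new edge. *)
Definition goodJ i G : Prop := forall S X D (A' : {set V}) (phi' : {ffun V -> 'I_n}) w,
  S \subset E -> (#|X| <= 1)%N -> (#|D| <= 1)%N ->
  #|copies ((E :\: S) :|: X) (O :|: S) D A' phi' w G|%:R <=
  expR 1 * Bsum n ((E :\: S) :|: X) (O :|: S) D A' kk (Aw h i)^-1 (kap * i%:R) :> R.

(** With [sn] the square root of n, this is, up to powers of 2t, the reciprocal of the expected
    number of extensions of [A] to [K] at the final time: the factor by which rooting all of [K]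
    reduces the count. *)
Definition rY K : R := Aw h m ^+ inside O K * sn ^+ inside E K / n%:R ^+ #|K :\: A|.
Definition tau : R := (Aw h m)^-1 ^+ #|O|.
Definition Nt : R := tau * bp ^+ #|E| * n%:R ^+ #|~: A|.
Definition uw i p q : R := Aw h i ^+ p * tau * bp ^+ q.
Definition X0 : R := expR 1 * (2 * kk%:R) ^+ #|V| * Nt.
Definition Wb : R := 2 ^+ #|E| * X0.

Definition inj_ext psi := injectiveb psi && [forall a in A, psi a == phi a].
Definition Phis psi := Phi m h kap (img psi E) (img psi O) tau.
Definition Wp i G : R := \sum_(psi | inj_ext psi) Phis psi i G.
Definition Sof psi G := [set e in E | psi @: e \notin G].
Definition pvalid psi G := valid (img psi E) (img psi O) G.

(** [bp] stands in for [kap * m], the chance that a pair becomes an edge; it is an upper bound that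
    stays at least 1/[sn] for small times. [rho] bounds the gain from any further root or further
    edge. *)
Definition copy_regime : Prop :=
  [/\ 0 < bp, kap * m%:R <= bp, kap <= h * bp & Aw h m * bp <= 1] /\
  [/\ 1 <= bp * sn, (0 < n)%N, (0 < kk)%N & bp <= rho /\ rho <= 1] /\
  [/\ forall K, A \proper K -> rY K <= rho, 12 * eta * P <= 1,
      (#|O| + #|E|)%:R <= P & sn ^+ 2 = n%:R].

Definition structure_pair : Prop :=
  [/\ forall e, e \in E -> #|e| = 2%N, forall e, e \in O -> #|e| = 2%N, [disjoint E & O],
      permissible E O & forall e, e \in E :|: O -> ~~ (e \subset A)].

Hypothesis reg : step_regime m h kap eta P z.
Hypothesis creg : copy_regime.
Hypothesis spair : structure_pair.

Let bp0 : 0 < bp. Proof. by case: creg => -[]. Qed.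
Let bpge : 0 <= bp. Proof. exact: ltW. Qed.
Let tau0 : 0 <= tau. Proof. by rewrite exprn_ge0 // invr_ge0 Aw_ge0. Qed.
Let rho0 : 0 <= rho.
Proof. by case: creg => _ [[_ _ _ [br _]] _]; exact: le_trans br. Qed.
Let Nt0 : 0 <= Nt.
Proof. by apply: mulr_ge0; [apply: mulr_ge0 => //|]; exact: exprn_ge0. Qed.
Let X00 : 0 <= X0.
Proof.
by apply: mulr_ge0 => //; apply: mulr_ge0; rewrite ?expR_ge0 // exprn_ge0 // mulr_ge0.
Qed.
Let Wb0 : 0 <= Wb. Proof. by apply: mulr_ge0 => //; exact: exprn_ge0. Qed.
Let bp1 : bp <= 1.
Proof. by case: creg => _ [[_ _ _ [br r1]] _]; exact: le_trans br r1. Qed.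
Let kap0 : 0 <= kap. Proof. by case: reg => -[_ /ltW]. Qed.

Lemma Xr0 : 0 <= X0 * rho. Proof. exact: mulr_ge0. Qed.

Lemma uw_ge0 i p q : 0 <= uw i p q.
Proof. by apply: mulr_ge0; [apply: mulr_ge0 => //|]; rewrite exprn_ge0 // Aw_ge0. Qed.

Lemma cnt_inside X K : (inside X K + cnt X K = #|X|)%N.
Proof.
rewrite -(cardsID [set e : {set V} | e \subset K] X); congr (_ + _)%N; apply: eq_card => e;
  by rewrite !inE // andbC.
Qed.

Lemma cntU X (Y : {set {set V}}) K : [disjoint X & Y] -> cnt (X :|: Y) K = (cnt X K + cnt Y K)%N.
Proof.
move=> dis; rewrite /cnt -cardsUI (_ : _ :&: _ = finset.set0) ?cards0 ?addn0.
  by apply: eq_card => e; rewrite !inE andb_orl.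
apply/setP => e; rewrite !inE; move/disjoint_setI0: dis => /setP /(_ e); rewrite !inE.
by case: (e \in X); case: (e \in Y); rewrite ?andbF.
Qed.

Lemma inside0 X : (forall e, e \in X -> ~~ (e \subset A)) -> inside X A = 0%N.
Proof. by move=> H; apply: eq_card0 => e; rewrite !inE; apply/negP => /andP [/H /negP]. Qed.

Lemma rY_A : rY A = 1.
Proof.
case: spair => _ _ _ _ ind.
rewrite /rY !inside0 ?finset.setDv ?cards0 ?expr0 ?mulr1 ?divr1 //;
  by move=> e eX; apply: ind; rewrite inE eX ?orbT.
Qed.

Lemma rY_ge0 K : 0 <= rY K.
Proof.
case: creg => _ [[bs _ _ _] _].
rewrite /rY !mulr_ge0 ?invr_ge0 ?exprn_ge0 ?Aw_ge0 //.
by rewrite -(pmulr_rge0 _ bp0) (le_trans _ bs).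
Qed.

Lemma rY_le1 K : A \subset K -> rY K <= 1.
Proof.
move=> AK; case: (eqVneq A K) => [<-|nAK]; first by rewrite rY_A.
case: creg => _ [[_ _ _ [_ r1]] [rr _ _ _]]; apply: le_trans r1; apply: rr.
by rewrite finset.properEneq nAK.
Qed.

(** The weight supplies the factors for the missing edges [S] that the count lacks, so the product
    no longer depends on [S]. What remains relative to [Nt] is [rY K] for the vertices treated as
    rooted and one [bp] for each extra edge that leaves [K]. *)
Lemma term_bound S X D K i j : S \subset E -> [disjoint E & X] -> A \subset K -> (i <= m)%N ->
  (j <= inside S K)%N ->
  (Aw h i)^-1 ^+ cnt (O :|: S) K * (kap * i%:R) ^+ (cnt ((E :\: S) :|: X) K + #|D :\: K|) *
    n%:R ^+ #|~: K| * uw i (#|O| + #|S| - j) (#|S| - j) <=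
  bp ^+ (cnt X K + #|D :\: K|) * rY K * Nt.
Proof.
move=> SE dEX AK im jS; case: spair => _ _ dEO _ _.
case: creg => -[_ kbp _ Ab] [[bs n0 _ _] _].
have dOS : [disjoint O & S].
  by rewrite disjoint_sym; apply: disjointWl SE dEO.
have dX : [disjoint E :\: S & X] by apply: disjointWl (finset.subsetDl _ _) dEX.
have cE : (cnt (E :\: S) K + cnt S K = cnt E K)%N.
  rewrite -cntU; last by rewrite -setI_eq0 finset.setDE -finset.setIA [_ :&: S]finset.setIC finset.setICr finset.setI0.
  by rewrite finset.setUC -{1}(finset.setIidPr SE) finset.setID.
rewrite (cntU K dOS) (cntU K dX).
have oO := cnt_inside O K; have oS := cnt_inside S K; have oE := cnt_inside E K.
set a := Aw h i; have a0 : 0 < a by exact: Aw_gt0.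
have aAm : a <= Aw h m by exact: (ler_Aw reg).
have ane : a != 0 by rewrite gt_eqF.
have nA : #|~: A| = (#|K :\: A| + #|~: K|)%N.
  rewrite -cardsUI (_ : _ :&: _ = finset.set0) ?cards0 ?addn0.
    apply: eq_card => v; rewrite !inE; have := fintype.subsetP AK v.
    by case: (v \in A); case: (v \in K) => //= /(_ isT).
  by apply/setP => v; rewrite !inE; case: (v \in K); rewrite ?andbF.
have -> := split_count oO oS jS.
have -> : (#|S| - j = (inside S K - j) + cnt S K)%N by rewrite -oS addnBAC.
rewrite /uw -/a.
set q := (inside S K - j)%N; set d := (cnt X K + #|D :\: K|)%N.
have -> : (cnt (E :\: S) K + cnt X K + #|D :\: K| = cnt (E :\: S) K + d)%N by rewrite addnA.
rewrite [a ^+ (_ + (_ + q))]exprD term_shuffle1 -exprMn mulVf // expr1n mul1r.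
apply: (@le_trans _ _ (bp ^+ (cnt (E :\: S) K + d) * n%:R ^+ #|~: K| *
   (a ^+ (inside O K + q) * tau * bp ^+ (q + cnt S K)))).
  apply: ler_wpM2r.
    by apply: mulr_ge0; [apply: mulr_ge0 => //|]; rewrite exprn_ge0 ?(ltW a0).
  apply: ler_wpM2r; first exact: exprn_ge0.
  rewrite lerXn2r ?nnegrE ?mulr_ge0 //; apply: le_trans kbp.
  by rewrite ler_wpM2l // ler_nat.
rewrite (exprD bp _ d) (exprD a) (exprD bp q) term_shuffle2 -(exprD bp (cnt _ K)) cE.
rewrite -[a ^+ q * _]exprMn /Nt /rY nA -oE (exprD bp (inside _ _)) (exprD n%:R).
have nk : n%:R ^+ #|K :\: A| != 0 :> R by rewrite expf_neq0 // pnatr_eq0 -lt0n.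
rewrite (term_shuffle3 _ _ _ _ _ _ _ nk) -[bp ^+ _ * sn ^+ _]exprMn.
apply: ler_wpM2l.
  by apply: mulr_ge0; [apply: mulr_ge0; [apply: mulr_ge0 => //; exact: exprn_ge0|]|]; exact: exprn_ge0.
apply: ler_pM; rewrite ?exprn_ge0 ?mulr_ge0 ?(ltW a0) //.
  by rewrite lerXn2r ?nnegrE ?(ltW a0) ?Aw_ge0.
apply: (@le_trans _ _ 1); last by rewrite exprn_ege1.
rewrite exprn_ile1 ?mulr_ge0 ?(ltW a0) // (le_trans _ Ab) // ler_wpM2r //.
Qed.

Lemma count_bound S X D (A' : {set V}) (phi' : {ffun V -> 'I_n}) w i j (r : R) G : (i <= m)%N -> goodJ i G ->
  S \subset E -> (#|X| <= 1)%N -> (#|D| <= 1)%N -> [disjoint E & X] -> A \subset A' ->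
  (forall K, A' \subset K -> (j <= inside S K)%N) ->
  (forall K, A' \subset K -> bp ^+ (cnt X K + #|D :\: K|) * rY K <= r) ->
  #|copies ((E :\: S) :|: X) (O :|: S) D A' phi' w G|%:R * uw i (#|O| + #|S| - j) (#|S| - j)
  <= X0 * r.
Proof.
move=> im gJ SE X1 D1 dEX AA' jS rK.
have u0 : 0 <= uw i (#|O| + #|S| - j) (#|S| - j).
  exact: uw_ge0.
apply: le_trans (ler_wpM2r u0 (gJ S X D A' phi' w SE X1 D1)) _.
rewrite -[leLHS]mulrA /X0 -[expR 1 * _ * Nt]mulrA -[leRHS]mulrA.
apply: ler_wpM2l; first exact: expR_ge0.
rewrite /Bsum mulr_suml.
have kk1 : 1 <= kk%:R :> R by case: creg => _ [[_ _ k0 _] _]; rewrite ler1n.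
apply: (@le_trans _ _ (\sum_(K : {set V} | A' \subset K) kk%:R ^+ #|V| * (r * Nt))).
  apply: ler_sum => K A'K; rewrite term_shuffle4; apply: ler_pM; rewrite ?exprn_ge0 //.
  - apply: mulr_ge0; last exact: uw_ge0.
    by rewrite !mulr_ge0 ?exprn_ge0 ?invr_ge0 ?Aw_ge0 ?mulr_ge0.
  - by rewrite ler_weXn2l // max_card.
  - apply: le_trans (term_bound D SE dEX (fintype.subset_trans AA' A'K) im (jS K A'K)) _.
    by rewrite ler_wpM2r // rK.
have r0 : 0 <= r.
  by apply: le_trans (rK A' (fintype.subxx _)); rewrite mulr_ge0 ?exprn_ge0 ?rY_ge0.
rewrite exprMn term_shuffle5.
rewrite sumr_const -[leLHS]mulr_natl; apply: ler_wpM2r.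
  by apply: mulr_ge0; [exact: exprn_ge0 | exact: mulr_ge0].
rewrite -natrX ler_nat -cardsT -card_powerset; apply: subset_leq_card.
by apply/fintype.subsetP => K _; rewrite powersetE finset.subsetT.
Qed.

Lemma rK_proper X D (A' : {set V}) : A \proper A' ->
  forall K, A' \subset K -> bp ^+ (cnt X K + #|D :\: K|) * rY K <= rho.
Proof.
move=> AA' K A'K; have rr : rY K <= rho.
  by case: creg => _ [_ [rr _ _ _]]; apply: rr; exact: fintype.proper_sub_trans AA' A'K.
by rewrite (le_trans _ rr) // ler_piMl ?rY_ge0 // exprn_ile1.
Qed.

(** For [K] larger than [A] the gain comes from [rY K]; for [K] equal to [A], where [rY] is 1, it
    comes from an edge outside the pattern, worth [bp]. *)
Lemma rK_extra X D (A' : {set V}) : A \subset A' -> (0 < cnt X A + #|D :\: A|)%N ->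
  forall K, A' \subset K -> bp ^+ (cnt X K + #|D :\: K|) * rY K <= rho.
Proof.
move=> AA' ex K A'K; case: (eqVneq A K) => [<-|nAK]; last first.
  apply: (@rK_proper X D K) => //; rewrite finset.properEneq nAK.
  exact: fintype.subset_trans AA' A'K.
rewrite rY_A mulr1; have br : bp <= rho by case: creg => _ [[_ _ _ []]].
apply: le_trans br; rewrite -(prednK ex) exprS ler_piMr // exprn_ile1 //.
Qed.

Lemma rK_one X D (A' : {set V}) : A \subset A' ->
  forall K, A' \subset K -> bp ^+ (cnt X K + #|D :\: K|) * rY K <= 1.
Proof.
move=> AA' K A'K; rewrite mulr_ile1 ?exprn_ge0 ?rY_ge0 ?exprn_ile1 //.
by apply: rY_le1; exact: fintype.subset_trans AA' A'K.
Qed.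

Lemma weight_le_uw i p q : weight m h kap tau i p q <= uw i p q.
Proof.
case: creg => -[_ kbp _ _] _.
rewrite /weight /uw -[leLHS]mulrA; apply: ler_wpM2l.
  by apply: mulr_ge0 => //; rewrite exprn_ge0 ?Aw_ge0.
apply: (@le_trans _ _ ((kap * m%:R) ^+ q)); last first.
  by rewrite lerXn2r ?nnegrE ?mulr_ge0.
rewrite exprMn ler_wpM2l ?exprn_ge0 // -natrX ler_nat.
apply: (@leq_trans ((m - i) ^ q)); last by case: q => // q; rewrite leq_exp2r // leq_subr.
elim: q => [|q IH]; first by rewrite ffactn0.
by rewrite ffactnSr expnSr leq_mul // leq_subr.
Qed.

Section OneMap.
Variable psi : {ffun V -> 'I_n}.
Hypothesis ext : inj_ext psi.

Lemma inj_extP : injective psi /\ forall a, a \in A -> psi a = phi a.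
Proof.
by case/andP: ext => /injectiveP inj /forall_inP agr; split=> // a /agr /eqP.
Qed.

Let inj := inj_extP.1.

Lemma card_img X : #|img psi X| = #|X|.
Proof. by rewrite card_imset //; exact: imset_inj. Qed.

Lemma mem_img X (e : {set V}) : (psi @: e \in img psi X) = (e \in X).
Proof. by rewrite (mem_imset _ _ (imset_inj inj)). Qed.

Lemma disj_img : [disjoint img psi E & img psi O].
Proof.
case: spair => _ _ dEO _ _; apply/pred0P => x; apply/negP => /= /andP [/imsetP [e eE ->]].
by rewrite mem_img => eO; move/pred0P: dEO => /(_ e) /=; rewrite eE eO.
Qed.

Lemma img_Sof G : img psi E :\: G = img psi (Sof psi G).
Proof.
apply/setP => x; apply/idP/idP.
  rewrite inE => /andP [xG /imsetP [e eE xe]]; rewrite xe mem_img inE eE -xe.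
  exact: xG.
by move=> /imsetP [e]; rewrite inE => /andP [eE eG] ->; rewrite inE mem_img eE eG.
Qed.

Lemma card_Sof G : #|img psi E :\: G| = #|Sof psi G|.
Proof. by rewrite img_Sof card_img. Qed.

Lemma pvalid_copies S X D (A' : {set V}) (phi' : {ffun V -> 'I_n}) w G : pvalid psi G -> Sof psi G = S ->
  (forall a, a \in A' -> psi a = phi' a) ->
  (forall p, p \in X -> psi @: p \in G) ->
  (forall b, b \in D -> (forall c, psi c != w) /\ [set psi b; w] \in G) ->
  psi \in copies ((E :\: S) :|: X) (O :|: S) D A' phi' w G.
Proof.
move=> /andP [TO EO] SE agr XG DG; rewrite inE; apply/and3P; split.
- apply/and3P; split; first by case/andP: ext.
  + by apply/forall_inP => a /agr ->.
  + by apply/forall_inP => b /DG [nw _]; apply/forallP.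
- rewrite finset.subUset; apply/andP; split; apply/fintype.subsetP => x /imsetP.
  + move=> [e]; rewrite !inE => /orP [/andP [eS eE] ->|eX ->]; last exact: XG.
    by move: eS; rewrite -SE inE eE /= negbK.
  + by move=> [b bD ->]; case: (DG b bD).
- apply/fintype.subsetP => x /imsetP [e]; rewrite inE => /orP [eO|eS] ->.
    by apply: (fintype.subsetP TO); rewrite mem_img.
  by apply: (fintype.subsetP EO); rewrite img_Sof mem_img SE.
Qed.

Lemma Phis_valid i G : pvalid psi G ->
  Phis psi i G = weight m h kap tau i (#|O| + #|Sof psi G|) #|Sof psi G|.
Proof. by move=> v; rewrite /Phis /Phi -/(pvalid psi G) v card_Sof card_img. Qed.

Lemma sizeP_img : (#|img psi O| + #|img psi E|)%:R <= P.
Proof. by rewrite !card_img; case: creg => _ [_ []]. Qed.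
End OneMap.

(** The weight depends on a copy only through its set of missing edges, so the copies fall into at
    most 2^|E| classes. *)
Lemma sum_by_S i j G (X : pred {ffun V -> 'I_n}) (B : R) : 0 <= B ->
  (forall S, S \subset E ->
     #|[set psi | [&& inj_ext psi, pvalid psi G, X psi & Sof psi G == S]]|%:R *
     uw i (#|O| + #|S| - j) (#|S| - j) <= B) ->
  \sum_(psi | [&& inj_ext psi, pvalid psi G & X psi])
     uw i (#|O| + #|Sof psi G| - j) (#|Sof psi G| - j) <= 2 ^+ #|E| * B.
Proof.
move=> B0 HB; rewrite (partition_big (fun psi => Sof psi G) (fun S => S \in powerset E)) /=; last first.
  by move=> psi _; rewrite powersetE; apply/fintype.subsetP => e; rewrite inE => /andP [].
rewrite -natrX -card_powerset mulr_natl -sumr_const.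
apply: ler_sum => S; rewrite powersetE => SE.
rewrite (eq_bigr (fun=> uw i (#|O| + #|S| - j) (#|S| - j))); last by move=> psi /andP [_ /eqP ->].
rewrite sumr_const -[leLHS]mulr_natl; apply: le_trans (HB S SE).
apply: ler_wpM2r; first exact: uw_ge0.
rewrite ler_nat; apply: eq_leq; apply: eq_card => psi; rewrite !inE unfold_in /=.
by rewrite -!andbA.
Qed.

Lemma valid_sum_le (w : 'I_n) i G : (i <= m)%N -> goodJ i G ->
  \sum_(psi | [&& inj_ext psi, pvalid psi G & predT psi])
     uw i (#|O| + #|Sof psi G| - 0) (#|Sof psi G| - 0) <= Wb.
Proof.
move=> im gJ; apply: sum_by_S => // S SE.
have := @count_bound S finset.set0 finset.set0 A phi w i 0 1 G im gJ SE.
rewrite !cards0 mulr1 => /(_ isT isT) H.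
apply: le_trans (H _ _ _ _) => //.
- apply: ler_wpM2r; first exact: uw_ge0.
  rewrite ler_nat; apply: subset_leq_card; apply/fintype.subsetP => psi.
  rewrite inE => /and4P [ext v _ /eqP SS]; apply: pvalid_copies => //.
  + exact: (inj_extP ext).2.
  + by move=> p; rewrite inE.
  + by move=> b; rewrite inE.
- by rewrite -setI_eq0 finset.setI0.
- exact: rK_one.
Qed.

Lemma Wp_le (w : 'I_n) i G : (i <= m)%N -> goodJ i G -> Wp i G <= Wb.
Proof.
move=> im gJ; apply: le_trans (valid_sum_le w im gJ); rewrite /Wp.
rewrite (bigID (fun psi => pvalid psi G)) /= [X in _ + X]big1 ?addr0; last first.
  by move=> psi /andP [_ nv]; rewrite /Phis /Phi -/(pvalid psi G) (negbTE nv).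
rewrite (eq_bigl (fun psi => inj_ext psi && pvalid psi G)) //.
rewrite [leRHS](eq_bigl (fun psi => inj_ext psi && pvalid psi G)) => [|psi]; last by rewrite andbT.
apply: ler_sum => psi /andP [ext v]; rewrite (Phis_valid ext i v) !subn0.
exact: weight_le_uw.
Qed.

Lemma Wp_ge0 i G : 0 <= Wp i G.
Proof. by apply: sumr_ge0 => psi _; exact: (Phi_ge0 reg). Qed.

Lemma faith_sub G f : faith (f |: G) -> faith G.
Proof.
move=> H e1 e2 e3 h1 h2 h3; apply: H;
  [move: h1|move: h2|move: h3]; rewrite !inE => /orP [/orP [->|/and3P [-> -> ->]]|->];
  by rewrite ?orbT.
Qed.

Lemma piece_bound S X D (A' : {set V}) (phi' : {ffun V -> 'I_n}) w i j (r : R) G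
    (C : {set {ffun V -> 'I_n}}) : (i <= m)%N -> goodJ i G ->
  S \subset E -> (#|X| <= 1)%N -> (#|D| <= 1)%N -> [disjoint E & X] -> A \subset A' ->
  (forall K, A' \subset K -> (j <= inside S K)%N) ->
  (forall K, A' \subset K -> bp ^+ (cnt X K + #|D :\: K|) * rY K <= r) ->
  (forall psi, psi \in C -> [/\ inj_ext psi, pvalid psi G & Sof psi G = S] /\
     [/\ forall a, a \in A' -> psi a = phi' a, forall p, p \in X -> psi @: p \in G
       & forall b, b \in D -> (forall c, psi c != w) /\ [set psi b; w] \in G]) ->
  #|C|%:R * uw i (#|O| + #|S| - j) (#|S| - j) <= X0 * r.
Proof.
move=> im gJ SE X1 D1 dEX AA' jS rK HC.
apply: le_trans (count_bound phi' w im gJ SE X1 D1 dEX AA' jS rK).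
apply: ler_wpM2r; first exact: uw_ge0.
rewrite ler_nat; apply: subset_leq_card; apply/fintype.subsetP => psi /HC [[ext v SS] [h1 h2 h3]].
exact: pvalid_copies.
Qed.

Lemma disj0 : [disjoint E & (finset.set0 : {set {set V}})].
Proof. by rewrite -setI_eq0 finset.setI0. Qed.

Lemma OS_indep S a b : S \subset E -> [set a; b] \in O :|: S -> ~~ ([set a; b] \subset A).
Proof.
case: spair => _ _ _ _ ind SE; rewrite inE => abO; apply: ind; rewrite inE.
by case/orP: abO => [->|/(fintype.subsetP SE) ->]; rewrite ?orbT.
Qed.

Section Pieces.
Variables (x' y' : 'I_n) (S : {set {set V}}) (G : graph n) (i : nat).
Hypotheses (im : (i <= m)%N) (gJ : goodJ i G) (SE : S \subset E).

Definition base_piece psi a b :=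
  [&& inj_ext psi, pvalid psi G, Sof psi G == S, [set a; b] \in O :|: S, a != b & psi a == x'].

Lemma base_pieceP psi a b : base_piece psi a b ->
  [/\ inj_ext psi, pvalid psi G & Sof psi G = S] /\
  [/\ [set a; b] \in O :|: S, a != b & psi a = x'].
Proof. by move=> /and5P [? ? /eqP ? ? /andP [? /eqP]]. Qed.

Lemma nobase a b (Q : pred {ffun V -> 'I_n}) j (r : R) : 0 <= r ->
  ~~ ([set a; b] \in O :|: S) -> #|[set psi | base_piece psi a b && Q psi]|%:R *
   uw i (#|O| + #|S| - j) (#|S| - j) <= X0 * r.
Proof.
move=> r0 nab; rewrite (_ : [set psi | _] = finset.set0); first by rewrite cards0 mul0r; apply: mulr_ge0.
apply/setP => psi; rewrite !inE; apply/negP => /andP [/base_pieceP [_ [ab _ _]] _].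
by rewrite ab in nab.
Qed.

Definition root2 a u b v : {ffun V -> 'I_n} :=
  [ffun s => if s == a then u else if s == b then v else phi s].

Lemma root2P psi a u b v : inj_ext psi -> psi a = u -> psi b = v ->
  forall s, s \in A :|: [set a; b] -> psi s = root2 a u b v s.
Proof.
move=> ext <- <- s; rewrite ffunE !inE; case: eqP => [->//|_]; case: eqP => [->//|_].
by rewrite !orbF => sA; exact: (inj_extP ext).2.
Qed.

(** Both ends of the new edge are images of [a] and [b], which do not both lie in [A], so there is a
    new root. The value [j = 1] serves the weight after the edge has been chosen. *)
Lemma type0_bound a b j : (j = 0%N \/ (j = 1%N /\ [set a; b] \in S)) ->
  #|[set psi | base_piece psi a b && (psi b == y')]|%:R *
   uw i (#|O| + #|S| - j) (#|S| - j) <= X0 * rho.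
Proof.
move=> jj; case: (boolP ([set a; b] \in O :|: S)) => [ab|]; last exact: nobase.
have prop : A \proper A :|: [set a; b].
  rewrite fintype.properE finset.subsetUl /= finset.subUset negb_and; apply/orP; right.
  exact: OS_indep SE ab.
apply: (@piece_bound S finset.set0 finset.set0 (A :|: [set a; b]) (root2 a x' b y') y' i j rho G) => //.
- by rewrite cards0.
- by rewrite cards0.
- exact: disj0.
- exact: finset.subsetUl.
- move=> K AK; case: jj => [->//|[-> abS]].
  rewrite card_gt0; apply/finset.set0Pn; exists [set a; b]; rewrite inE abS /=.
  by apply: fintype.subset_trans AK; exact: finset.subsetUr.
- exact: rK_proper.
move=> psi; rewrite inE => /andP [/base_pieceP [[e1 e2 e3] [_ _ pa]] /eqP pb]; split=> //; split.
- exact: root2P.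
- by move=> p; rewrite inE.
- by move=> p; rewrite inE.
Qed.

(** The third vertex of the triangle lies outside the copy. If [a] is in [A], rooting it gains
    nothing, but then [b] is not in [A] and its pendant edge to [y'] gives the factor. *)
Lemma type1_bound a b :
  #|[set psi | base_piece psi a b && ([forall v, psi v != y'] && ([set psi b; y'] \in G))]|%:R *
   uw i (#|O| + #|S| - 0) (#|S| - 0) <= X0 * rho.
Proof.
case: (boolP ([set a; b] \in O :|: S)) => [ab|]; last exact: nobase.
apply: (@piece_bound S finset.set0 [set b] (A :|: [set a; a]) (root2 a x' a x') y' i 0 rho G) => //.
- by rewrite cards0.
- by rewrite cards1.
- exact: disj0.
- exact: finset.subsetUl.
- case: (boolP (a \in A)) => [aA|aA].
    apply: rK_extra; first exact: finset.subsetUl.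
    rewrite addn_gt0; apply/orP; right; rewrite card_gt0; apply/finset.set0Pn; exists b.
    rewrite !inE eqxx andbT; apply: contra (OS_indep SE ab) => bA.
    by apply/fintype.subsetP => v; rewrite !inE => /orP [] /eqP ->.
  apply: rK_proper; rewrite fintype.properE finset.subsetUl /=.
  by apply: contra aA => /fintype.subsetP /(_ a); apply; rewrite !inE eqxx /= orbT.
move=> psi; rewrite inE => /andP [/base_pieceP [[e1 e2 e3] [_ _ pa]] /andP [/forallP nw bG]].
split=> //; split.
- exact: root2P.
- by move=> p; rewrite inE.
- by move=> p; rewrite inE => /eqP ->.
Qed.

(** The third vertex is the image of [c]. Either [a] or [c] is a new root, or {b, c} is an edge
    outside the pattern, or both are rooted and {b, c} is in the pattern. The last case gives no
    gain; it is assumed empty here and excluded later by faithfulness. *)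
Lemma type2_bound a b c : (a \in A -> c \in A -> [set b; c] \in E ->
    [set psi | base_piece psi a b && [&& psi c == y', b != c, a != c & [set psi b; psi c] \in G]]
      = finset.set0) ->
  #|[set psi | base_piece psi a b && [&& psi c == y', b != c, a != c & [set psi b; psi c] \in G]]|%:R *
   uw i (#|O| + #|S| - 0) (#|S| - 0) <= X0 * rho.
Proof.
move=> H; case: (boolP ([set a; b] \in O :|: S)) => [ab|]; last exact: nobase.
pose X := if [set b; c] \in E then finset.set0 else [set [set b; c]].
have H0 C : C = finset.set0 -> #|C : {set {ffun V -> 'I_n}}|%:R * uw i (#|O| + #|S| - 0) (#|S| - 0) <= X0 * rho.
  by move=> ->; rewrite cards0 mul0r Xr0.
case: (boolP [&& a \in A, c \in A & [set b; c] \in E]) => [/and3P [aA cA bcE]|ncase].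
  by apply: H0; exact: H.
have [bc|bc] := boolP (b != c); last first.
  by apply: H0; apply/setP => psi; rewrite !inE /= !andbF.
apply: (@piece_bound S X finset.set0 (A :|: [set a; c]) (root2 a x' c y') y' i 0 rho G) => //.
- by rewrite /X; case: ifP; rewrite ?cards0 ?cards1.
- by rewrite cards0.
- rewrite /X; case: ifP => [_|nE]; first exact: disj0.
  by rewrite disjoint_sym disjoints1 nE.
- exact: finset.subsetUl.
- case: (boolP ((a \in A) && (c \in A))) => [/andP [aA cA]|nac].
    apply: rK_extra; first exact: finset.subsetUl.
    rewrite aA cA /= in ncase; rewrite /X (negbTE ncase) addn_gt0; apply/orP; left.
    rewrite card_gt0; apply/finset.set0Pn; exists [set b; c]; rewrite !inE eqxx /=.
    apply: contra (OS_indep SE ab) => /fintype.subsetP bA.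
    apply/fintype.subsetP => v; rewrite !inE => /orP [] /eqP -> //.
    by apply: bA; rewrite !inE eqxx.
  apply: rK_proper; rewrite fintype.properE finset.subsetUl /=.
  apply: contra nac => /fintype.subsetP sub; apply/andP; split; apply: sub; by rewrite !inE eqxx ?orbT.
move=> psi; rewrite inE => /andP [/base_pieceP [[e1 e2 e3] [_ _ pa]] /and4P [/eqP pc _ _ bcG]].
split=> //; split.
- exact: root2P.
- by move=> p; rewrite /X; case: ifP => _; rewrite inE // => /eqP ->; rewrite imset_pair.
- by move=> p; rewrite inE.
Qed.
End Pieces.

Lemma mem_pending psi G r : inj_ext psi -> r \in pending (img psi E) (img psi O) G ->
  exists2 r0, r0 \in O :|: Sof psi G & r = psi @: r0.
Proof.
move=> ext; rewrite /pending (img_Sof ext _) inE => /orP [] /imsetP [r0 rr ->]; exists r0 => //;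
  by rewrite inE rr ?orbT.
Qed.

Lemma OS_pair S (r0 : {set V}) : S \subset E -> r0 \in O :|: S -> #|r0| = 2%N.
Proof.
case: spair => E2 O2 _ _ _ SE; rewrite inE => /orP [/O2 //|/(fintype.subsetP SE) /E2 //].
Qed.

Lemma Sof_sub psi G : Sof psi G \subset E.
Proof. by apply/fintype.subsetP => e; rewrite inE => /andP []. Qed.

Lemma kill_cover (x y : 'I_n) psi G f : x != y -> f = [set x; y] -> f \in open_edges G ->
  inj_ext psi -> f \in kill_any G (pending (img psi E) (img psi O) G) ->
  exists (o : bool) a b, let x' := if o then x else y in let y' := if o then y else x in
    [/\ [set a; b] \in O :|: Sof psi G, a != b, psi a = x' &
      [\/ psi b = y', (forall v, psi v != y') /\ [set psi b; y'] \in G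
        | exists c, [/\ psi c = y', b != c, a != c & [set psi b; psi c] \in G]]].
Proof.
move=> xy fE fO ext /(kill_anyP _ fO) [r /(mem_pending ext) [r0 r0O ->]].
have inj := (inj_extP ext).1.
have /eqP /cards2P [a [b [ab r0E]]] := OS_pair (Sof_sub psi G) r0O.
rewrite /kills => /orP [/eqP fr|/existsP [g /andP [gG /triangleP [p [q [s [[pq ps qs] [rE fE' gE]]]]]]]].
  move: fr; rewrite fE r0E imset_pair => /esym /(pair_eq xy) [[pa pb]|[pa pb]].
    by exists true, a, b; split=> //; [rewrite -r0E|constructor 1].
  by exists false, a, b; split=> //; [rewrite -r0E|constructor 1].
have [a0 [b0 [ab0 r0E' pa0 pb0]]] : exists a0 b0, [/\ a0 != b0, r0 = [set a0; b0], psi a0 = p & psi b0 = q].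
  move: rE; rewrite r0E imset_pair => /(pair_eq pq) [[pa pb]|[pa pb]].
    by exists a, b.
  by exists b, a; split=> //; rewrite 1?eq_sym // finset.setUC.
have [ori [px sy]] : exists o : bool, p = (if o then x else y) /\ s = (if o then y else x).
  by move: fE'; rewrite fE => /esym /(pair_eq xy) [[-> ->]|[-> ->]]; [exists true|exists false].
exists ori, a0, b0; split=> //; first by rewrite -r0E'.
  by rewrite pa0.
rewrite -sy; case: (boolP [forall v, psi v != s]) => [/forallP nv|].
  by constructor 2; split=> //; rewrite pb0 -gE.
rewrite negb_forall => /existsP [c /negPn /eqP pc]; constructor 3; exists c; split=> //.
- by apply: contraNneq qs => bc; rewrite -pb0 -pc bc.
- by apply: contraNneq ps => ac; rewrite -pa0 -pc ac.
- by rewrite pb0 pc -gE.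
Qed.

(** The edge {a, c} lies inside [A] and is present in the graph, {b, c} is a pattern edge, so the
    triangle a, b, c has at most one element of [O], against permissibility. *)
Lemma faith_triangle S psi G a b c : S \subset E -> faith G -> inj_ext psi ->
  [set a; b] \in O :|: S -> [set b; c] \in E -> a != b -> b != c -> a != c ->
  a \in A -> c \in A -> [set psi a; psi c] \in G -> False.
Proof.
case: spair => E2 O2 dEO _ ind SE fa ext abO bcE ab bc ac aA cA acG.
have agr := (inj_extP ext).2.
have acA : [set a; c] \subset A by apply/fintype.subsetP => v; rewrite !inE => /orP [] /eqP ->.
have abE : [set a; b] \in E :|: O.
  by move: abO; rewrite !inE => /orP [->|/(fintype.subsetP SE) ->]; rewrite ?orbT.
have tri : triangle [set a; b] [set a; c] [set b; c] by apply/triangleP; exists a, b, c.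
have bcO : [set b; c] \in O = false.
  by apply/negP => bcO; move/pred0P: dEO => /(_ [set b; c]) /=; rewrite bcE bcO.
have acO : [set a; c] \in O = false.
  by apply/negP => acO; have := ind [set a; c]; rewrite inE acO orbT acA => /(_ isT).
have : (2 <= ([set a; b] \in O) + ([set a; c] \in O) + ([set b; c] \in O))%N.
  apply: (fa _ _ _ _ _ _ tri).
  - by move: abE; rewrite !inE => /orP [->|->]; rewrite ?orbT.
  - by rewrite !inE cards2 ac acA imset_pair -!agr // acG !orbT.
  - by rewrite !inE bcE.
by rewrite bcO acO; case: (_ \in O).
Qed.

Lemma kill_sum (x y : 'I_n) i G f : x != y -> f = [set x; y] -> (i <= m)%N -> goodJ i G ->
  f \in open_edges G -> faith (f |: G) ->
  \sum_(psi | [&& inj_ext psi, pvalid psi G & f \in kill_any G (pending (img psi E) (img psi O) G)])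
     uw i (#|O| + #|Sof psi G| - 0) (#|Sof psi G| - 0) <=
  2 ^+ #|E| * ((6 * #|V| ^ 3)%:R * (X0 * rho)).
Proof.
move=> xy fE im gJ fO fa; apply: sum_by_S => [|S SE]; first by apply: mulr_ge0 => //; apply: mulr_ge0.
pose x' (o : bool) := if o then x else y; pose y' (o : bool) := if o then y else x.
(* The covering classes are indexed by a triple of vertices, the orientation of [f], and one of
   three types; this is the origin of the constant 6 |V|^3. *)
pose C (t : (V * V * V) * bool * option bool) : {set {ffun V -> 'I_n}} :=
  let: ((a, b, c), o, k) := t in
  match k with
  | None => [set psi | base_piece (x' o) S G psi a b && (psi b == y' o)]
  | Some true => [set psi | base_piece (x' o) S G psi a b &&
      ([forall v, psi v != y' o] && ([set psi b; y' o] \in G))]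
  | Some false => [set psi | base_piece (x' o) S G psi a b &&
      [&& psi c == y' o, b != c, a != c & [set psi b; psi c] \in G]]
  end.
apply: (@le_trans _ _ ((\sum_t #|C t|)%N%:R * uw i (#|O| + #|S| - 0) (#|S| - 0))).
  apply: ler_wpM2r; first exact: uw_ge0.
  rewrite ler_nat; apply: card_cover_le => psi; rewrite inE => /and4P [ext v kf /eqP SS].
  have [ori [a [b /= [abO ab pa H]]]] := kill_cover xy fE fO ext kf.
  have bp' : base_piece (x' ori) S G psi a b.
    by rewrite /base_piece ext v SS eqxx -SS abO ab pa eqxx.
  case: H => [pb|[nv bG]|[c [pc bc ac bcG]]].
  - by exists ((a, b, a), ori, None); rewrite /C inE bp' pb eqxx.
  - by exists ((a, b, a), ori, Some true); rewrite /C inE bp' bG andbT; apply/forallP.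
  - by exists ((a, b, c), ori, Some false); rewrite /C inE bp' pc eqxx bc ac -pc bcG.
rewrite natr_sum mulr_suml.
apply: (@le_trans _ _ (\sum_(t : (V * V * V) * bool * option bool) (X0 * rho))); last first.
  rewrite sumr_const -[leLHS]mulr_natl ler_wpM2r ?Xr0 // ler_nat.
  rewrite !card_prod card_bool card_option card_bool !expnS expn0; apply: eq_leq; lia.
apply: ler_sum => -[[[[a b] c] o] [[]|]] _; rewrite /C.
- exact: type1_bound.
- apply: type2_bound => // aA cA bcE; apply/setP => psi; rewrite !inE.
  apply/negP => /andP [/base_pieceP [[e1 e2 e3] [ab nab pa]] /and4P [/eqP pc bc ac bcG]].
  apply: (faith_triangle SE fa e1 ab bcE nab bc ac aA cA).
  by rewrite pa pc !inE fE /x' /y'; case: (o); rewrite ?eqxx // finset.setUC eqxx.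
- by apply: type0_bound => //; left.
Qed.

Lemma select_sum (x y : 'I_n) i G f : x != y -> f = [set x; y] -> (i <= m)%N -> goodJ i G ->
  \sum_(psi | [&& inj_ext psi, pvalid psi G & f \in img psi E :\: G])
     uw i (#|O| + #|Sof psi G| - 1) (#|Sof psi G| - 1) <=
  2 ^+ #|E| * ((2 * #|V| ^ 2)%:R * (X0 * rho)).
Proof.
move=> xy fE im gJ; apply: sum_by_S => [|S SE]; first by apply: mulr_ge0 => //; apply: mulr_ge0.
pose x' (o : bool) := if o then x else y; pose y' (o : bool) := if o then y else x.
pose C (t : (V * V) * bool) : {set {ffun V -> 'I_n}} :=
  let: ((a, b), o) := t in
  if [set a; b] \in S then [set psi | base_piece (x' o) S G psi a b && (psi b == y' o)] else finset.set0.
apply: (@le_trans _ _ ((\sum_t #|C t|)%N%:R * uw i (#|O| + #|S| - 1) (#|S| - 1))).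
  apply: ler_wpM2r; first exact: uw_ge0.
  rewrite ler_nat; apply: card_cover_le => psi; rewrite inE => /and4P [ext v]; rewrite (img_Sof ext G).
  move=> /imsetP [e0 e0S fe0] /eqP SS.
  have e0O : e0 \in O :|: S by rewrite inE -SS e0S orbT.
  have /eqP /cards2P [a [b [ab e0E]]] := OS_pair SE e0O.
  have base o : psi a = x' o -> base_piece (x' o) S G psi a b.
    by move=> pa; rewrite /base_piece ext v SS eqxx -e0E e0O ab pa eqxx.
  move: fe0; rewrite fE e0E imset_pair => /esym /(pair_eq xy) [[pa pb]|[pa pb]].
    by exists ((a, b), true); rewrite /C -e0E -SS e0S inE SS base // pb eqxx.
  by exists ((a, b), false); rewrite /C -e0E -SS e0S inE SS base // pb eqxx.
rewrite natr_sum mulr_suml.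
apply: (@le_trans _ _ (\sum_(t : (V * V) * bool) (X0 * rho))); last first.
  rewrite sumr_const -[leLHS]mulr_natl ler_wpM2r ?Xr0 // ler_nat.
  rewrite !card_prod card_bool !expnS expn0; apply: eq_leq; lia.
apply: ler_sum => -[[a b] o] _; rewrite /C; case: ifP => [abS|_].
  by apply: type0_bound => //; right.
by rewrite cards0 mul0r Xr0.
Qed.

Definition harmful psi G := (#|harmless (img psi E) (img psi O) G| < #|img psi E :\: G|)%N.

(** If choosing {a, c} closes {a, b} in the same copy, then {psi b, psi c} is an edge of [G]. It is
    not a pattern edge, since [F] is permissible, and does not lie inside [A], since phi is
    faithful; it is therefore an extra edge, and the factor rho is gained. *)
Lemma harmful_sum i G : (i <= m)%N -> goodJ i G -> faith G ->
  \sum_(psi | [&& inj_ext psi, pvalid psi G & harmful psi G])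
     uw i (#|O| + #|Sof psi G| - 0) (#|Sof psi G| - 0) <=
  2 ^+ #|E| * ((#|V| ^ 3)%:R * (X0 * rho)).
Proof.
move=> im gJ fa; apply: sum_by_S => [|S SE]; first by apply: mulr_ge0 => //; apply: mulr_ge0.
have w : 'I_n by case: creg => _ [[_ n0 _ _] _]; exact: (Ordinal n0).
pose C (t : V * V * V) : {set {ffun V -> 'I_n}} := let: (a, b, c) := t in
  if [&& [set a; b] \in O :|: S, [set a; c] \in S, a != b, b != c, a != c, [set b; c] \notin E & ~~ ([set b; c] \subset A)] then
  [set psi | [&& inj_ext psi, pvalid psi G, Sof psi G == S & [set psi b; psi c] \in G]] else finset.set0.
apply: (@le_trans _ _ ((\sum_t #|C t|)%N%:R * uw i (#|O| + #|S| - 0) (#|S| - 0))).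
  apply: ler_wpM2r; first exact: uw_ge0.
  rewrite ler_nat; apply: card_cover_le => psi; rewrite inE => /and4P [ext v hm /eqP SS].
  have inj := (inj_extP ext).1; have agr := (inj_extP ext).2.
  have [f fE fH] : exists2 f, f \in img psi E :\: G & f \notin harmless (img psi E) (img psi O) G.
    apply/fintype.subsetPn; apply: contraL hm => /subset_leq_card.
    by rewrite /harmful -leqNgt.
  move: fH; rewrite inE fE /= negb_forall => /existsP [r]; rewrite !negb_imply => /and3P [rP kr rf].
  have [r0 r0O rE] := mem_pending ext rP.
  move: (fE); rewrite (img_Sof ext G) => /imsetP [e0 e0S fe0].
  move: kr; rewrite /kills eq_sym (negbTE rf) /= => /existsP [g /andP [gG /triangleP [p [q [s [[pq ps qs] [rE' fE' gE]]]]]]].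
  have /eqP /cards2P [a1 [b1 [ab1 r0E]]] := OS_pair (Sof_sub psi G) r0O.
  have [a [b [ab r0E' pa pb]]] : exists a0 b0, [/\ a0 != b0, r0 = [set a0; b0], psi a0 = p & psi b0 = q].
    move: rE'; rewrite rE r0E imset_pair => /(pair_eq pq) [[pa pb]|[pa pb]].
      by exists a1, b1.
    by exists b1, a1; split=> //; rewrite 1?eq_sym // finset.setUC.
  have e0O : e0 \in O :|: Sof psi G by rewrite inE e0S orbT.
  have /eqP /cards2P [a2 [c2 [ac2 e0E]]] := OS_pair (Sof_sub psi G) e0O.
  have [c [ac e0E' pc]] : exists c, [/\ a != c, e0 = [set a; c] & psi c = s].
    move: fE'; rewrite fe0 e0E imset_pair => /(pair_eq ps) [[pa2 pc2]|[pa2 pc2]].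
      by exists c2; have <- : a2 = a by apply: inj; rewrite pa2 pa.
    exists a2; have <- : c2 = a by apply: inj; rewrite pc2 pa.
    by split; rewrite // 1?eq_sym // finset.setUC.
  have bc : b != c by apply: contraNneq qs => bc; rewrite -pb -pc bc.
  have bcG : [set psi b; psi c] \in G by rewrite pb pc -gE.
  have abO : [set a; b] \in O :|: S by rewrite -r0E' -SS.
  have acS : [set a; c] \in S by rewrite -e0E' -SS.
  have acE : [set a; c] \in E by exact: (fintype.subsetP SE).
  have tri : triangle [set a; b] [set a; c] [set b; c] by apply/triangleP; exists a, b, c.
  have noO X : [set a; c] \in E -> permissible X O -> [set a; b] \in X :|: O -> [set a; c] \in X ->
      [set b; c] \in X -> [set b; c] \notin O -> False.
    case: spair => _ _ dEO _ _ _ pX h1 h2 h3 h4.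
    have acO : [set a; c] \in O = false.
      by apply/negP => acO; move/pred0P: dEO => /(_ [set a; c]) /=; rewrite acE acO.
    have : (2 <= ([set a; b] \in O) + ([set a; c] \in O) + ([set b; c] \in O))%N.
      by apply: (pX _ _ _ h1 _ _ tri); rewrite inE ?h2 ?h3.
    rewrite acO (negbTE h4).
    by case: (_ \in O).
  have bcO : [set b; c] \notin O.
    apply/negP => bcO; case/andP: v => TO _.
    have : psi @: [set b; c] \in open_edges G by apply: (fintype.subsetP TO); rewrite (mem_img ext).
    by rewrite imset_pair => /open_edgesP [_]; rewrite bcG.
  have abX X : E \subset X -> [set a; b] \in X :|: O.
    move=> EX; move: abO; rewrite !inE => /orP [->|/(fintype.subsetP SE) /(fintype.subsetP EX) ->];
    by rewrite ?orbT.
  have bcE : [set b; c] \notin E.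
    by apply/negP => bcE; case: spair => _ _ _ perm _; apply: (noO E) => //; exact: abX.
  have bcA : ~~ ([set b; c] \subset A).
    apply/negP => bcA; apply: (noO _ acE fa) => //; first by apply: abX; exact: finset.subsetUl.
      by rewrite inE acE.
    rewrite !inE cards2 bc bcA imset_pair -!agr ?bcG ?orbT //;
      by apply: (fintype.subsetP bcA); rewrite !inE eqxx ?orbT.
  by exists (a, b, c); rewrite /C abO acS ab bc ac bcE bcA inE ext v SS eqxx bcG.
rewrite natr_sum mulr_suml.
apply: (@le_trans _ _ (\sum_(t : V * V * V) (X0 * rho))); last first.
  rewrite sumr_const -[leLHS]mulr_natl ler_wpM2r ?Xr0 // ler_nat.
  rewrite !card_prod !expnS expn0; apply: eq_leq; lia.
apply: ler_sum => -[[a b] c] _; rewrite /C; case: ifP; last by rewrite cards0 mul0r Xr0.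
move=> /and5P [abO acS ab bc /and3P [ac bcE bcA]].
apply: (@piece_bound S [set [set b; c]] finset.set0 A phi w i 0 rho G) => //.
- by rewrite cards1.
- by rewrite cards0.
- by rewrite disjoint_sym disjoints1.
- apply: rK_extra => //; rewrite addn_gt0; apply/orP; left.
  by rewrite card_gt0; apply/finset.set0Pn; exists [set b; c]; rewrite !inE eqxx.
move=> psi; rewrite inE => /and4P [e1 e2 /eqP e3 bcG]; split=> //; split.
- exact: (inj_extP e1).2.
- by move=> p; rewrite inE => /eqP ->; rewrite imset_pair.
- by move=> p; rewrite inE.
Qed.

(** A uniform jump bound cannot contain 1/(m - i), which is large near the end. The falling
    factorial contains the factor m - i; cancelling it leaves one free [kap], at most [h * bp]. *)
Lemma select_rate i p q : (i < m)%N -> q%:R <= P ->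
  q%:R / (m - i)%:R * weight m h kap tau i p q <= P * h * uw i p q.
Proof.
move=> im qP; case: creg => -[_ kbp kh _] _.
have P0 : 0 <= P by apply: le_trans qP.
have hge : 0 <= h by case: reg => -[/ltW].
case: (posnP q) => [->|q0].
  by rewrite !mul0r; apply: mulr_ge0; [exact: mulr_ge0 | exact: uw_ge0].
have [c0 [w1 _]] := weight_split reg tau0 p q im.
set c := (Aw h i ^+ p * tau * kap ^+ q * ((m - i.+1) ^_ q.-1)%:R) in c0 w1.
rewrite w1; have -> : (if q is 0 then 1 else (m - i)%:R) = (m - i)%:R :> R by rewrite -(prednK q0).
have M0 : (m - i)%:R != 0 :> R by rewrite pnatr_eq0 -lt0n subn_gt0.
have -> : q%:R / (m - i)%:R * (c * (m - i)%:R) = q%:R * c by field.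
rewrite -mulrA; apply: ler_pM => //.
rewrite /c /uw -(prednK q0) [q.-1.+1.-1]/= 2!exprS.
have -> : Aw h i ^+ p * tau * (kap * kap ^+ q.-1) * ((m - i.+1) ^_ q.-1)%:R =
   Aw h i ^+ p * tau * (kap * (kap ^+ q.-1 * ((m - i.+1) ^_ q.-1)%:R)).
  by rewrite -!mulrA.
rewrite [leRHS]mulrCA; apply: ler_wpM2l; first by apply: mulr_ge0 => //; rewrite exprn_ge0 ?Aw_ge0.
rewrite [leRHS]mulrA; apply: ler_pM => //; first by apply: mulr_ge0; rewrite ?exprn_ge0.
apply: (@le_trans _ _ ((kap * m%:R) ^+ q.-1)); last by rewrite lerXn2r ?nnegrE ?mulr_ge0.
rewrite exprMn ler_wpM2l ?exprn_ge0 // -natrX ler_nat.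
apply: (@leq_trans ((m - i.+1) ^ q.-1)); last by case: q.-1 => // k; rewrite leq_exp2r // leq_subr.
elim: q.-1 => [|k IH]; first by rewrite ffactn0.
by rewrite ffactnSr expnSr leq_mul // leq_subr.
Qed.

Lemma weight_next i p q : (i < m)%N -> p%:R <= P -> weight m h kap tau i.+1 p q <= 2 * uw i p q.
Proof.
move=> im pP; apply: le_trans (weight_le_uw _ _ _) _.
have [_ a2 _ _] := expR_alpha reg (ltnW im) pP.
have [[_ _ /andP [_ eta1] _] _] := reg.
rewrite /uw AwS exprMn term_shuffle6; apply: ler_pM => //.
- exact: uw_ge0.
- by apply: le_trans a2 _; rewrite -[2]/(1 + 1) lerD2l quarter_le1.
Qed.

(** Three contributions: the smooth change of all weights, the copies closed by the new edge, and
    the copies for which it is a missing edge. *)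
Definition Jb : R := Wb * (h * (2 * (P * (8 * tm h m + 4)) + P)) +
  2 ^+ #|E| * ((6 * #|V| ^ 3)%:R * (X0 * rho)) + 2 * (2 ^+ #|E| * ((2 * #|V| ^ 2)%:R * (X0 * rho))).

Lemma Phis_diff0 psi i G f : f \in open_edges G -> ~~ pvalid psi G ->
  Phis psi i.+1 (f |: G) - Phis psi i G = 0.
Proof.
by move=> fO nv; rewrite /Phis; have [-> ->] := Phi_invalid m h kap tau i.+1 fO nv; rewrite subrr.
Qed.

Lemma Wp_jump i G f (w : 'I_n) : (i < m)%N -> goodJ i G -> f \in open_edges G -> faith (f |: G) ->
  `|Wp i.+1 (f |: G) - Wp i G| <= Jb.
Proof.
move=> im gJ fO fa; have im' := ltnW im.
have [f2 _ _] := open_edgesP _ _ fO; have /eqP /cards2P [x [y [xy fE]]] := f2.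
have hge : 0 <= h by case: reg => -[/ltW].
rewrite /Wp -sumrB; apply: le_trans (ler_norm_sum _ _ _) _.
rewrite (bigID (fun psi => pvalid psi G)) /= [X in _ + X]big1 ?addr0; last first.
  by move=> psi /andP [_ nv]; rewrite Phis_diff0 ?normr0.
pose H := h * (2 * (P * (8 * tm h m + 4)) + P).
pose kl psi := f \in kill_any G (pending (img psi E) (img psi O) G).
pose sl psi := f \in img psi E :\: G.
apply: (@le_trans _ _ (\sum_(psi | inj_ext psi && pvalid psi G)
  (H * uw i (#|O| + #|Sof psi G| - 0) (#|Sof psi G| - 0) +
   (kl psi)%:R * uw i (#|O| + #|Sof psi G| - 0) (#|Sof psi G| - 0) +
   (sl psi)%:R * (2 * uw i (#|O| + #|Sof psi G| - 1) (#|Sof psi G| - 1))))).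
  apply: ler_sum => psi /andP [ext v]; rewrite !subn0 !subn1.
  have pE : (#|O| + #|Sof psi G|)%N = (#|img psi O| + #|img psi E :\: G|)%N.
    by rewrite (card_img ext) (card_Sof ext G).
  have qE : #|Sof psi G| = #|img psi E :\: G| by rewrite (card_Sof ext G).
  have pP : (#|O| + #|Sof psi G|)%:R <= P.
    by rewrite pE; exact: (pend_size (sizeP_img ext)).
  have qP : #|Sof psi G|%:R <= P by apply: le_trans pP; rewrite ler_nat leq_addl.
  have pP' : (#|O| + #|Sof psi G|).-1%:R <= P by apply: le_trans pP; rewrite ler_nat leq_pred.
  apply: le_trans (Phi_jump reg (disj_img ext) tau0 i fO v pE qE) _.
  apply: lerD; first apply: lerD.
  - apply: le_trans (weight_diff reg tau0 _ im pP) _; rewrite /H.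
    have wu := weight_le_uw i (#|O| + #|Sof psi G|) #|Sof psi G|.
    apply: le_trans (lerD (ler_wpM2l _ wu) (select_rate _ im qP)) _.
      rewrite !mulr_ge0 ?addr_ge0 ?mulr_ge0 ?(tm_ge0 reg) //; apply: le_trans pP; exact: ler0n.
    by rewrite le_eqVlt; apply/orP; left; apply/eqP; ring.
  - by apply: ler_wpM2l => //; exact: weight_le_uw.
  - by apply: ler_wpM2l => //; exact: weight_next.
rewrite 2!big_split /= /Jb; apply: lerD; first apply: lerD.
- rewrite -mulr_sumr mulrC; apply: ler_wpM2r.
    rewrite /H mulr_ge0 ?addr_ge0 ?mulr_ge0 ?addr_ge0 ?mulr_ge0 ?(tm_ge0 reg) //;
    by case: reg => -[_ _ _ [P1 _]] _; apply: le_trans P1.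
  apply: le_trans (valid_sum_le w im' gJ).
  by rewrite le_eqVlt; apply/orP; left; apply/eqP; apply: eq_bigl => psi; rewrite andbT.
- apply: le_trans (kill_sum xy fE im' gJ fO fa); rewrite le_eqVlt; apply/orP; left; apply/eqP.
  rewrite [RHS](eq_bigl (fun psi => (inj_ext psi && pvalid psi G) && kl psi)) => [|psi]; last by rewrite andbA.
  by rewrite [RHS]big_mkcondr; apply: eq_bigr => psi _; case: (kl psi); rewrite ?mul1r ?mul0r.
- rewrite (eq_bigr (fun psi => 2 * ((sl psi)%:R * uw i (#|O| + #|Sof psi G| - 1) (#|Sof psi G| - 1)))); last first.
    by move=> psi _; rewrite mulrCA.
  rewrite -mulr_sumr ler_wpM2l //.
  apply: le_trans (select_sum xy fE im' gJ); rewrite le_eqVlt; apply/orP; left; apply/eqP.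
  rewrite [RHS](eq_bigl (fun psi => (inj_ext psi && pvalid psi G) && sl psi)) => [|psi]; last by rewrite andbA.
  by rewrite [RHS]big_mkcondr; apply: eq_bigr => psi _; case: (sl psi); rewrite ?mul1r ?mul0r.
Qed.

Lemma Estep_Wp i G : Estep G (Wp i) = \sum_(psi | inj_ext psi) Estep G (Phis psi i).
Proof. by rewrite /Estep exchange_big /=; apply: eq_bigr => G' _; rewrite mulr_sumr. Qed.

Definition delt i : R := 3 * eta * P * (h + (m - i)%:R^-1).

Lemma Wp_up i G : (i < m)%N -> goodK h kap eta z i G -> Estep G (Wp i.+1) <= expR (delt i) * Wp i G.
Proof.
move=> im gK; rewrite Estep_Wp mulr_sumr; apply: ler_sum => psi ext.
have := Phi_step_ub reg (disj_img ext) tau0 (sizeP_img ext) im gK; exact.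
Qed.

Definition harm_rate i : R := 2 * #|E|%:R / (m - i)%:R * (2 ^+ #|E| * ((#|V| ^ 3)%:R * (X0 * rho))).

Lemma Wp_down i G : (i < m)%N -> goodK h kap eta z i G -> goodJ i G -> faith G ->
  (1 - delt i) * Wp i G - harm_rate i <= Estep G (Wp i.+1).
Proof.
move=> im gK gJ fa; rewrite Estep_Wp lerBlDr mulr_sumr.
pose hf psi := harmful psi G.
have M0 : 0 <= (m - i)%:R^-1 :> R by rewrite invr_ge0.
apply: (@le_trans _ _ (\sum_(psi | inj_ext psi) (Estep G (Phis psi i.+1) +
   (pvalid psi G && hf psi)%:R * (2 * #|E|%:R / (m - i)%:R * uw i (#|O| + #|Sof psi G| - 0) (#|Sof psi G| - 0))))).
  apply: ler_sum => psi ext; case: (boolP (pvalid psi G)) => [v|nv] /=; last first.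
    have -> : Phis psi i G = 0 by rewrite /Phis /Phi -/(pvalid psi G) (negbTE nv).
    rewrite mulr0 mul0r addr0; apply: sumr_ge0 => G' _.
    by apply: mulr_ge0; [exact: tfp_step_ge0 | exact: (Phi_ge0 reg)].
  have lb := Phi_step_lb reg (disj_img ext) tau0 (sizeP_img ext) im gK v.
  rewrite -/(Phis psi i) -/(Phis psi i.+1) -/(delt i) mulrBl lerBlDr in lb.
  apply: le_trans lb _; rewrite lerD2l.
  have Ph0 : 0 <= Phis psi i G by exact: (Phi_ge0 reg).
  have PhU : Phis psi i G <= uw i (#|O| + #|Sof psi G| - 0) (#|Sof psi G| - 0).
    by rewrite (Phis_valid ext i v) !subn0; exact: weight_le_uw.
  rewrite /hf /harmful; case: ltnP => hc; last first.
    by rewrite mul0r (eqP (_ : (_ - _ == 0)%N)) ?subn_eq0 // mulr0 !mul0r.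
  rewrite -[true%:R]/(1 : R) mul1r; apply: ler_pM; rewrite ?mulr_ge0 //.
  rewrite ler_wpM2r // ler_wpM2l // ler_nat (leq_trans (leq_subr _ _)) //.
  by rewrite -(card_img ext E) subset_leq_card // finset.subsetDl.
rewrite big_split /= lerD2l.
apply: (@le_trans _ _ (2 * #|E|%:R / (m - i)%:R * (\sum_(psi | [&& inj_ext psi, pvalid psi G & hf psi])
     uw i (#|O| + #|Sof psi G| - 0) (#|Sof psi G| - 0)))).
  rewrite mulr_sumr le_eqVlt; apply/orP; left; apply/eqP; rewrite [RHS]big_mkcondr.
  by apply: eq_bigr => psi _; case: (_ && _); rewrite ?mul1r ?mul0r.
by apply: ler_wpM2l; [rewrite !mulr_ge0 | exact: harmful_sum (ltnW im) gJ fa].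
Qed.

Definition nuv i : R := P * (h * (24 * tm h m + 10) + 3 / (m - i)%:R).

Lemma Wp_abs i G : (i < m)%N -> goodK h kap eta z i G ->
  (\sum_(f in open_edges G) `|Wp i.+1 (f |: G) - Wp i G|) / (Q_ G)%:R <= nuv i * Wp i G.
Proof.
move=> im gK.
apply: (@le_trans _ _ (\sum_(psi | inj_ext psi)
  ((\sum_(f in open_edges G) `|Phis psi i.+1 (f |: G) - Phis psi i G|) / (Q_ G)%:R))).
  rewrite -mulr_suml ler_wpM2r ?invr_ge0 // exchange_big /=; apply: ler_sum => f fO.
  by rewrite /Wp -sumrB; exact: ler_norm_sum.
rewrite mulr_sumr; apply: ler_sum => psi ext; case: (boolP (pvalid psi G)) => [v|nv].
  exact: (Phi_absstep reg (disj_img ext) tau0 (sizeP_img ext) im gK v).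
have -> : Phis psi i G = 0 by rewrite /Phis /Phi -/(pvalid psi G) (negbTE nv).
rewrite mulr0 big1 ?mul0r // => f fO.
by rewrite /Phis; have [-> _] := Phi_invalid m h kap tau i.+1 fO nv; rewrite subrr normr0.
Qed.

Lemma unfaithful_pair G f : faith G -> ~ faith (f |: G) ->
  exists e : {set V}, [/\ #|e| = 2%N, e \subset A & f = phi @: e].
Proof.
move=> fG nf; apply: contrapT => ne; apply: nf; rewrite /faith.
rewrite (_ : [set e | _] = [set e : {set V} | [&& #|e| == 2%N, e \subset A & phi @: e \in G]]) //.
apply/setP => e; rewrite !inE; case: eqP => //= e2; case: (boolP (e \subset A)) => //= eA.
by case: eqP => //= ef; case: ne; exists e.
Qed.

Definition unf G := [set f in open_edges G | ~~ `[< faith (f |: G) >]].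

Lemma card_unf G : faith G -> (#|unf G| <= #|V| ^ 2)%N.
Proof.
move=> fG; apply: (@leq_trans #|[set phi @: [set p.1; p.2] | p in {: V * V}]|); last first.
  by rewrite (leq_trans (leq_imset_card _ _)) // card_prod expnS expn1.
apply: subset_leq_card; apply/fintype.subsetP => f; rewrite inE => /andP [_ /asboolPn nf].
have [e [e2 _ ->]] := unfaithful_pair fG nf.
have /eqP /cards2P [a [b [_ ->]]] := e2.
by apply/imsetP; exists (a, b).
Qed.

(** An edge that makes phi unfaithful is the image of a pair inside [A], hence never a missing edge
    of a copy. *)
Lemma Wp_unf i G f : (i < m)%N -> faith G -> f \in unf G -> Wp i.+1 (f |: G) <= 2 * Wp i G.
Proof.
move=> im fG; rewrite inE => /andP [fO /asboolPn nf].
have [e [e2 eA fE]] := unfaithful_pair fG nf.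
rewrite /Wp mulr_sumr; apply: ler_sum => psi ext.
apply: (Phi_unselected reg (disj_img ext) tau0 (sizeP_img ext) im fO).
rewrite inE negb_and; apply/orP; right; apply/negP => /imsetP [e' e'E fe'].
have [inj agr] := inj_extP ext.
have ee' : e = e'.
  apply: (imset_inj inj); rewrite -fe' fE; apply: eq_in_imset => v ve.
  by rewrite agr // (fintype.subsetP eA).
by case: spair => _ _ _ _ /(_ e'); rewrite inE e'E -ee' eA => /(_ isT).
Qed.

Definition drift i : R := 2 * delt i * Wb + (#|V| ^ 2)%:R * (eta * h) * Wb + harm_rate i.

Lemma delt_le i : (i < m)%N -> 0 <= delt i <= 1 / 2.
Proof.
move=> im; case: reg => -[h0 _ /andP [eta0 eta1] [P1 _]] [_ h4 _].
have P0 : 0 <= P by apply: le_trans P1.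
have M0 : 0 < (m - i)%:R :> R by rewrite ltr0n subn_gt0.
have Mi : (m - i)%:R^-1 <= 1 :> R by rewrite invf_le1 // ler1n subn_gt0.
have Mi0 : 0 <= (m - i)%:R^-1 :> R by rewrite invr_ge0 ltW.
have h1 : h <= 1.
  apply: (@le_trans _ _ (4 * h)); last exact: le_trans h4 (quarter_le1 eta1).
  by rewrite -[leLHS]mul1r ler_pM2r // ler1n.
have eP : 12 * eta * P <= 1 by case: creg => _ [_ []].
rewrite /delt; apply/andP; split; first by rewrite !mulr_ge0 ?addr_ge0 // ltW.
apply: (@le_trans _ _ (3 * eta * P * 2)).
  by rewrite ler_wpM2l ?mulr_ge0 // -[2]/(1 + 1) lerD.
have -> : 3 * eta * P * 2 = (12 * eta * P) / 2 by field.
by rewrite ler_pM2r // invr_gt0.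
Qed.

(** The drift over faithful steps is the full drift minus that of the unfaithful steps. There are at
    most |V|^2 of the latter, each of chance 1/Q and changing the sum by at most [Wb], so no jump
    bound is needed for them. *)
Lemma Wp_drift i G (w : 'I_n) (sg : R) : (i < m)%N -> goodK h kap eta z i G -> goodJ i G -> faith G ->
  sg = 1 \/ sg = -1 ->
  sg * (\sum_(f in open_edges G | `[< faith (f |: G) >]) (Wp i.+1 (f |: G) - Wp i G)) / (Q_ G)%:R
   <= drift i.
Proof.
move=> im gK gJ fG sgE; have [Q0 _ _ _] := gK.
have Q0' : 0 < (Q_ G)%:R :> R by rewrite ltr0n.
have iQ : (Q_ G)%:R^-1 <= eta * h.
  apply: le_trans (goodK_invQ reg (ltnW im) gK); rewrite ler_peMr ?invr_ge0 // lerDr.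
  by case: reg => -[_ _ _ [P1 z0]] _; rewrite mulr_ge0 ?addr_ge0 //; exact: le_trans P1.
have W0 := Wp_ge0 i G; have WW := Wp_le w (ltnW im) gJ.
have tot : (\sum_(f in open_edges G) (Wp i.+1 (f |: G) - Wp i G)) / (Q_ G)%:R = Estep G (Wp i.+1) - Wp i G.
  rewrite EstepE -?card_gt0 // sumrB mulrBl sumr_const; congr (_ - _).
  by rewrite -[Wp i G *+ _]mulr_natl mulrAC divff ?mul1r // gt_eqF.
have split_f : \sum_(f in open_edges G | `[< faith (f |: G) >]) (Wp i.+1 (f |: G) - Wp i G) =
   \sum_(f in open_edges G) (Wp i.+1 (f |: G) - Wp i G) - \sum_(f in unf G) (Wp i.+1 (f |: G) - Wp i G).
  rewrite [X in _ = X - _](bigID (fun f => `[< faith (f |: G) >])) /= -addrA (_ : _ - _ = 0) ?addr0 //.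
  by apply/eqP; rewrite subr_eq0; apply/eqP; apply: eq_bigl => f; rewrite [RHS]inE.
have unf_le : `|\sum_(f in unf G) (Wp i.+1 (f |: G) - Wp i G)| / (Q_ G)%:R <= (#|V| ^ 2)%:R * (eta * h) * Wb.
  apply: (@le_trans _ _ ((#|V| ^ 2)%:R * Wb / (Q_ G)%:R)); last first.
    by rewrite mulrAC ler_wpM2r // ler_wpM2l.
  rewrite ler_wpM2r ?invr_ge0 //; apply: le_trans (ler_norm_sum _ _ _) _.
  apply: (@le_trans _ _ (\sum_(f in unf G) Wb)); last first.
    by rewrite sumr_const -[leLHS]mulr_natl ler_wpM2r // ler_nat card_unf.
  apply: ler_sum => f fu; apply: le_trans WW; rewrite ler_norml.
  have := Wp_unf im fG fu; have := Wp_ge0 i.+1 (f |: G) => ? ?.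
  by apply/andP; split; [rewrite lerBrDr addNr | rewrite lerBlDr -mulr2n -mulr_natl].
have /andP [d0 d2] := delt_le im.
have hr0 : 0 <= harm_rate i.
  apply: mulr_ge0; first by rewrite !mulr_ge0 ?invr_ge0.
  by apply: mulr_ge0; [exact: exprn_ge0 | apply: mulr_ge0 => //; exact: Xr0].
have dW : delt i * Wp i G <= delt i * Wb by apply: ler_wpM2l.
have unf1 := le_trans (ler_wpM2r (ltW (eq_ind_r (fun x => 0 < x) Q0' (erefl _))) (ler_norm _)) (lexx _).
rewrite split_f; set S1 := \sum_(f in open_edges G) _ in tot *; set S2 := \sum_(f in unf G) _ in unf_le *.
have nS2 : - (`|S2| / (Q_ G)%:R) <= S2 / (Q_ G)%:R <= `|S2| / (Q_ G)%:R.
  by rewrite -mulNr !ler_pM2r ?invr_gt0 // -ler_norml.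
have up := Wp_up im gK; have dn := Wp_down im gK gJ fG.
have eup : expR (delt i) * Wp i G <= (1 + 2 * delt i) * Wp i G.
  by apply: ler_wpM2r => //; apply: expR_le1D2x; rewrite d0 d2.
have -> : sg * (S1 - S2) / (Q_ G)%:R = sg * (S1 / (Q_ G)%:R - S2 / (Q_ G)%:R) by rewrite -mulrBl mulrA.
rewrite tot /drift; case/andP: nS2 => n1 n2.
exact: (drift_arith sgE up dn eup dW hr0 d0 WW W0 unf_le n1 n2).
Qed.

Definition cstep (theta : R) i : R := theta * drift i + 2 * theta ^+ 2 * Jb * nuv i * Wb.

(** The indicator of faithfulness removes exactly the steps for which no jump bound is available.
    Faithfulness, once lost, is never regained, so the indicator does not spoil the
    supermartingale. *)
Lemma Wp_exp_step i G (w : 'I_n) (sg theta c0 : R) : (i < m)%N -> goodK h kap eta z i G -> goodJ i G ->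
  sg = 1 \/ sg = -1 -> 0 <= theta -> theta * Jb <= 1 / 2 ->
  Estep G (fun G' => `[< faith G' >]%:R * expR (theta * sg * (Wp i.+1 G' - c0))) <=
  expR (cstep theta i) * (`[< faith G >]%:R * expR (theta * sg * (Wp i G - c0))).
Proof.
move=> im gK gJ sgE th0 thJ; have [Q0 _ _ _] := gK.
have Q0' : 0 < (Q_ G)%:R :> R by rewrite ltr0n.
rewrite EstepE -?card_gt0 //; case: (asboolP (faith G)) => [fG|nfG]; last first.
  rewrite mul0r mulr0 big1 ?mul0r // => f _.
  by rewrite asboolF ?mul0r // => /faith_sub.
rewrite mul1r; set K := expR (theta * sg * (Wp i G - c0)).
pose D f := Wp i.+1 (f |: G) - Wp i G.
have Jb0 : 0 <= Jb by rewrite !addr_ge0 //; [apply: mulr_ge0 => //; case: reg => -[h0 _ _ [P1 _]] _;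
    have P0 := le_trans ler01 P1; rewrite mulr_ge0 ?(ltW h0) // addr_ge0 // !mulr_ge0 // addr_ge0 // mulr_ge0 // (tm_ge0 reg) |
    apply: mulr_ge0; [exact: exprn_ge0 | apply: mulr_ge0 => //; exact: Xr0] |
    apply: mulr_ge0 => //; apply: mulr_ge0; [exact: exprn_ge0 | apply: mulr_ge0 => //; exact: Xr0]].
apply: (@le_trans _ _ ((\sum_(f in open_edges G) (K * (1 + 2 * theta ^+ 2 * Jb * `|D f| +
     theta * (sg * (`[< faith (f |: G) >]%:R * D f))))) / (Q_ G)%:R)).
  rewrite ler_wpM2r ?invr_ge0 //; apply: ler_sum => f fO.
  have -> : theta * sg * (Wp i.+1 (f |: G) - c0) = theta * sg * (Wp i G - c0) + theta * (sg * D f).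
    by rewrite /D; ring.
  rewrite expRD mulrCA; apply: ler_wpM2l; first exact: expR_ge0.
  have q0 : 0 <= 2 * theta ^+ 2 * Jb * `|D f| by rewrite !mulr_ge0 ?sqr_ge0.
  case: (asboolP (faith (f |: G))) => [ff|_]; last by rewrite !(mul0r, mulr0) addr0 addr_ge0.
  rewrite !mul1r; have DJ := Wp_jump w im gJ fO ff.
  exact: exp_arith sgE th0 thJ DJ.
rewrite -mulr_sumr !big_split /= sumr_const -!mulr_sumr.
rewrite (_ : \sum_(f in open_edges G) `[< faith (f |: G) >]%:R * D f =
   \sum_(f in open_edges G | `[< faith (f |: G) >]) D f); last first.
  by rewrite [RHS]big_mkcondr; apply: eq_bigr => f _; case: ifP; rewrite ?mul1r ?mul0r.
rewrite -[leLHS]mulrA mulrC; apply: ler_wpM2r; first exact: expR_ge0.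
apply: (@le_trans _ _ (1 + cstep theta i)); last exact: expR_ge1Dx.
have ab := Wp_abs im gK; have dr := Wp_drift w im gK gJ fG sgE.
have WW := Wp_le w (ltnW im) gJ.
have nu0 : 0 <= nuv i.
  case: reg => -[h0 _ _ [P1 _]] _; have P0 := le_trans ler01 P1.
  by rewrite mulr_ge0 // addr_ge0 ?mulr_ge0 ?invr_ge0 ?addr_ge0 ?mulr_ge0 ?(tm_ge0 reg) // ltW.
rewrite mulrDl mulrDl divff ?gt_eqF // /cstep -addrA lerD2l addrC.
apply: lerD; first by rewrite -mulrA -mulrA; apply: ler_wpM2l => //; rewrite mulrA.
rewrite -[leLHS]mulrA -[leRHS]mulrA; apply: ler_wpM2l; first by rewrite !mulr_ge0 ?sqr_ge0.
by apply: le_trans ab _; apply: ler_wpM2l.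
Qed.

Lemma Wp_tail (w : 'I_n) (sg theta lam : R) : sg = 1 \/ sg = -1 -> 0 <= theta -> theta * Jb <= 1 / 2 ->
  tfp_prob R m (fun g => (forall i, (i < m)%N -> goodK h kap eta z i (g i) /\ goodJ i (g i)) /\
     (faith (g m) /\ lam <= sg * (Wp m (g m) - Wp 0 finset.set0))) <=
  expR (\sum_(i < m) cstep theta i - theta * lam).
Proof.
move=> sgE th0 thJ.
have := @tfp_prob_markov R n m m (fun i G => goodK h kap eta z i G /\ goodJ i G)
  (fun G => faith G /\ lam <= sg * (Wp m G - Wp 0 finset.set0))
  (fun i G => `[< faith G >]%:R * expR (theta * sg * (Wp i G - Wp 0 finset.set0)))
  (cstep theta) (expR (theta * lam)) (leqnn m).
rewrite subrr mulr0 expR0 mulr1 => H.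
rewrite expRD expRN ler_pdivlMr ?expR_gt0 // mulrC.
apply: le_trans (H _ _ _) _.
- by move=> i G; rewrite mulr_ge0 ?expR_ge0.
- by move=> i G im [gK gJ]; exact: Wp_exp_step.
- move=> G [fG le]; rewrite (asboolT fG) mul1r ler_expR -mulrA ler_wpM2l //.
- by rewrite ler_piMr ?expR_ge0 //; case: `[< _ >].
Qed.
End CopyProcess.

(** * Parameters as powers of n and log n; the event K in these terms *)

Section RegimeArithmetic.
Variable R : realType.
Implicit Types (L ze nu t A x : R).

Lemma pow_absorb L ze k : 100 <= L -> 0 <= ze -> L ^+ 40 * ze <= 1 -> (k <= 39)%N ->
  100 * L ^+ k * ze <= 1.
Proof.
move=> L1 z0 Lz k39; apply: le_trans Lz; apply: ler_wpM2r => //.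
apply: (@le_trans _ _ (L ^+ k.+1)).
  by rewrite exprS; apply: ler_wpM2r => //; rewrite exprn_ge0 //; lra.
by rewrite ler_weXn2l //; lra.
Qed.

Lemma regime1 L ze nu A : 100 <= L -> 0 < nu -> nu <= ze -> 100 * L ^+ 1 * ze <= 1 ->
  0 <= A -> A * nu ^+ 2 <= ze ^+ 2 ->
  (L ^+ 5 * (16 + L ^+ 2) + 1) * (2 * A * (2 * nu ^+ 8)) <= L ^+ 7 * ze * nu ^+ 6.
Proof.
move=> L1 nu0 nz Lz A0 AE; rewrite expr1 in Lz.
have -> : (L ^+ 5 * (16 + L ^+ 2) + 1) * (2 * A * (2 * nu ^+ 8)) =
   4 * (L ^+ 5 * (16 + L ^+ 2) + 1) * (A * nu ^+ 2) * nu ^+ 6 by ring.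
apply: ler_wpM2r; first by rewrite exprn_ge0 // ltW.
have z0 : 0 < ze by lra.
have L7 : L ^+ 5 * (16 + L ^+ 2) + 1 <= 2 * L ^+ 7.
  have L5 : 1 <= L ^+ 5 by rewrite exprn_ege1 //; lra.
  have L2 : 17 <= L ^+ 2 by nra.
  have -> : 2 * L ^+ 7 = L ^+ 5 * (L ^+ 2 + L ^+ 2) by ring.
  nra.
have L70 : 0 <= L ^+ 7 by rewrite exprn_ge0 //; lra.
apply: (@le_trans _ _ (4 * (2 * L ^+ 7) * ze ^+ 2)).
  apply: ler_pM => //; first by rewrite mulr_ge0 // addr_ge0 // mulr_ge0 ?addr_ge0 ?exprn_ge0 //; lra.
    by rewrite mulr_ge0 // exprn_ge0 // ltW.
  by rewrite ler_wpM2l.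
have -> : 4 * (2 * L ^+ 7) * ze ^+ 2 = L ^+ 7 * ze * (8 * ze) by ring.
rewrite -[leRHS]mulr1; apply: ler_wpM2l; first by rewrite mulr_ge0 // ltW.
nra.
Qed.

Lemma regime2 L ze nu t : 100 <= L -> 0 < nu -> nu <= ze -> 100 * L ^+ 1 * ze <= 1 ->
  0 <= t -> 16 * t <= L ->
  4 * nu ^+ 6 <= L ^+ 7 * ze /\
  L ^+ 5 * nu ^+ 6 * (8 * t + 2) * (8 * t + 1) <= L ^+ 7 * ze / 2.
Proof.
move=> L1 nu0 nz Lz t0 tL; rewrite expr1 in Lz.
have z0 : 0 < ze by lra.
have nu1 : nu <= 1 / 100 by nra.
have n6 : nu ^+ 6 <= nu / 4.
  have n1 : nu ^+ 5 <= nu ^+ 1 by rewrite ler_wiXn2l ?(ltW nu0) //; lra.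
  rewrite expr1 in n1; rewrite exprS; nra.
have L70 : 1 <= L ^+ 7 by rewrite exprn_ege1 //; lra.
split; first by nra.
have L50 : 0 <= L ^+ 5 by rewrite exprn_ge0 //; lra.
have T : (8 * t + 2) * (8 * t + 1) <= L ^+ 2.
  have a1 : 8 * t + 2 <= L by lra. have a2 : 8 * t + 1 <= L by lra. nra.
have T0 : 0 <= (8 * t + 2) * (8 * t + 1) by nra.
have -> : L ^+ 5 * nu ^+ 6 * (8 * t + 2) * (8 * t + 1) = L ^+ 5 * (nu ^+ 6 * ((8 * t + 2) * (8 * t + 1))) by ring.
have -> : L ^+ 7 * ze / 2 = L ^+ 5 * (ze / 2 * L ^+ 2) by field.
apply: ler_wpM2l => //; apply: ler_pM => //; first by rewrite exprn_ge0 // ltW.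
by lra.
Qed.

Lemma goodK_ratio q qt x s : 0 < qt -> `|q / qt - 1| <= x -> x <= 1 / 4 -> 0 <= s <= 1 / 4 ->
  0 < q /\ `|(q / (qt * (1 + s)))^-1 - 1| <= 2 * x + 2 * s.
Proof.
move=> qt0 qx x4 /andP [s0 s4].
have [lo hi] := near1 qx.
have y0 : 0 < q / qt by lra.
have q0 : 0 < q by rewrite -(@pmulr_lgt0 _ qt^-1) // invr_gt0.
split=> //; set y := q / qt in lo hi y0.
have -> : (q / (qt * (1 + s)))^-1 = (1 + s) / y.
  by rewrite /y; field; rewrite !gt_eqF //; lra.
rewrite ler_norml; apply/andP; split.
  rewrite lerBrDr ler_pdivlMr //; nra.
rewrite lerBlDr ler_pdivrMr //; nra.
Qed.
End RegimeArithmetic.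

Section Scale.
Variables (R : realType) (n m : nat).
Let L : R := ln n%:R.
Let h : R := n%:R `^ (- (3 / 2)).
Let t : R := tm h m.

(** Every power of n that occurs is a power of this quantity: [h] is its 6th power, 1/sqrt n its
    square, 1/n its 4th power. [zet] is the common size e^(2t^2) n^(-1/4) of the relative errors, so
    that [zet ^+ 2] is [Aw h m * nuq ^+ 2]. *)
Definition nuq : R := n%:R `^ (- (1 / 4)).
Definition zet : R := expR (2 * tm (n%:R `^ (- (3 / 2))) m ^+ 2) * nuq.

(** The exponent 40 is generous: it leaves [100 * L ^+ k * zet <= 1] for every k up to 39, more than
    any estimate below uses. *)
Definition scale_regime : Prop :=
  [/\ (1 < n)%N, 100 <= L, L ^+ 40 * zet <= 1 & 16 * t <= L].

Hypothesis sreg : scale_regime.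
Let n1 : (1 < n)%N. Proof. by case: sreg. Qed.
Let n0 : 0 < n%:R :> R. Proof. by rewrite ltr0n ltnW. Qed.
Let nne : n%:R != 0 :> R. Proof. by rewrite gt_eqF. Qed.

Lemma nuq_gt0 : 0 < nuq. Proof. exact: powR_gt0. Qed.
Let nu0 := nuq_gt0.

Lemma nuq_pow k (x : R) : x = - (1 / 4) * k%:R -> n%:R `^ x = nuq ^+ k.
Proof. by move=> ->; rewrite powRrM powR_mulrn // powR_ge0. Qed.

Lemma h_nuq : h = nuq ^+ 6. Proof. by apply: nuq_pow; field. Qed.

Lemma n_nuq : n%:R * nuq ^+ 4 = 1.
Proof.
rewrite -(@nuq_pow 4 (-1)); last by field.
by rewrite powR_inv1 ?ltW // divff.
Qed.

Lemma sqrtn_nuq : Num.sqrt n%:R * nuq ^+ 2 = 1.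
Proof.
have s0 : 0 < Num.sqrt n%:R :> R by rewrite sqrtr_gt0.
apply/eqP; rewrite -(@eqrXn2 _ 2) ?mulr_ge0 ?exprn_ge0 ?sqrtr_ge0 ?(ltW nu0) //.
by rewrite exprMn sqr_sqrtr ?ltW // -exprM n_nuq expr1n.
Qed.

Lemma n32_h : n32 R n * h = 1.
Proof. by rewrite /n32 /h -powRD ?nne ?implybT // addrN powRr0. Qed.

Lemma h_gt0 : 0 < h. Proof. by rewrite h_nuq exprn_gt0. Qed.

Lemma tm0 i : 0 <= tm h i. Proof. by rewrite mulr_ge0 // ltW // h_gt0. Qed.

Lemma zet_gt0 : 0 < zet. Proof. by rewrite mulr_gt0 ?expR_gt0. Qed.

Lemma nuq_le_zet : nuq <= zet.
Proof.
rewrite /zet ler_peMl ?(ltW nu0) // (le_trans _ (expR_ge1Dx _)) // lerDl.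
by rewrite mulr_ge0 // sqr_ge0.
Qed.

Lemma Aw_zet : Aw h m * nuq ^+ 2 = zet ^+ 2.
Proof.
by rewrite /zet exprMn -expRM_natl; congr (expR _ * _); rewrite -/h /=; ring.
Qed.

Lemma Aw_mono i j : (i <= j)%N -> Aw h i <= Aw h j.
Proof.
move=> ij; rewrite ler_expR ler_wpM2l // lerXn2r ?nnegrE ?tm0 //.
by rewrite ler_wpM2r ?(ltW h_gt0) // ler_nat.
Qed.

(** This is 2/n^2, the asymptotic chance of a given pair at time 0. [etaq] is the relative error of
    order L^5 [zet] from the event K, with two powers of L for the factor t and for constants; [Pq]
    leaves room for about L^3 copies with about L pairs each. *)
Definition kapq : R := 2 * nuq ^+ 8.
Definition etaq : R := L ^+ 7 * zet.
Definition Pq : R := L ^+ 5.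

Let L100 : 100 <= L. Proof. by case: sreg. Qed.
Let L0 : 0 <= L. Proof. by apply: le_trans L100. Qed.
Let absorb k : (k <= 39)%N -> 100 * L ^+ k * zet <= 1.
Proof. by move=> k39; case: sreg => _ ? ? _; apply: pow_absorb => //; exact: ltW zet_gt0. Qed.

Lemma step_regime_scale j : (j <= m)%N -> step_regime j h kapq etaq Pq (L ^+ 2).
Proof.
move=> jm; have t16 : 16 * tm h m <= L by case: sreg.
have tj : tm h j <= tm h m by rewrite ler_wpM2r ?(ltW h_gt0) // ler_nat.
have tj16 : 16 * tm h j <= L by apply: le_trans t16; rewrite ler_wpM2l.
have e0 : 0 <= etaq by rewrite mulr_ge0 ?exprn_ge0 // ltW // zet_gt0.
have [r1 r2] := regime2 L100 nu0 nuq_le_zet (absorb (isT : (1 <= 39)%N)) (tm0 j) tj16.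
have e4 : etaq <= 1 / 4.
  by have := absorb (isT : (7 <= 39)%N); rewrite -mulrA -/etaq => ?; lra.
split; split.
- exact: h_gt0.
- by rewrite mulr_gt0 // exprn_gt0.
- by rewrite e0.
- by split; [rewrite exprn_ege1 // (le_trans _ L100) // ler1n | exact: exprn_ge0].
- rewrite /Pq /etaq /kapq [leRHS](_ : _ = L ^+ 7 * zet * nuq ^+ 6); last by rewrite h_nuq.
  apply: regime1 => //; rewrite ?nuq_le_zet ?(absorb (isT : (1 <= 39)%N)) ?Aw_ge0 //.
  by rewrite -Aw_zet ler_wpM2r ?exprn_ge0 ?(ltW nu0) // Aw_mono.
- by rewrite h_nuq.
- by have -> : Pq * h = L ^+ 5 * nuq ^+ 6 by rewrite h_nuq.
Qed.

Lemma ln_le_half_pow (x : R) : 0 < x -> ln x <= x - 1.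
Proof.
by move=> x0; have := le_ln1Dx (x := x - 1); rewrite addrCA subrr addr0; apply; rewrite ltrBrDl subrr.
Qed.

Lemma harmonic_le k : (0 < k)%N -> \sum_(i < k) (k - i)%:R^-1 <= 1 + ln k%:R :> R.
Proof.
have -> : \sum_(i < k) (k - i)%:R^-1 = \sum_(i < k) i.+1%:R^-1 :> R.
  rewrite (reindex_inj rev_ord_inj) /=; apply: eq_bigr => i _; congr (_%:R^-1).
  by rewrite subKn.
case: k => // k _; elim: k => [|k IH]; first by rewrite big_ord_recl big_ord0 addr0 invr1 ln1 addr0.
rewrite big_ord_recr /=; apply: (@le_trans _ _ (1 + ln k.+1%:R + k.+2%:R^-1)); first by rewrite lerD2r.
rewrite -addrA lerD2l -lerBrDl.
have k1 : 0 < k.+1%:R :> R by rewrite ltr0n.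
have k2 : 0 < k.+2%:R :> R by rewrite ltr0n.
have := @ln_le_half_pow (k.+1%:R / k.+2%:R) (divr_gt0 k1 k2).
rewrite ln_div ?posrE // => H.
have E : k.+1%:R / k.+2%:R - 1 = - k.+2%:R^-1 :> R.
  have kE : k.+1%:R = k.+2%:R - 1 :> R by rewrite -[k.+2%:R]natr1 addrK.
  by rewrite kE mulrBl divff ?gt_eqF // mul1r addrAC subrr add0r.
by rewrite E in H; rewrite -lerN2 opprB.
Qed.

Lemma Lnu_le1 : 100 * (L * nuq) <= 1.
Proof.
have := absorb (isT : (1 <= 39)%N); rewrite expr1 -mulrA; apply: le_trans.
by rewrite ler_wpM2l // ler_wpM2l // nuq_le_zet.
Qed.

Lemma nuq_le1 : nuq <= 1.
Proof.
have := Lnu_le1; apply: le_trans; rewrite mulrA ler_peMl ?(ltW nu0) //.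
by rewrite mulr_ege1 ?ler1n // (le_trans _ L100) // ler1n.
Qed.

Lemma ln_m_le j : (j <= m)%N -> (0 < j)%N -> ln j%:R <= 2 * L :> R.
Proof.
move=> jm j0; have -> : 2 * L = ln (n%:R ^+ 2) by rewrite lnXn // mulr_natl.
rewrite ler_ln ?posrE ?ltr0n ?exprn_gt0 //.
have t16 : 16 * tm h m <= L by case: sreg.
have tj : tm h j <= L.
  apply: (@le_trans _ _ (16 * tm h m)) => //.
  apply: (@le_trans _ _ (tm h m)); first by rewrite ler_wpM2r ?(ltW h_gt0) // ler_nat.
  by rewrite ler_peMl ?tm0 // ler1n.
have n8 : n%:R ^+ 2 * nuq ^+ 8 = 1 by rewrite -[8%N]/(4 * 2)%N exprM -exprMn n_nuq expr1n.
rewrite -(@ler_pM2r _ (nuq ^+ 8)) ?exprn_gt0 // n8.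
have -> : j%:R * nuq ^+ 8 = tm h j * nuq ^+ 2 by rewrite /tm h_nuq; ring.
apply: (@le_trans _ _ (L * nuq)); last by apply: le_trans Lnu_le1; rewrite ler_peMl ?mulr_ge0 ?(ltW nu0) // ler1n.
by apply: ler_pM; rewrite ?tm0 ?exprn_ge0 ?(ltW nu0) // expr2 ler_piMr ?(ltW nu0) // nuq_le1.
Qed.

Lemma rate_sum j : (j <= m)%N -> \sum_(i < j) (h + (j - i)%:R^-1) <= 4 * L.
Proof.
move=> jm; case: (posnP j) => [->|j0]; first by rewrite big_ord0 mulr_ge0.
rewrite big_split /= sumr_const card_ord -[h *+ j]mulr_natl -/(tm h j).
have tj : tm h j <= tm h m by rewrite ler_wpM2r ?(ltW h_gt0) // ler_nat.
have := harmonic_le j0; have := ln_m_le jm j0.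
have : 16 * tm h m <= L by case: sreg.
by move: L100 tj (tm0 j); lra.
Qed.

Lemma delta_sum j : (j <= m)%N -> \sum_(i < j) 3 * etaq * Pq * (h + (j - i)%:R^-1) <= 1.
Proof.
move=> jm; rewrite -mulr_sumr.
have e0 : 0 <= 3 * etaq * Pq.
  by apply: mulr_ge0; [apply: mulr_ge0 => //; apply: mulr_ge0; [exact: exprn_ge0 | exact: ltW zet_gt0] | exact: exprn_ge0].
apply: le_trans (ler_wpM2l e0 (rate_sum jm)) _.
apply: le_trans (absorb (isT : (13 <= 39)%N)).
have -> : 3 * etaq * Pq * (4 * L) = 12 * (L ^+ 13 * zet) by rewrite /etaq /Pq; ring.
rewrite -[leRHS]mulrA; apply: ler_wpM2r; last by rewrite ler_nat.
by apply: mulr_ge0; [exact: exprn_ge0 | exact: ltW zet_gt0].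
Qed.

Lemma kap_j j : (j <= m)%N -> kapq * j%:R = 2 * tm h j * nuq ^+ 2.
Proof. by move=> _; rewrite /kapq /tm h_nuq; ring. Qed.

Lemma kap_le1 j : (j <= m)%N -> kapq * j%:R <= 1.
Proof.
move=> jm; rewrite kap_j //.
have t16 : 16 * tm h m <= L by case: sreg.
have tj : 2 * tm h j <= L.
  apply: (@le_trans _ _ (16 * tm h m)) => //.
  apply: ler_pM; rewrite ?tm0 ?ler_nat //.
  by rewrite ler_wpM2r ?(ltW h_gt0) // ler_nat.
apply: (@le_trans _ _ (L * nuq)).
  apply: ler_pM; [by rewrite mulr_ge0 // tm0 | by rewrite exprn_ge0 ?(ltW nu0) | exact: tj |].
  by rewrite expr2 ler_piMr ?(ltW nu0) // nuq_le1.
by apply: le_trans Lnu_le1; rewrite ler_peMl ?mulr_ge0 ?(ltW nu0) // ler1n.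
Qed.

Lemma bin2R : 'C(n, 2)%:R = n%:R * (n%:R - 1) / 2 :> R.
Proof.
have := bin_ffact n 2; rewrite ffactnS ffactn1 => /(congr1 (fun x => x%:R : R)).
move=> H; have {}H : 'C(n, 2)%:R * 2 = n%:R * n.-1%:R :> R by rewrite -!natrM; exact: H.
by apply: (@mulIf _ 2) => //; rewrite divfK // H -subn1 natrB // ltnW.
Qed.

(** The factor 1 + 1/(n-1) = n/(n-1) turns the binomial n(n-1)/2 into n^2/2. *)
Lemma Qt_shift i : Qtilde n i%:R * (1 + (n%:R - 1)^-1) = (Aw h i * kapq)^-1 /\ 0 < Qtilde n i%:R :> R.
Proof.
have n1' : 0 < n%:R - 1 :> R by rewrite subr_gt0 ltr1n.
have -> : Qtilde n i%:R = (Aw h i)^-1 * (n%:R * (n%:R - 1) / 2) :> R.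
  by rewrite /Qtilde bin2R /Aw -expRN.
have A0 := Aw_gt0 h i.
split; last by rewrite !mulr_gt0 ?invr_gt0.
have k : kapq = 2 / n%:R ^+ 2.
  have n8 : n%:R ^+ 2 * nuq ^+ 8 = 1 by rewrite -[8%N]/(4 * 2)%N exprM -exprMn n_nuq expr1n.
  by apply: (@mulIf _ (n%:R ^+ 2)); rewrite ?expf_neq0 // divfK ?expf_neq0 // /kapq -mulrA [_ * n%:R ^+ 2]mulrC n8 mulr1.
by rewrite k; field; rewrite nne !gt_eqF.
Qed.

Lemma Yt_scale i : Ytilde n i%:R * (Aw h i * kapq) = 8 * tm h i * h.
Proof.
have A0 := Aw_gt0 h i.
have -> : Ytilde n i%:R = 4 * tm h i * (Aw h i)^-1 * Num.sqrt n%:R :> R.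
  by rewrite /Ytilde /Aw -expRN.
have -> : 4 * tm h i * (Aw h i)^-1 * Num.sqrt n%:R * (Aw h i * kapq) =
   8 * tm h i * (Num.sqrt n%:R * nuq ^+ 2) * nuq ^+ 6 * ((Aw h i)^-1 * Aw h i) by rewrite /kapq; ring.
by rewrite sqrtn_nuq mulVf ?gt_eqF // !mulr1 h_nuq.
Qed.

Lemma goodK_arith (Q Y Yt Ak th rh e1 e2 et hh : R) : 0 < hh -> 0 <= th ->
  Y / Q = rh * (Y * Ak) -> Yt * Ak = 8 * th * hh -> `|rh - 1| <= e1 -> e1 <= 1 ->
  `|(Y - Yt) * Ak| <= e2 * hh -> 2 * e2 + 8 * th * e1 <= et ->
  `|Y / Q - 8 * th * hh| <= et * hh.
Proof.
move=> h0 th0 -> YtE r1 e11 D2 tot.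
have -> : rh * (Y * Ak) - 8 * th * hh = rh * ((Y - Yt) * Ak) + (rh - 1) * (8 * th * hh).
  by rewrite -YtE; ring.
have [lo hi] := near1 r1.
have T0 : 0 <= 8 * th * hh by rewrite !mulr_ge0 // ltW.
have D0 : 0 <= e2 * hh by apply: le_trans D2.
apply: le_trans (ler_normD _ _) _; rewrite [`|rh * _|]normrM [`|(rh - 1) * _|]normrM (ger0_norm T0).
apply: (@le_trans _ _ (2 * (e2 * hh) + e1 * (8 * th * hh))).
  apply: lerD; last exact: ler_wpM2r.
  apply: ler_pM => //; rewrite ger0_norm; lra.
have -> : 2 * (e2 * hh) + e1 * (8 * th * hh) = (2 * e2 + 8 * th * e1) * hh by ring.
by rewrite ler_wpM2r // ltW.
Qed.

(** Before time w the exponential factors are at most L, because w is so small that exp(C w^2) <=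
    log n. *)
Lemma fy_le (C w : R) i : 4 <= C -> expR (C * w ^+ 2) <= L -> i%:R <= w * n32 R n ->
  [/\ f_y C n (time n i%:R) <= L ^+ 4 * nuq, 0 <= f_y C n (time n i%:R) & Aw h i <= L].
Proof.
move=> C4 Cw iw; have tw : tm h i <= w.
  by have := ler_wpM2r (ltW h_gt0) iw; rewrite -mulrA n32_h mulr1.
have tw2 : tm h i ^+ 2 <= w ^+ 2 by rewrite lerXn2r ?nnegrE ?tm0 // (le_trans (tm0 i)).
have C0 : 0 <= C by apply: le_trans C4.
have e1 : expR (C * tm h i ^+ 2) <= L by apply: le_trans Cw; rewrite ler_expR ler_wpM2l.
have L1 : 1 <= L by apply: le_trans L100; rewrite ler1n.
split.
- rewrite /f_y -/nuq.
  have -> : L ^+ 4 * nuq = L * nuq * L ^+ 3 by ring.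
  apply: ler_pM; rewrite ?mulr_ge0 ?expR_ge0 ?powR_ge0 //.
    by rewrite ler_wpM2r ?(ltW nu0).
  by rewrite -powR_mulrn // ler_powR // ler_pdivrMr // -natrM ler_nat.
- by rewrite /f_y !mulr_ge0 ?expR_ge0 ?powR_ge0.
- by apply: le_trans e1; rewrite /Aw ler_expR ler_wpM2r ?sqr_ge0.
Qed.

Lemma tm16 i : (i < m)%N -> 16 * tm h i <= L.
Proof.
move=> im; case: sreg => _ _ _; apply: le_trans; rewrite ler_wpM2l //.
by rewrite ler_wpM2r ?(ltW h_gt0) // ler_nat ltnW.
Qed.

(** The two regimes of the event K merge: before time w the absolute errors [f_y] are relative
    errors up to a factor L, and after it the relative errors [g_y] and [g_q] are at most L^4 [zet].
    Both fit under L^5 [zet], and [etaq] adds the factor 8t of the closing rate. *)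
Lemma goodK_of_event (eps C w : R) (g : nat -> graph n) i :
  0 < eps <= 1 -> 4 <= C -> expR (C * w ^+ 2) <= L -> (i < m)%N ->
  event_K eps C w m.-1 g -> goodK h kapq etaq (L ^+ 2) i (g i).
Proof.
move=> /andP [eps0 eps1] C4 Cw im [[Y1 Y2] Z1 [Q1 Q2]].
have im' : (i <= m.-1)%N by rewrite -ltnS prednK // (leq_trans _ im).
have [QtE Qt0] := Qt_shift i.
have L1 : 1 <= L by apply: le_trans L100; rewrite ler1n.
have z0 := zet_gt0; have zi : expR (2 * tm h i ^+ 2) * nuq <= zet.
  rewrite /zet ler_wpM2r ?(ltW nu0) // ler_expR ler_wpM2l // lerXn2r ?nnegrE ?tm0 //.
  by rewrite ler_wpM2r ?(ltW h_gt0) // ler_nat ltnW.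
have A0 := Aw_gt0 h i; have k0 : 0 < kapq by rewrite mulr_gt0 // exprn_gt0.
have n1' : 0 < n%:R - 1 :> R by rewrite subr_gt0 ltr1n.
have qx : `|(Q_ (g i))%:R / Qtilde n i%:R - 1| <= L ^+ 5 * zet.
  case: (leP i%:R (w * n32 R n)) => iw.
    have [f1 f0 AL] := fy_le C4 Cw iw.
    have := Q1 i im' iw; rewrite /in_pm => /andP [lo hi].
    have Qn : Qtilde n (n32 R n) <= L * Qtilde n i%:R :> R.
      have -> : Qtilde n (n32 R n) = expR (- (4 * (n32 R n * h) ^+ 2)) * Aw h i * Qtilde n i%:R :> R.
        by rewrite /Qtilde /Aw -mulrA [_ * (_ * 'C(n, 2)%:R)]mulrA -expRD addrN expR0 mul1r.
      rewrite n32_h expr1n mulr1 ler_wpM2r ?(ltW Qt0) // -[leRHS]mul1r ler_pM ?expR_ge0 ?(ltW A0) //.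
    rewrite -(@ler_pM2r _ (Qtilde n i%:R)) //.
    have -> : `|(Q_ (g i))%:R / Qtilde n i%:R - 1| * Qtilde n i%:R = `|(Q_ (g i))%:R - Qtilde n i%:R| :> R.
      by rewrite -[X in _ * X](gtr0_norm Qt0) -normrM mulrBl mul1r divfK ?gt_eqF.
    apply: (@le_trans _ _ (eps * f_y C n (time n i%:R) * Qtilde n (n32 R n))).
      by rewrite ler_norml; apply/andP; split; [rewrite lerBrDl | rewrite lerBlDl].
    apply: (@le_trans _ _ (1 * (L ^+ 4 * nuq) * (L * Qtilde n i%:R))).
      apply: ler_pM => //; first by apply: mulr_ge0 => //; exact: ltW.
        by rewrite /Qtilde mulr_ge0 ?expR_ge0.
      by apply: ler_pM => //; exact: ltW.
    have -> : 1 * (L ^+ 4 * nuq) * (L * Qtilde n i%:R) = L ^+ 5 * nuq * Qtilde n i%:R by ring.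
    by rewrite ler_wpM2r ?(ltW Qt0) // ler_wpM2l ?exprn_ge0 // nuq_le_zet.
  have [_ _] := Q2 i im' iw; rewrite /in_pm => /andP [lo hi].
  apply: (@le_trans _ _ (g_q n (time n i%:R))).
    by rewrite ler_norml; apply/andP; split; [rewrite lerBrDl | rewrite lerBlDl].
  rewrite /g_q -/nuq mulrC; apply: ler_pM; rewrite ?exprn_ge0 ?mulr_ge0 ?expR_ge0 ?(ltW nu0) //.
  by rewrite ler_weXn2l.
have x4 : L ^+ 5 * zet <= 1 / 4.
  by have := absorb (isT : (5 <= 39)%N); rewrite -mulrA => ?; lra.
have s2 : (n%:R - 1)^-1 <= L ^+ 5 * zet / 8.
  apply: (@le_trans _ _ (2 * nuq ^+ 4)).
    rewrite -[leLHS]mul1r ler_pdivrMr // mulrBr mulr1 -mulrA [nuq ^+ 4 * _]mulrC n_nuq mulr1.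
    have : 2 * nuq ^+ 4 <= 1.
      have : nuq ^+ 4 <= nuq ^+ 1 by rewrite ler_wiXn2l ?(ltW nu0) // nuq_le1.
      have := Lnu_le1; have : nuq <= L * nuq by rewrite ler_peMl ?(ltW nu0).
      by rewrite expr1; lra.
    by lra.
  have n41 : nuq ^+ 4 <= nuq ^+ 1 by rewrite ler_wiXn2l ?(ltW nu0) // nuq_le1.
  rewrite expr1 in n41; apply: (@le_trans _ _ (2 * nuq)); first by rewrite ler_wpM2l.
  have : L ^+ 1 <= L ^+ 5 by rewrite ler_weXn2l.
  rewrite expr1 => L15; have nz := nuq_le_zet.
  have : 100 * zet <= L ^+ 5 * zet by rewrite ler_wpM2r ?(ltW z0) // (le_trans L100).
  by lra.
have s0 : 0 <= (n%:R - 1)^-1 :> R by rewrite invr_ge0 ltW.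
have s01 : 0 <= ((n%:R - 1)^-1 : R) <= 1 / 4 by rewrite s0 /=; lra.
have [Q0 rho0] := goodK_ratio Qt0 qx x4 s01.
have rE : ((Q_ (g i))%:R * Aw h i * kapq)^-1 = ((Q_ (g i))%:R / (Qtilde n i%:R * (1 + (n%:R - 1)^-1)))^-1.
  by rewrite QtE invrK -mulrA.
have rho1 : `|((Q_ (g i))%:R * Aw h i * kapq)^-1 - 1| <= 3 * (L ^+ 5 * zet).
  by rewrite rE; apply: le_trans rho0 _; lra.
have L2 : 100 <= L ^+ 2 by rewrite expr2; apply: le_trans L100 _; rewrite ler_peMl.
have L75 : 100 * (L ^+ 5 * zet) <= etaq.
  have -> : etaq = L ^+ 2 * (L ^+ 5 * zet) by rewrite /etaq; ring.
  by rewrite ler_wpM2r // mulr_ge0 ?exprn_ge0 // ltW.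
split.
- by move: Q0; rewrite ltr0n.
- move=> r rO; apply: (@goodK_arith _ _ (Ytilde n i%:R) (Aw h i * kapq) _
      (((Q_ (g i))%:R * Aw h i * kapq)^-1) (3 * (L ^+ 5 * zet)) (8 * (L ^+ 5 * zet))).
  + exact: h_gt0.
  + exact: tm0.
  + by field; rewrite !gt_eqF.
  + exact: Yt_scale.
  + exact: rho1.
  + by lra.
  + have Ak0 : 0 <= Aw h i * kapq by rewrite mulr_ge0 ?ltW.
    rewrite normrM (ger0_norm Ak0).
    case: (leP i%:R (w * n32 R n)) => iw.
      have [f1 f0 AL] := fy_le C4 Cw iw.
      have := Y1 i r im' iw rO; rewrite /in_pm => /andP [lo hi].
      have Yn : Ytilde n (n32 R n) <= 4 * Num.sqrt n%:R :> R.
        by rewrite /Ytilde /time n32_h expr1n !mulr1 ler_wpM2r ?sqrtr_ge0 // ler_piMr.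
      have Yn0 : 0 <= Ytilde n (n32 R n) :> R.
        by rewrite /Ytilde /time n32_h !mulr_ge0 ?expR_ge0 ?sqrtr_ge0.
      apply: (@le_trans _ _ ((L ^+ 4 * nuq) * (4 * Num.sqrt n%:R) * (L * kapq))).
        apply: ler_pM => //; last by rewrite ler_wpM2r ?(ltW k0).
        apply: (@le_trans _ _ (f_y C n (time n i%:R) * Ytilde n (n32 R n))).
          by rewrite ler_norml; apply/andP; split; [rewrite lerBrDl | rewrite lerBlDl].
        exact: ler_pM.
      have -> : L ^+ 4 * nuq * (4 * Num.sqrt n%:R) * (L * kapq) =
         8 * (L ^+ 5 * nuq) * (Num.sqrt n%:R * nuq ^+ 2) * nuq ^+ 6 by rewrite /kapq; ring.
      rewrite sqrtn_nuq mulr1 h_nuq ler_wpM2r ?exprn_ge0 ?(ltW nu0) // ler_wpM2l //.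
      by rewrite ler_wpM2l ?exprn_ge0 // nuq_le_zet.
    have := Y2 i r im' iw rO; rewrite /in_pm => /andP [lo hi].
    have Yi0 : 0 <= Ytilde n i%:R :> R.
      by rewrite /Ytilde !mulr_ge0 ?expR_ge0 ?sqrtr_ge0 ?tm0.
    apply: (@le_trans _ _ (g_y n (time n i%:R) * Ytilde n i%:R * (Aw h i * kapq))).
      apply: ler_wpM2r => //.
      by rewrite ler_norml; apply/andP; split; [rewrite lerBrDl | rewrite lerBlDl].
    rewrite -mulrA Yt_scale.
    apply: (@le_trans _ _ (L ^+ 4 * zet * (8 * tm h i * h))).
      apply: ler_wpM2r; first by rewrite !mulr_ge0 ?tm0 // ltW // h_gt0.
      by rewrite /g_y -/nuq mulrC ler_wpM2l ?exprn_ge0.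
    have -> : L ^+ 4 * zet * (8 * tm h i * h) = 8 * (L ^+ 4 * tm h i * zet) * h by ring.
    rewrite ler_wpM2r ?(ltW h_gt0) // ler_wpM2l // ler_wpM2r ?(ltW z0) // [L ^+ 5]exprSr ler_wpM2l ?exprn_ge0 //.
    by apply: le_trans (tm16 im); rewrite ler_peMl ?tm0 // ler1n.
  + have tL : 8 * tm h i <= L / 2.
      by have := tm16 im; lra.
    have : 8 * tm h i * (3 * (L ^+ 5 * zet)) <= L / 2 * (3 * (L ^+ 5 * zet)).
      by rewrite ler_wpM2r // !mulr_ge0 ?exprn_ge0 // ltW.
    have : L * (L ^+ 5 * zet) * 50 <= etaq.
      have -> : etaq = L * (L ^+ 5 * zet) * L by rewrite /etaq; ring.
      apply: ler_wpM2l; last by apply: le_trans L100; rewrite ler_nat.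
      by apply: mulr_ge0 => //; apply: mulr_ge0; [exact: exprn_ge0 | exact: ltW].
    by move: L75; lra.
- have z5 : 0 <= L ^+ 5 * zet by apply: mulr_ge0; [exact: exprn_ge0 | exact: ltW].
  by apply: le_trans rho1 _; lra.
- by move=> u v uv; exact: Z1.
Qed.
End Scale.

(** * Union bound over the enriched patterns *)

Lemma set_le1 (U : finType) (X : {set U}) : (#|X| <= 1)%N ->
  exists o : option U, X = [set x | o == Some x].
Proof.
move=> X1; case: (set_0Vmem X) => [->|[x xX]]; first by exists None; apply/setP => y; rewrite !inE.
exists (Some x); have -> : [set y | Some x == Some y] = [set x].
  by apply/setP => y; rewrite !inE; apply/eqP/eqP => [[->]|->].
by apply/esym/eqP; rewrite eqEcard finset.sub1set xX cards1.
Qed.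

Lemma card_optset (U : finType) (o : option U) : (#|[set x | o == Some x]| <= 1)%N.
Proof.
case: o => [x|]; last by rewrite (_ : [set x | None == Some x] = finset.set0) ?cards0 //; apply/setP => y; rewrite !inE.
have -> : [set y | Some x == Some y] = [set x]; last by rewrite cards1.
by apply/setP => y; rewrite !inE; apply/eqP/eqP => [[->]|->].
Qed.

Lemma card_set_type (U : finType) : #|{: {set U}}| = (2 ^ #|U|)%N.
Proof.
rewrite -[in RHS]cardsT -card_powerset; apply: eq_card => K.
by rewrite powersetE finset.subsetT inE.
Qed.

Lemma card_sig_subset (U : finType) (X : {set U}) : #|{: {S : {set U} | S \subset X}}| = (2 ^ #|X|)%N.
Proof. by rewrite card_sig -card_powerset; apply: eq_card => S; rewrite powersetE !inE. Qed.

Lemma pow2_le_expR (R : realType) j : (2 ^ j)%:R <= expR j%:R :> R.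
Proof.
rewrite -[j%:R]mulr1 expRM_natl natrX; apply: lerXn2r; rewrite ?nnegrE ?expR_ge0 //.
by have := expR_ge1Dx (1 : R); lra.
Qed.

Lemma pow2S_le v : ((2 ^ v).+1 <= 2 ^ v.+1)%N.
Proof. by rewrite expnS mul2n -addnn -[X in (X <= _)%N]addn1 leq_add2l expn_gt0. Qed.

Lemma pow2S_expR (R : realType) v : (2 ^ v).+1%:R <= expR v.+1%:R :> R.
Proof.
have a : (2 ^ v).+1%:R <= (2 ^ v.+1)%:R :> R by rewrite ler_nat; exact: pow2S_le.
exact: le_trans a (pow2_le_expR R v.+1).
Qed.

Lemma natM_le (R : realType) (a b : nat) (x y : R) : a%:R <= x -> b%:R <= y -> (a * b)%:R <= x * y.
Proof. by move=> ax bY; rewrite natrM ler_pM. Qed.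

Section UnionBound.
Variables (R : realType) (n m : nat).
Let L : R := ln n%:R.
Let h : R := n%:R `^ (- (3 / 2)).
Hypothesis sreg : scale_regime R n m.
Variables (V : finType) (E O : {set {set V}}) (k kk : nat).
Hypothesis small : (#|V| + #|E| + #|O|)%:R <= L.
Hypothesis k_ge : L ^+ 3 <= k%:R.
Hypothesis k_le : k%:R <= L ^+ 3 + 1.
Hypothesis kkE : kk = (k * #|V| + #|V| + 1)%N.

Let L100 : 100 <= L. Proof. by case: sreg. Qed.

Lemma union_size (S X : {set {set V}}) (D : {set V}) : S \subset E -> (#|X| <= 1)%N -> (#|D| <= 1)%N ->
  (k * (#|(E :\: S) :|: X : {set {set V}}| + #|O :|: S| + #|D : {set V}|))%:R <= Pq R n.
Proof.
move=> SE X1 D1; have c1 : (#|E :\: S| + #|S| = #|E|)%N.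
  by rewrite -(cardsID S E) (finset.setIidPr SE) addnC.
have c2 := leq_card_setU (E :\: S) X; have c3 := leq_card_setU O S.
apply: (@le_trans _ _ (k%:R * (L + 2))).
  rewrite natrM ler_wpM2l //; apply: (@le_trans _ _ ((#|V| + #|E| + #|O|)%:R + 2)); last by rewrite lerD2r.
  by rewrite -(natrD _ _ 2) ler_nat; move: c1 c2.1 c3.1 X1 D1; lia.
apply: (@le_trans _ _ ((L ^+ 3 + 1) * (L + 2))).
  by apply: ler_wpM2r k_le; move: L100; lra.
rewrite /Pq -/L; have L1 := L100.
have L3 : 1 <= L ^+ 3 by rewrite exprn_ege1 //; lra.
have L2 : 100 * L <= L ^+ 2 by rewrite expr2 ler_wpM2r //; lra.
rewrite (_ : L ^+ 5 = L ^+ 3 * L ^+ 2) -?exprD //; nra.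
Qed.

(** Sets of at most one element are encoded as options, which keeps the index small; the dominating
    factor n^|V|, at most exp(L^2), comes from the root map. *)
Definition union_index : finType :=
  ('I_m.+1 * {S : {set {set V}} | S \subset E} * option {set V} * option V * {set V} *
    {ffun V -> 'I_n} * 'I_n)%type.

Lemma card_union_index : #|union_index|%:R <= expR (2 * L ^+ 2) :> R.
Proof.
rewrite /union_index !card_prod !card_option !card_ord card_sig_subset !card_set_type card_ffun card_ord.
have L1 := L100; have n0 : 0 < n%:R :> R by case: sreg => n1 _ _ _; rewrite ltr0n ltnW.
have sm := small; rewrite !natrD in sm.
have v0 : 0 <= #|V|%:R :> R by []. have e0 : 0 <= #|E|%:R :> R by []. have o0 : 0 <= #|O|%:R :> R by [].
have vL : #|V|%:R <= L by lra.
have eL : #|E|%:R <= L by lra.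
have vS : #|V|.+1%:R <= 2 * L :> R by rewrite -natr1; lra.
have fin : 3 * L + L + 2 * L + L + L + L ^+ 2 + L <= 2 * L ^+ 2 by rewrite expr2; nra.
have L0' : 0 <= L by lra.
have f1 : m.+1%:R <= expR (3 * L) :> R.
  case: (posnP m) => [->|m0].
    by rewrite -[leLHS](@expR0 R) ler_expR; lra.
  have m0' : 0 < m%:R :> R by rewrite ltr0n.
  have : m%:R <= expR (2 * L) :> R by rewrite -[leLHS]lnK ?posrE // ler_expR (ln_m_le sreg).
  have -> : 3 * L = 2 * L + L by ring.
  rewrite expRD -natr1 => mL; have := expR_ge1Dx L.
  have : 1 <= m%:R :> R by rewrite ler1n.
  by move=> a b; apply: (@le_trans _ _ (expR (2 * L) * 2)); [lra | rewrite ler_wpM2l ?expR_ge0; lra].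
have f2 : (2 ^ #|E|)%:R <= expR L :> R by apply: le_trans (pow2_le_expR R _) _; rewrite ler_expR.
have f5 : (2 ^ #|V|)%:R <= expR L :> R by apply: le_trans (pow2_le_expR R _) _; rewrite ler_expR.
have f3 : (2 ^ #|V|).+1%:R <= expR (2 * L) :> R.
  by apply: le_trans (pow2S_expR R _) _; rewrite ler_expR.
have f4 : #|V|.+1%:R <= expR L :> R.
  by apply: le_trans f5; rewrite ler_nat ltn_expl.
have f6 : (n ^ #|V|)%:R <= expR (L ^+ 2) :> R.
  by rewrite natrX -[n%:R]lnK ?posrE // -expRM_natl ler_expR -/L expr2 ler_wpM2r.
have f7 : n%:R <= expR L :> R by rewrite lnK ?posrE.
have := natM_le (natM_le (natM_le (natM_le (natM_le (natM_le f1 f2) f3) f4) f5) f6) f7.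
rewrite -!expRD => le; apply: le_trans le _.
by rewrite ler_expR.
Qed.

(** The moment of order k >= L^3 gives exp(1 - k), against exp(2 L^2) indices. *)
Lemma goodJ_tail :
  tfp_prob R m (fun g : nat -> graph n => (forall i, (i < m)%N -> goodK h (kapq R n) (etaq R n m) (L ^+ 2) i (g i)) /\
    exists2 i, (i <= m)%N & ~ goodJ h (kapq R n) kk E O i (g i)) <= expR (- (3 * L ^+ 2)).
Proof.
pose Ev (j : union_index) (g : nat -> graph n) :=
  let: (i, S', oX, oD, A', phi', w) := j in
  (forall i, (i < m)%N -> goodK h (kapq R n) (etaq R n m) (L ^+ 2) i (g i)) /\
  expR 1 * Bsum n ((E :\: sval S') :|: [set x | oX == Some x]) (O :|: sval S') [set x | oD == Some x] A' kk
     (Aw h i)^-1 (kapq R n * i%:R) <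
  #|copies ((E :\: sval S') :|: [set x | oX == Some x]) (O :|: sval S') [set x | oD == Some x] A' phi' w (g i)|%:R.
apply: (@le_trans _ _ (tfp_prob R m (fun g => exists j, Ev j g))).
  apply: ler_tfp_prob => g [gK [i im nJ]]; apply: contrapT => noE; apply: nJ => S X D A' phi' w SE X1 D1.
  rewrite leNgt; apply/negP => lt; apply: noE.
  have [oX XE] := set_le1 X1; have [oD DE] := set_le1 D1.
  exists (Ordinal (im : (i < m.+1)%N), exist _ S SE, oX, oD, A', phi', w).
  by rewrite /Ev /= -XE -DE.
apply: (@le_trans _ _ (#|union_index|%:R * expR (1 - k%:R))).
  apply: tfp_prob_exists => -[[[[[[i [S SE]] oX] oD] A'] phi'] w].
  have im : (i <= m)%N by rewrite -ltnS.
  have Akk : (#|A' : {set V}| + 1 + k * #|V| <= kk)%N 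
    by rewrite kkE -[X in (_ <= X)%N]addnA addnC leq_add2l leq_add2r max_card.
  apply: (@le_trans _ _ _ _ _ _ (copies_tail (step_regime_scale sreg im) phi' w (kap_le1 sreg im)
    (delta_sum sreg im) im Akk (union_size SE (card_optset oX) (card_optset oD)))).
  by apply: ler_tfp_prob => g [gK lt]; split=> // i' i'i; apply: gK; apply: leq_trans i'i im.
apply: (@le_trans _ _ (expR (2 * L ^+ 2) * expR (1 - k%:R))).
  by rewrite ler_wpM2r ?expR_ge0 // card_union_index.
rewrite -expRD ler_expR; have L1 := L100; move: k_ge.
have : 100 * L ^+ 2 <= L ^+ 3 by rewrite [in leRHS]exprS ler_wpM2r ?sqr_ge0.
have : 1 <= L ^+ 2 by rewrite exprn_ege1 //; lra.
lra.
Qed.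
End UnionBound.

(** * Initial and final value of the weighted count *)

Lemma ffact_ge N k : ((N - k) ^ k <= N ^_ k)%N.
Proof.
elim: k N => [|k IH] N; first by rewrite ffactn0.
rewrite ffactnS expnS leq_mul ?leq_subr //; apply: leq_trans (IH _).
by case: k {IH} => // k; rewrite leq_exp2r //; lia.
Qed.

Lemma ffact_le_pow N k : (N ^_ k <= N ^ k)%N.
Proof. by elim: k => [|k IH]; rewrite ?ffactn0 // ffactnSr expnSr leq_mul // leq_subr. Qed.

Section Bernoulli.
Variable R : realType.

Lemma bernoulli_le (x : R) k : 0 <= x <= 1 -> 1 - k%:R * x <= (1 - x) ^+ k.
Proof.
move=> /andP [x0 x1]; elim: k => [|k IH]; first by rewrite mul0r subr0 expr0.
rewrite exprS; apply: (@le_trans _ _ ((1 - x) * (1 - k%:R * x))); last by rewrite ler_wpM2l //; lra.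
have : 0 <= k%:R * (x * x) by rewrite !mulr_ge0.
by rewrite -natr1; lra.
Qed.

Lemma pow_sub_ge (N b k : nat) : (0 < N)%N ->
  N%:R ^+ k * (1 - (k * b)%:R / N%:R) <= (N - b)%N%:R ^+ k :> R.
Proof.
move=> N0; have N0' : 0 < N%:R :> R by rewrite ltr0n.
case: (leqP b N) => bN.
  have -> : (N - b)%N%:R = N%:R * (1 - b%:R / N%:R) :> R.
    by rewrite natrB // mulrBr mulr1 mulrCA divff ?mulr1 ?gt_eqF.
  rewrite exprMn ler_wpM2l ?exprn_ge0 // natrM -mulrA bernoulli_le //.
  by rewrite divr_ge0 //= ler_pdivrMr // mul1r ler_nat.
case: k => [|k]; first by rewrite mul0n mul0r subr0 expr0 mulr1.
apply: (@le_trans _ _ 0); last by rewrite exprn_ge0.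
rewrite mulr_ge0_le0 ?exprn_ge0 // subr_le0 ler_pdivlMr // mul1r ler_nat.
by apply: leq_trans (ltnW bN) _; rewrite leq_pmull.
Qed.

Lemma start_shuffle1 (T k M N I F : R) : T * (k * M) * N - I * (T * k * F) = T * k * (N * M - I * F).
Proof. by ring. Qed.

Lemma start_shuffle2 (T k M N x ee mm : R) :
  T * k * (N * M * x + N * M * (ee / mm)) = T * N * (x * (k * M) + ee * ((k * M) / mm)).
Proof. by ring. Qed.

Lemma start_shuffle3 (T B N x ee hh : R) : T * B * N * (x + ee * hh) = T * N * (x * B + ee * (B * hh)).
Proof. by ring. Qed.

Lemma start_arith (I F Nn M x y : R) : 0 <= I -> I <= Nn -> Nn * (1 - x) <= I -> F <= M -> M * (1 - y) <= F ->
  0 <= M -> 0 <= y -> 0 <= Nn * M - I * F <= Nn * M * x + Nn * M * y.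
Proof.
move=> I0 IN NI FM MF M0 y0.
have -> : Nn * M - I * F = (Nn - I) * M + I * (M - F) by ring.
have a : (Nn - I) * M <= (Nn * x) * M by apply: ler_wpM2r => //; lra.
have b : I * (M - F) <= I * (M * y) by apply: ler_wpM2l => //; lra.
have c : I * (M * y) <= Nn * (M * y) by apply: ler_wpM2r => //; apply: mulr_ge0.
have d : 0 <= (Nn - I) * M by apply: mulr_ge0 => //; lra.
have d' : 0 <= I * (M - F) by apply: mulr_ge0 => //; lra.
by apply/andP; split; lra.
Qed.
End Bernoulli.

Section Identify.
Variables (V : finType) (n m : nat) (R : realType) (h kap : R).
Variables (E O : {set {set V}}) (A : {set V}) (phi : {ffun V -> 'I_n}).

(** At time m the falling factorial of 0 removes every copy with a missing edge, and [tau]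
    normalises the weight of a complete one to 1. *)
Lemma Wp_end G : Wp m h kap E O A phi m G =
  #|[set psi : {ffun V -> 'I_n} | [&& injectiveb psi, [forall a in A, psi a == phi a],
          [forall e in E, psi @: e \in G] & [forall e in O, psi @: e \in open_edges G]]]|%:R.
Proof.
rewrite /Wp big_mkcond /= -sum1dep_card natr_sum [RHS]big_mkcond /=; apply: eq_bigr => psi _.
rewrite [in RHS]andbA -/(inj_ext A phi psi); case: (boolP (inj_ext A phi psi)) => //= ext.
rewrite /Phis /Phi.
have imP (X : {set {set V}}) (Y : {set {set 'I_n}}) : (img psi X \subset Y) = [forall e in X, psi @: e \in Y].
  apply/fintype.subsetP/forall_inP => [sub e eX|all _ /imsetP [e eX ->]]; last exact: all.
  by apply: sub; apply: imset_f.
rewrite /valid -!imP -finset.setD_eq0.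
case: (boolP (img psi O \subset _)) => sO /=; last by rewrite andbF.
rewrite andbT; case: (boolP (img psi E :\: G == finset.set0)) => [/eqP ->|ne].
  rewrite finset.sub0set /weight cards0 subnn ffactn0 expr0 addn0 (card_img ext) !mulr1 /tau -exprMn.
  by rewrite mulfV ?expr1n // gt_eqF // Aw_gt0.
case: ifP => // _; by rewrite /weight subnn ffact0n cards_eq0 (negbTE ne) mulr0.
Qed.

Hypothesis pairE : forall e, e \in E -> #|e| = 2%N.
Hypothesis pairO : forall e, e \in O -> #|e| = 2%N.

(** In the empty graph every pair is open, so all injections extending phi are alive and have equal
    weight. *)
Lemma Wp_start : Wp m h kap E O A phi 0 finset.set0 =
  #|[set psi | inj_ext A phi psi]|%:R * (tau m h O * kap ^+ #|E| * (m ^_ #|E|)%:R).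
Proof.
rewrite /Wp (eq_bigr (fun=> tau m h O * kap ^+ #|E| * (m ^_ #|E|)%:R)).
  rewrite (eq_bigl (mem [set psi | inj_ext A phi psi])) => [|psi]; last by rewrite /= inE.
  by rewrite sumr_const mulr_natl.
move=> psi ext; rewrite /Phis /Phi.
have inj : injective psi by case: (inj_extP ext).
have op (X : {set {set V}}) : (forall e, e \in X -> #|e| = 2%N) -> img psi X \subset open_edges finset.set0.
  move=> pX; apply/fintype.subsetP => _ /imsetP [e eX ->].
  have c2 : #|psi @: e| = 2%N by rewrite card_imset // pX.
  rewrite inE c2 eqxx finset.in_set0 /=; apply/forallP => v; apply/negP => sub.
  have : (psi @: e \subset finset.set0).
    by apply: fintype.subset_trans sub _; apply/fintype.subsetP => u; rewrite !inE andbF.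
  by rewrite finset.subset0 -cards_eq0 c2.
rewrite /valid finset.setD0 (op _ pairO) (op _ pairE) /= /weight !(card_img ext) subn0.
by rewrite /Aw /tm mulr0n mul0r expr2 mul0r mulr0 expR0 expr1n mul1r.
Qed.

Hypothesis injA : {in A &, injective phi}.

Lemma card_inj_ext_le : (#|[set psi | inj_ext A phi psi]| <= n ^ #|~: A|)%N.
Proof.
pose f (psi : {ffun V -> 'I_n}) : {ffun {x | x \notin A} -> 'I_n} := [ffun u => psi (sval u)].
rewrite -(@card_in_imset _ _ f).
  apply: leq_trans (max_card _) _; rewrite card_ffun card_ord card_sig.
  have -> // : #|[pred x | x \notin A]| = #|~: A| by apply: eq_card => x; rewrite !inE.
move=> p q; rewrite !inE => /inj_extP [_ pA] /inj_extP [_ qA] fpq; apply/ffunP => x.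
case: (boolP (x \in A)) => xA; first by rewrite pA // qA.
by move/ffunP: fpq => /(_ (exist _ x xA)); rewrite !ffunE.
Qed.

Lemma card_inj_ext_ge : ((n - #|V|) ^ #|~: A| <= #|[set psi | inj_ext A phi psi]|)%N.
Proof.
pose g (f : {ffun {x | x \notin A} -> 'I_n}) : {ffun V -> 'I_n} :=
  [ffun x => if insub x is Some u then f u else phi x].
have gA f x : x \in A -> g f x = phi x.
  by move=> xA; rewrite ffunE insubN // negbK.
have gN f x (xA : x \notin A) : g f x = f (exist _ x xA).
  by rewrite ffunE insubT.
have gI : injective g.
  by move=> f f' /ffunP E'; apply/ffunP => -[x xA]; have := E' x; rewrite !gN.
have cD : #|{: {x | x \notin A}}| = #|~: A|.
  by rewrite card_sig; apply: eq_card => x; rewrite !inE.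
have cR : #|mem (~: (phi @: A))| = (n - #|A|)%N.
  have cc : (#|A| + #|~: (phi @: A)| = n)%N by rewrite -(card_in_imset injA) cardsC card_ord.
  have le : (#|A| <= n)%N by have := leq_addr #|~: (phi @: A)| #|A|; rewrite cc.
  by apply: (@addnI #|A|); rewrite subnKC.
have := @card_inj_ffuns_on {x | x \notin A} 'I_n (mem (~: (phi @: A))).
rewrite cD cR => cE.
apply: (@leq_trans ((n - #|A|) ^_ #|~: A|)).
  by apply: leq_trans (ffact_ge _ _); rewrite -subnDA cardsC.
rewrite -cE -(card_imset _ gI); apply: subset_leq_card.
apply/fintype.subsetP => psi0 /imsetP [f]; rewrite !inE => /andP [/ffun_onP fR /injectiveP fI] ->.
rewrite /inj_ext; apply/andP; split; last by apply/forall_inP => a aA; rewrite gA.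
have fN u x : x \in A -> f u != phi x.
  move=> xA; have := fR u; rewrite !inE; apply: contra => /eqP ->; exact: imset_f.
apply/injectiveP => x y; case: (boolP (x \in A)) => xA; case: (boolP (y \in A)) => yA.
- by rewrite !gA //; apply: injA.
- by rewrite gA // gN => /esym/eqP; rewrite (negbTE (fN _ _ xA)).
- by rewrite gN gA // => /eqP; rewrite (negbTE (fN _ _ yA)).
- by rewrite !gN => /fI [].
Qed.

(** Replacing injections by all maps costs a relative |V|^2/n, and replacing the falling factorial
    by a power costs |E|^2/m, which [kap <= h * bp] turns into |E|^2 h. *)
Lemma Wp_start_near (bp : R) : (0 < n)%N -> (0 < m)%N -> 0 <= kap -> kap * m%:R <= bp -> kap <= h * bp ->
  0 < bp -> 0 <= h ->
  `|tau m h O * (kap * m%:R) ^+ #|E| * n%:R ^+ #|~: A| - Wp m h kap E O A phi 0 finset.set0| <=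
  Nt n m h E O A bp * ((#|~: A| * #|V|)%:R / n%:R + (#|E| * #|E|)%:R * h).
Proof.
move=> n0 m0 k0 kb kh b0 h0; rewrite Wp_start.
have n0' : 0 < n%:R :> R by rewrite ltr0n.
have m0' : 0 < m%:R :> R by rewrite ltr0n.
have t0 : 0 <= tau m h O by rewrite exprn_ge0 // invr_ge0 Aw_ge0.
set I := #|_|%:R; set e := #|E|; set v := #|~: A|; set T := tau m h O.
have I0 : 0 <= I by rewrite /I.
have IN : I <= n%:R ^+ v by rewrite /I -natrX ler_nat card_inj_ext_le.
have NI : n%:R ^+ v * (1 - (v * #|V|)%:R / n%:R) <= I.
  by apply: le_trans (pow_sub_ge _ _ _ n0) _; rewrite -natrX ler_nat card_inj_ext_ge.
have FM : (m ^_ e)%:R <= m%:R ^+ e :> R by rewrite -natrX ler_nat ffact_le_pow.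
have MF : m%:R ^+ e * (1 - (e * e)%:R / m%:R) <= (m ^_ e)%:R :> R.
  by apply: le_trans (pow_sub_ge _ _ _ m0) _; rewrite -natrX ler_nat ffact_ge.
have M0 : 0 <= m%:R ^+ e :> R by rewrite exprn_ge0.
have y0 : 0 <= (e * e)%:R / m%:R :> R by rewrite divr_ge0.
have /andP [lo hi] := start_arith I0 IN NI FM MF M0 y0.
have -> : T * (kap * m%:R) ^+ e * n%:R ^+ v - I * (T * kap ^+ e * (m ^_ e)%:R) =
   T * kap ^+ e * (n%:R ^+ v * m%:R ^+ e - I * (m ^_ e)%:R) by rewrite exprMn; exact: start_shuffle1.
have Tk : 0 <= T * kap ^+ e by rewrite mulr_ge0 // exprn_ge0.
rewrite ger0_norm; last exact: mulr_ge0.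
apply: le_trans (ler_wpM2l Tk hi) _.
have -> : T * kap ^+ e * (n%:R ^+ v * m%:R ^+ e * ((v * #|V|)%:R / n%:R) + n%:R ^+ v * m%:R ^+ e * ((e * e)%:R / m%:R)) =
  T * n%:R ^+ v * (((v * #|V|)%:R / n%:R) * (kap * m%:R) ^+ e + (e * e)%:R * ((kap * m%:R) ^+ e / m%:R)).
  by rewrite [(kap * _) ^+ e]exprMn; exact: start_shuffle2.
rewrite /Nt -/T -/e -/v.
have -> : T * bp ^+ e * n%:R ^+ v * ((v * #|V|)%:R / n%:R + (e * e)%:R * h) =
  T * n%:R ^+ v * (((v * #|V|)%:R / n%:R) * bp ^+ e + (e * e)%:R * (bp ^+ e * h)).
  exact: start_shuffle3.
have km0 : 0 <= kap * m%:R by rewrite mulr_ge0.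
apply: ler_wpM2l; first by rewrite mulr_ge0 // exprn_ge0.
apply: lerD; first by rewrite ler_wpM2l ?divr_ge0 // lerXn2r ?nnegrE // ltW.
case: (posnP e) => [->|e0]; first by rewrite !mul0r.
rewrite ler_wpM2l // -(prednK e0) !exprSr.
rewrite -mulrA mulfK ?gt_eqF // -mulrA; apply: ler_pM; rewrite ?exprn_ge0 //.
  by rewrite lerXn2r ?nnegrE // ltW.
by rewrite mulrC.
Qed.
End Identify.

(** * Thresholds t_H(F) and the submodular potential *)

Section Thresholds.
Variables (R : realType) (n : nat) (V : finType) (F : graph_structure V).
Hypothesis n1 : (1 < n)%N.
Let L : R := ln n%:R.
Let n0 : 0 < n%:R :> R. Proof. by rewrite ltr0n ltnW. Qed.
Let L0 : 0 < L. Proof. by rewrite ln_gt0 // ltr1n. Qed.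
Implicit Types (H K A : {set V}) (t s : R).

Lemma time_n32 s : time n (s * n32 R n) = s.
Proof.
rewrite /time -mulrA /n32 -powRD ?addrN ?powRr0 ?mulr1 //.
by apply/implyP => _; rewrite gt_eqF.
Qed.

Lemma sqrt_expR : Num.sqrt n%:R = expR (L / 2) :> R.
Proof.
have -> : n%:R = expR (L / 2) ^+ 2 :> R.
  by rewrite -expRM_natl mulrC divfK ?lnK ?posrE ?pnatr_eq0.
by rewrite sqrtr_sqr ger0_norm ?expR_ge0.
Qed.

(** Logarithm of [Ntilde] divided by (2t)^e, so that the time t^*_H(K) is where it stops being
    positive. *)
Definition expo t H K : R :=
  L * (v_rel H K)%:R - L / 2 * (e_rel F H K)%:R - 4 * t ^+ 2 * (o_rel F H K)%:R.

Lemma Ntilde_expo H K (x : R) :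
  Ntilde F H K n x = (2 * time n x) ^+ e_rel F H K * expR (expo (time n x) H K).
Proof.
rewrite /Ntilde /expo sqrt_expR expr_div_n -!expRM_natl -expRN.
have -> : n%:R ^+ v_rel H K = expR ((v_rel H K)%:R * L) :> R by rewrite expRM_natl lnK ?posrE.
set T := _ ^+ e_rel F H K.
have -> (a b c : R) : a * (T * b) * c = T * (a * b * c) by ring.
by rewrite -!expRD; congr (_ * expR _); field.
Qed.

Lemma tstar_memP H K s : 0 < s ->
  (Ntilde F H K n (s * n32 R n) <= (2 * s) ^+ e_rel F H K) = (expo s H K <= 0).
Proof.
move=> s0; rewrite Ntilde_expo time_n32 ger_pMr ?expR_le1 //.
by rewrite exprn_gt0 // mulr_gt0.
Qed.

Lemma tstar_lt t H K : 0 < t -> (t%:E < tstar_rel R F H K n)%E -> 0 < expo t H K.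
Proof.
move=> t0; rewrite ltNge => /negP lt; rewrite ltNge; apply/negP => le; apply: lt.
by apply: ereal_inf_lbound; exists t => //; split=> //; rewrite tstar_memP.
Qed.

Lemma tstar_gt t H K : 0 < t -> 0 < expo t H K -> (t%:E < tstar_rel R F H K n)%E.
Proof.
move=> t0 e0; pose D := L * (v_rel H K)%:R - L / 2 * (e_rel F H K)%:R.
have eE s : expo s H K = D - 4 * s ^+ 2 * (o_rel F H K)%:R by [].
(* A strict inequality with an infimum needs a margin: [s0] is the root of the quadratic, or t + 1
   when no open pair leaves H and the sign does not depend on time. *)
have [s0 ts sle] : exists2 s0, t < s0 & forall s, 0 < s -> expo s H K <= 0 -> s0 <= s.
  case: (posnP (o_rel F H K)) => [oz|op].
    exists (t + 1) => [|s sp]; first by rewrite ltrDl.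
    by move: e0; rewrite !eE oz !mulr0 => ? ?; lra.
  have o0 : 0 < (o_rel F H K)%:R :> R by rewrite ltr0n.
  have D0 : 0 <= D / (4 * (o_rel F H K)%:R).
    have : 0 <= 4 * t ^+ 2 * (o_rel F H K)%:R by apply: mulr_ge0 => //; apply: mulr_ge0 => //; exact: sqr_ge0.
    by move: e0; rewrite eE => ? ?; rewrite divr_ge0 ?mulr_ge0 //; lra.
  exists (Num.sqrt (D / (4 * (o_rel F H K)%:R))) => [|s sp].
    rewrite -(ger0_norm (ltW t0)) -sqrtr_sqr ltr_sqrt; last first.
      by apply: lt_le_trans (_ : t ^+ 2 <= _); [exact: exprn_gt0 | rewrite ler_pdivlMr ?mulr_gt0 //; move: e0; rewrite eE; lra].
    by rewrite ltr_pdivlMr ?mulr_gt0 //; move: e0; rewrite eE; lra.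
  move=> se; rewrite -[leRHS](ger0_norm (ltW sp)) -sqrtr_sqr ler_sqrt ?sqr_ge0 //.
  by rewrite ler_pdivrMr ?mulr_gt0 //; move: se; rewrite eE; lra.
apply: (@lt_le_trans _ _ s0%:E); first by rewrite lte_fin.
rewrite /tstar_rel; apply: le_ereal_inf_tmp => _ [s [sp le] <-]; rewrite lee_fin; apply: sle => //.
by rewrite -tstar_memP.
Qed.

(** At t itself only a weak inequality survives, by continuity; at the smaller time t/2 positivity
    is strict and forces e < 2v. *)
Lemma tstar_le t H K : 0 < t -> (t%:E <= tstar_rel R F H K n)%E ->
  0 <= expo t H K /\ ((e_rel F H K) < 2 * v_rel H K)%N.
Proof.
move=> t0 le; pose D := L * (v_rel H K)%:R - L / 2 * (e_rel F H K)%:R.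
have eE s : expo s H K = D - 4 * s ^+ 2 * (o_rel F H K)%:R by [].
have no s : 0 < s -> s < t -> 0 < expo s H K.
  move=> s0 st; rewrite ltNge; apply/negP => es; move: le; apply/negP; rewrite -ltNge.
  apply: (@le_lt_trans _ _ s%:E); last by rewrite lte_fin.
  by apply: ereal_inf_lbound; exists s => //; split=> //; rewrite tstar_memP.
have o0 : 0 <= (o_rel F H K)%:R :> R by [].
have D0 : 0 < D.
  have t2 : 0 < t / 2 by rewrite divr_gt0.
  have t2' : t / 2 < t by lra.
  have := no _ t2 t2'; rewrite eE.
  have : 0 <= 4 * (t / 2) ^+ 2 * (o_rel F H K)%:R by apply: mulr_ge0 => //; apply: mulr_ge0 => //; exact: sqr_ge0.
  lra.
split.
  rewrite leNgt; apply/negP; rewrite eE => neg.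
  have op : 0 < (o_rel F H K)%:R :> R.
    by rewrite lt0r o0 andbT; apply/eqP => oz; move: neg; rewrite oz mulr0; lra.
  have D4 : 0 < D / (4 * (o_rel F H K)%:R) by rewrite divr_gt0 // mulr_gt0.
  have := no (Num.sqrt (D / (4 * (o_rel F H K)%:R))); rewrite sqrtr_gt0 D4 => /(_ isT).
  have -> : Num.sqrt (D / (4 * (o_rel F H K)%:R)) < t.
    rewrite -(ger0_norm (ltW t0)) -sqrtr_sqr ltr_sqrt ?exprn_gt0 //.
    by rewrite ltr_pdivrMr ?mulr_gt0 //; lra.
  move=> /(_ isT); rewrite eE sqr_sqrtr ?(ltW D4) //.
  have -> : D - 4 * (D / (4 * (o_rel F H K)%:R)) * (o_rel F H K)%:R = 0 by field; rewrite gt_eqF.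
  by rewrite ltxx.
rewrite -(ltr_nat R) natrM; move: D0; rewrite /D.
have -> : L * (v_rel H K)%:R - L / 2 * (e_rel F H K)%:R = L / 2 * (2 * (v_rel H K)%:R - (e_rel F H K)%:R) by field.
by rewrite pmulr_rgt0 ?divr_gt0 // subr_gt0.
Qed.

Lemma t_rel_ge eps H (x : \bar R) : (x <= t_rel eps F H n)%E ->
  (x <= (tmax eps n)%:E)%E /\ forall K, H \proper K -> (x <= tstar_rel R F H K n)%E.
Proof. by rewrite /t_rel le_min => /andP [/bigmin_geP [_ xK] ->]. Qed.

Lemma t_rel_gt eps H t : (t%:E < t_rel eps F H n)%E <->
  t < tmax eps n /\ forall K, H \proper K -> (t%:E < tstar_rel R F H K n)%E.
Proof.
rewrite /t_rel lt_min lte_fin; split=> [/andP [/bigmin_gtP [_ xK] ->]|[-> xK]] //.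
by rewrite andbT; apply/bigmin_gtP; split=> //; rewrite ltry.
Qed.

Definition pot t K : R := L * #|K|%:R - L / 2 * (ecount F K)%:R - 4 * t ^+ 2 * (ocount F K)%:R.

Lemma count_mono (X : {set {set V}}) H K : H \subset K ->
  (#|[set e in X | e \subset H]| <= #|[set e in X | e \subset K]|)%N.
Proof.
move=> HK; apply: subset_leq_card; apply/fintype.subsetP => e; rewrite !inE => /andP [-> eH] /=.
exact: fintype.subset_trans eH HK.
Qed.

Lemma count_supermodular (X : {set {set V}}) H K :
  (#|[set e in X | e \subset H]| + #|[set e in X | e \subset K]| <=
   #|[set e in X | e \subset H :|: K]| + #|[set e in X | e \subset H :&: K]|)%N.
Proof.
rewrite -cardsUI leq_add //; apply: subset_leq_card; apply/fintype.subsetP => e; rewrite !inE.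
  by move=> /orP [] /andP [-> eH] /=; apply: fintype.subset_trans eH _; rewrite ?finset.subsetUl ?finset.subsetUr.
by move=> /andP [/andP [-> eH] /andP [_ eK]]; rewrite /= finset.subsetI eH.
Qed.

Lemma expo_pot t H K : H \subset K -> expo t H K = pot t K - pot t H.
Proof.
move=> HK; rewrite /expo /pot /v_rel /e_rel /o_rel !natrB;
  (exact: (count_mono _ HK) || exact: subset_leq_card || ring).
Qed.

Lemma pot_submodular t H K : pot t (H :|: K) + pot t (H :&: K) <= pot t H + pot t K.
Proof.
have c1 : #|H :|: K|%:R + #|H :&: K|%:R = #|H|%:R + #|K|%:R :> R by rewrite -!natrD cardsUI.
have c2 := count_supermodular (gsE F) H K; have c3 := count_supermodular (gsO F) H K.
rewrite -(ler_nat R) !natrD in c2; rewrite -(ler_nat R) !natrD in c3.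
have l2 := ler_wpM2l (ltW (divr_gt0 L0 (ltr0n R 2))) c2.
have l3 := ler_wpM2l (mulr_ge0 (ler0n R 4) (sqr_ge0 t)) c3.
have l1 : L * #|H :|: K|%:R + L * #|H :&: K|%:R = L * #|H|%:R + L * #|K|%:R by rewrite -!mulrDr c1.
rewrite /pot /ecount /ocount; move: l1 l2 l3; rewrite !mulrDr; lra.
Qed.

(* Among the sets minimising the submodular function [pot t] over the supersets
   of [A], the largest one is exactly the minimal [H] with [t < t_H(F)]. *)
Lemma minset_pot eps t A H : 0 < t -> (t_rel eps F A n < t%:E)%E ->
  minset (fun K : {set V} => (A \proper K) && (t%:E < t_rel eps F K n)%E) H ->
  A \proper H /\ forall K, A \subset K -> pot t H <= pot t K.
Proof.
move=> t0 tA /minsetP [/andP [AH tH] minH]; split=> //.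
have [tm HK] := (t_rel_gt _ _ _).1 tH.
have [K0 AK0 minK0] := @arg_minP _ R {set V} A (fun K => A \subset K) (pot t) (fintype.subxx A).
have [H0 /andP [AH0 /eqP pH0] maxH0] := @arg_maxnP {set V} K0
  (fun K => (A \subset K) && (pot t K == pot t K0)) (fun K => #|K|) (introT andP (conj AK0 (eqxx _))).
have min0 K : A \subset K -> pot t H0 <= pot t K by move=> AK; rewrite pH0 minK0.
have strict K : H0 \proper K -> pot t H0 < pot t K.
  move=> H0K; have AK : A \subset K := fintype.subset_trans AH0 (proper_sub H0K).
  rewrite lt_def min0 // andbT; apply/eqP => pK.
  have := maxH0 K; rewrite AK pK pH0 eqxx => /(_ isT) /=; rewrite leqNgt.
  by rewrite (proper_card H0K).
have tH0 : (t%:E < t_rel eps F H0 n)%E.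
  apply/t_rel_gt; split=> // K H0K; apply: tstar_gt => //.
  by rewrite expo_pot ?proper_sub // subr_gt0 strict.
have AH0p : A \proper H0.
  rewrite finset.properEneq AH0 andbT; apply/eqP => AE.
  by move: tA; rewrite AE ltNge (ltW tH0).
(* Otherwise submodularity and the minimality of [H0] make the potential of H with [H0] added no
   larger than that of H, against t < t_H(F). *)
have H0H : H0 \subset H.
  have sm := pot_submodular t H H0.
  have mi : pot t H0 <= pot t (H :&: H0) by apply: min0; rewrite finset.subsetI (proper_sub AH).
  apply/negPn/negP => nsub.
  have pr : H \proper H :|: H0.
    rewrite properE finset.subsetUl /=; apply: contra nsub => sub.
    exact: fintype.subset_trans (finset.subsetUr _ _) sub.
  have := tstar_lt t0 (HK _ pr); rewrite expo_pot ?proper_sub // subr_gt0; lra.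
have HE : H0 = H by apply: minH => //; rewrite AH0p.
by move=> K AK; rewrite -HE min0.
Qed.
End Thresholds.

(** * Choice of the tail parameters and concentration around the trajectory *)

Lemma exp_nat1 (e v o : nat) : (e.+1 + 5 * v <= 5 * (v + e + o) + 1)%N.
Proof. lia. Qed.

Lemma exp_nat2 (s : nat) : (3 <= 5 * s + 1 + 20)%N.
Proof. lia. Qed.

Lemma exp_nat3 (s : nat) : (5 * s + 22)%N = (5 * s + 1 + 20).+1.
Proof. lia. Qed.

Section TrackArithmetic.
Variable R : realType.

Lemma expR1_le4 : expR 1 <= 4 :> R.
Proof.
have a : 2^-1 <= expR (- 2^-1) :> R by have := expR_ge1Dx (- 2^-1 : R); lra.
have b : expR 2^-1 <= 2 :> R.
  by rewrite -[2^-1]opprK expRN -[leRHS]invrK lef_pV2 ?posrE ?expR_gt0.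
have -> : expR 1 = expR 2^-1 * expR 2^-1 :> R by rewrite -expRD; congr expR; lra.
have c := expR_ge0 (2^-1 : R).
by apply: (@le_trans _ _ (2 * 2)); [apply: ler_pM | lra].
Qed.

Lemma Jb_shuffle (p X r hh P tt a b : R) :
  p * X * (hh * (2 * (P * (8 * tt + 4)) + P)) + p * (a * (X * r)) + 2 * (p * (b * (X * r))) =
  p * X * (hh * P * (16 * tt + 9) + (a + 2 * b) * r).
Proof. by ring. Qed.

Lemma drift_shuffle1 (a b p c X r : R) : a / b * (p * (c * (X * r))) = p * X * (a * c * r) * b^-1.
Proof. by ring. Qed.

Lemma drift_shuffle2 (W z7 l5 v2 b hh y : R) :
  W * (6 * (z7 * l5) + v2 * z7 + b) * (hh + y) =
    2 * (3 * z7 * l5 * (hh + y)) * W + v2 * (z7 * hh) * W + v2 * z7 * W * y + W * b * hh + W * b * y.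
Proof. by ring. Qed.

Lemma add3_le (a b c d e : R) : 0 <= c -> 0 <= d -> a + b + e <= a + b + c + d + e.
Proof. lra. Qed.

Lemma lam_shuffle1 (y N l G : R) : y * N * (l * G) = N * (y * l * G).
Proof. by ring. Qed.

Lemma lam_shuffle2 (y N l G : R) : y * N * (l * G) + y * N * (l * G) = 2 * (y * l) * G * N.
Proof. by ring. Qed.

(** With [x] the size of the weighted sum, the deviation is x L^20 G and theta is 1/(x L^16 G), so
    their product is L^4. The drift, at most x L^15 G, then costs at most 1. In the quadratic term
    theta J is at most G/L^8 and theta N W at most 1/(L^8 G), so G cancels. *)
Lemma tail_arith (L G x W J D N : R) : 100 <= L -> 0 < G -> G <= 1 -> 0 < x -> 0 <= W -> W <= x ->
  0 <= J -> J <= x * (L ^+ 8 * G ^+ 2) -> D <= x * (L ^+ 15 * G) -> 0 <= N -> N <= L ^+ 8 ->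
  let th := (x * (L ^+ 16 * G))^-1 in
  [/\ 0 <= th, th * J <= 1 / 2 &
      th * D + 2 * th ^+ 2 * J * N * W - th * (x * (L ^+ 20 * G)) <= 2 - L ^+ 4].
Proof.
move=> L1 G0 G1 x0 W0 Wx J0 JJ DD N0 NN th.
have L0 : 0 < L by lra.
have d0 : 0 < x * (L ^+ 16 * G) by rewrite !mulr_gt0 // exprn_gt0.
have th0 : 0 < th by rewrite invr_gt0.
have Lk k : (0 < k)%N -> 100 <= L ^+ k.
  have L1' : 1 <= L by apply: le_trans L1; rewrite ler1n.
  by move=> k0; apply: le_trans L1 _; rewrite -[leLHS]expr1 ler_weXn2l.
have L8 := Lk 8%N isT.
have thd : th * (x * (L ^+ 16 * G)) = 1 by rewrite mulVf ?gt_eqF.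
have thJ : th * J <= 1 / 100.
  apply: le_trans (ler_wpM2l (ltW th0) JJ) _.
  rewrite mulrC ler_pdivrMr // (_ : 1 / 100 * (x * (L ^+ 16 * G)) = x * (L ^+ 8 * G * (L ^+ 8 / 100))); last by field.
  apply: ler_wpM2l; first exact: ltW.
  rewrite expr2 mulrA; apply: ler_wpM2l; last by apply: le_trans G1 _; lra.
  by apply: mulr_ge0; [apply: exprn_ge0; exact: ltW | exact: ltW].
split; [exact: ltW | by lra |].
have thD : th * D <= 1.
  apply: le_trans (ler_wpM2l (ltW th0) DD) _; rewrite -thd ler_wpM2l ?(ltW th0) // ler_wpM2l ?(ltW x0) //.
  by rewrite ler_wpM2r ?(ltW G0) // ler_weXn2l //; lra.
have -> : th * (x * (L ^+ 20 * G)) = th * (x * (L ^+ 16 * G)) * L ^+ 4 by ring.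
rewrite thd mul1r.
have tW : th * (N * W) <= 1 / (L ^+ 8 * G).
  rewrite ler_pdivlMr ?mulr_gt0 ?exprn_gt0 //.
  apply: (@le_trans _ _ (th * (L ^+ 8 * x) * (L ^+ 8 * G))).
    rewrite ler_wpM2r ?mulr_ge0 ?exprn_ge0 ?(ltW L0) ?(ltW G0) // ler_wpM2l ?(ltW th0) //.
    exact: ler_pM.
  by rewrite -thd le_eqVlt; apply/orP; left; apply/eqP; ring.
have tJ : th * J <= G / L ^+ 8.
  apply: le_trans (ler_wpM2l (ltW th0) JJ) _.
  rewrite ler_pdivlMr ?exprn_gt0 // -[leRHS]mul1r -thd le_eqVlt; apply/orP; left; apply/eqP; ring.
have : 2 * th ^+ 2 * J * N * W <= 1.
  have -> : 2 * th ^+ 2 * J * N * W = 2 * ((th * J) * (th * (N * W))) by ring.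
  apply: (@le_trans _ _ (2 * (G / L ^+ 8 * (1 / (L ^+ 8 * G))))).
    rewrite ler_wpM2l //; apply: ler_pM => //; first by rewrite mulr_ge0 // ltW.
    by rewrite !mulr_ge0 // ltW.
  have -> : 2 * (G / L ^+ 8 * (1 / (L ^+ 8 * G))) = 2 / (L ^+ 16) by field; rewrite !gt_eqF.
  have := Lk 16%N isT => L16; rewrite ler_pdivrMr; lra.
lra.
Qed.
End TrackArithmetic.

Section Track.
Variables (R : realType) (n m : nat).
Let L : R := ln n%:R.
Let h : R := n%:R `^ (- (3 / 2)).
Let t : R := tm h m.
Let nu : R := nuq R n.
Let ze : R := zet R n m.
Hypothesis sreg : scale_regime R n m.
Hypothesis m0 : (0 < m)%N.
Variables (V : finType) (E O : {set {set V}}) (A : {set V}) (k kk : nat).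
Let s := (#|V| + #|E| + #|O|)%N.
Hypothesis small : s%:R <= L.
Hypothesis k_ge : L ^+ 3 <= k%:R.
Hypothesis k_le : k%:R <= L ^+ 3 + 1.
Hypothesis kkE : kk = (k * #|V| + #|V| + 1)%N.
Hypothesis spair : structure_pair E O A.
Variable c : R.
Hypothesis c2 : 2 <= c.

(** The time that corresponds to m^+. Replacing t by it in [bpq] keeps 2t/sqrt n from degenerating
    at early times. *)
Definition tpos : R := Num.max (tm (n%:R `^ (- (3 / 2))) m) 1.
Definition bpq : R := 2 * tpos * nuq R n ^+ 2.
(** The relative error [g_err] without its power of log n. *)
Definition Gq : R := expR (c * tm (n%:R `^ (- (3 / 2))) m ^+ 2) * nuq R n.
(** A further root gains [Gq ^+ 2]; the factor L is needed because a further edge gains only [bpq],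
    which is at most L/sqrt n. *)
Definition rhoq : R := Num.min 1 (ln n%:R * Gq ^+ 2).

Hypothesis G1 : Gq <= 1.
Hypothesis rYle : forall K : {set V}, A \proper K -> rY n m h E O A (Num.sqrt n%:R) K <= Gq ^+ 2.

Let L100 : 100 <= L. Proof. by case: sreg. Qed.
Let L0 : 0 < L. Proof. by apply: lt_le_trans L100. Qed.
Let L1 : 1 <= L. Proof. by apply: le_trans L100; rewrite ler1n. Qed.
Let nu0 : 0 < nu. Proof. exact: (nuq_gt0 sreg). Qed.
Let nu1 : nu <= 1. Proof. exact: (nuq_le1 sreg). Qed.
Let ze0 : 0 < ze. Proof. exact: (zet_gt0 sreg). Qed.
Let t0 : 0 <= t. Proof. exact: (tm0 sreg). Qed.
Let h0 : 0 < h. Proof. exact: (h_gt0 sreg). Qed.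
Let absorb j : (j <= 39)%N -> 100 * L ^+ j * ze <= 1.
Proof. by move=> j39; apply: pow_absorb => //; [exact: ltW | case: sreg]. Qed.

Lemma Gq_gt0 : 0 < Gq. Proof. by rewrite mulr_gt0 ?expR_gt0. Qed.
Let G0 := Gq_gt0.

Lemma zet_le_Gq : ze <= Gq.
Proof. by rewrite ler_wpM2r ?(ltW nu0) // ler_expR ler_wpM2r ?sqr_ge0. Qed.

Lemma nuq_le_Gq : nu <= Gq.
Proof. exact: le_trans (nuq_le_zet sreg) zet_le_Gq. Qed.

Lemma tpos_bounds : [/\ 1 <= tpos, t <= tpos & 2 * tpos <= L].
Proof.
rewrite /tpos le_max lexx orbT le_max lexx; split=> //.
have t16 : 16 * t <= L by case: sreg.
rewrite -ler_pdivlMl // ge_max; move: L100 => ?; apply/andP; split; rewrite -/h -/t; lra.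
Qed.

Lemma bpq_gt0 : 0 < bpq.
Proof. by case: tpos_bounds => tp _ _; rewrite !mulr_gt0 ?exprn_gt0 //; lra. Qed.

Lemma Gq2_le : Gq ^+ 2 <= Gq.
Proof. by rewrite expr2 ler_piMl // ltW. Qed.

Lemma nu2_le : nu ^+ 2 <= Gq ^+ 2.
Proof. by rewrite lerXn2r ?nnegrE ?(ltW nu0) ?(ltW G0) // nuq_le_Gq. Qed.

Lemma card_small : [/\ #|V|%:R <= L, #|E|%:R <= L & (#|O| + #|E|)%:R <= L].
Proof.
split; apply: le_trans small; rewrite ler_nat /s -addnA.
- exact: leq_addr.
- by rewrite addnCA leq_addr.
- by rewrite [(#|E| + _)%N]addnC leq_addl.
Qed.

Lemma rhoq_le : rhoq <= L * Gq ^+ 2. Proof. by rewrite /rhoq ge_min lexx orbT. Qed.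

Lemma rhoq_ge0 : 0 <= rhoq.
Proof. by rewrite /rhoq le_min ler01 mulr_ge0 ?sqr_ge0 // ltW. Qed.

Lemma creg_scale : copy_regime n m h (kapq R n) (etaq R n m) (Pq R n) kk E O A bpq (Num.sqrt n%:R) rhoq.
Proof.
have [tp1 ttp tpL] := tpos_bounds; have b0 := bpq_gt0.
have L1' := L1; have nu0' := nu0; have ze0' := ze0; have G0' := G0; have G1' := G1.
have ze1 : ze <= 1 by apply: le_trans zet_le_Gq G1.
have La := absorb (isT : (1 <= 39)%N); rewrite expr1 in La.
have nn : nu ^+ 2 <= nu by rewrite expr2 ler_piMl // ltW.
have Lnu := Lnu_le1 sreg; rewrite -/nu -/L in Lnu.
have bL : bpq <= L * nu ^+ 2 by rewrite /bpq ler_wpM2r ?sqr_ge0.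
split; [split=> // | split; [split|split]].
- by rewrite (kap_j R n (leqnn m)) /bpq ler_wpM2r ?sqr_ge0 // ler_wpM2l.
- rewrite /bpq (h_nuq R n : h = _) /kapq -/nu.
  have -> : nu ^+ 6 * (2 * tpos * nu ^+ 2) = tpos * (2 * nu ^+ 8) by ring.
  by apply: ler_peMl => //; apply: mulr_ge0 => //; apply: exprn_ge0; exact: ltW.
- have -> : Aw h m * bpq = 2 * tpos * (Aw h m * nu ^+ 2) by rewrite /bpq -/nu; ring.
  rewrite (Aw_zet R n m) -/ze expr2 mulrA.
  have : 2 * tpos * ze <= L * ze by rewrite ler_wpM2r // ltW.
  move=> le; have : 2 * tpos * ze <= 1 by lra.
  move=> le1; have z2 : 2 * tpos * ze * ze <= 1 * ze by rewrite ler_wpM2r // ltW.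
  by lra.
- have -> : bpq * Num.sqrt n%:R = 2 * tpos * (Num.sqrt n%:R * nu ^+ 2) by rewrite /bpq -/nu; ring.
  by rewrite (sqrtn_nuq sreg) mulr1; lra.
- by case: sreg => n1 _ _ _; rewrite ltnW.
- by rewrite kkE addn1.
- split; last by rewrite /rhoq ge_min lexx.
  rewrite /rhoq le_min; apply/andP; split.
    apply: le_trans bL _; have : L * nu ^+ 2 <= L * nu by rewrite ler_wpM2l // ltW.
    have : 0 < L * nu by rewrite mulr_gt0.
    by lra.
  by apply: le_trans bL _; rewrite ler_wpM2l ?(ltW L0) // nu2_le.
- move=> K AK; rewrite /rhoq le_min; apply/andP; split.
    by apply: le_trans (rYle AK) _; apply: le_trans Gq2_le G1.
  by apply: le_trans (rYle AK) _; rewrite ler_peMl ?sqr_ge0.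
- have -> : 12 * etaq R n m * Pq R n = 12 * (L ^+ 12 * ze) by rewrite /etaq /Pq -/L -/ze; ring.
  have := absorb (isT : (12 <= 39)%N).
  have : 0 <= L ^+ 12 * ze by apply: mulr_ge0; [apply: exprn_ge0; exact: ltW | exact: ltW].
  by lra.
- case: card_small => _ _ oe; apply: le_trans oe _; rewrite /Pq -/L -[leLHS]expr1.
  by rewrite ler_weXn2l.
- by rewrite sqr_sqrtr.
Qed.

Lemma kk_le : 2 * kk%:R <= L ^+ 5 :> R.
Proof.
have [vL _ _] := card_small; have L1' := L100.
have v0 : 0 <= #|V|%:R :> R by [].
rewrite kkE !natrD natrM.
have a : k%:R * #|V|%:R <= (L ^+ 3 + 1) * L by apply: ler_pM.
have l4 : 100 * L ^+ 4 <= L ^+ 5 by rewrite [leRHS]exprS ler_wpM2r ?exprn_ge0 // ltW.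
have l3 : 100 * L ^+ 3 <= L ^+ 4 by rewrite [leRHS]exprS ler_wpM2r ?exprn_ge0 // ltW.
have l2 : L ^+ 1 <= L ^+ 3 by rewrite ler_weXn2l.
rewrite expr1 in l2; rewrite mulrDl mul1r -exprSr in a; lra.
Qed.

Let N0 : R := Nt n m h E O A bpq.
Let x : R := L ^+ (5 * s + 1) * N0.

Lemma Nt_gt0 : 0 < N0.
Proof.
rewrite /N0 /Nt /tau !mulr_gt0 ?exprn_gt0 ?invr_gt0 ?Aw_gt0 ?bpq_gt0 //.
by case: sreg => n1 _ _ _; rewrite ltr0n ltnW.
Qed.

Let x0 : 0 < x. Proof. by rewrite mulr_gt0 ?exprn_gt0 ?Nt_gt0. Qed.

Lemma Wb_le : 0 <= Wb n m h kk E O A bpq <= x.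
Proof.
have N0' := Nt_gt0.
rewrite /Wb /X0 -/N0; apply/andP; split.
  apply: mulr_ge0; first exact: exprn_ge0.
  apply: mulr_ge0; last exact: ltW.
  by apply: mulr_ge0; [exact: expR_ge0 | apply: exprn_ge0; apply: mulr_ge0].
rewrite /x mulrA; apply: ler_wpM2r; first exact: ltW.
(* Each constant becomes a power of L: 2^|E| at most L^|E|, e at most L, and (2kk)^|V| at most
   L^(5|V|). *)
apply: (@le_trans _ _ (L ^+ #|E| * L * (L ^+ 5) ^+ #|V|)).
  rewrite mulrA; apply: ler_pM.
  - by apply: mulr_ge0; [exact: exprn_ge0 | exact: expR_ge0].
  - by apply: exprn_ge0; apply: mulr_ge0.
  - apply: ler_pM; [exact: exprn_ge0 | exact: expR_ge0 | |].
      by apply: lerXn2r; rewrite ?nnegrE ?(ltW L0) //; apply: le_trans L100; rewrite ler_nat.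
    by apply: le_trans (expR1_le4 R) _; apply: le_trans L100; rewrite ler_nat.
  - apply: lerXn2r kk_le; rewrite nnegrE; [exact: mulr_ge0 | apply: exprn_ge0; exact: ltW].
rewrite -exprSr -exprM -exprD; apply: ler_weXn2l => //.
exact: exp_nat1.
Qed.

Lemma V3_le : (#|V| ^ 3)%:R <= L ^+ 3 /\ (#|V| ^ 2)%:R <= L ^+ 2.
Proof.
by case: card_small => vL _ _; rewrite !natrX; split; rewrite lerXn2r ?nnegrE // ltW.
Qed.

Lemma Jb_le : 0 <= Jb n m h (Pq R n) kk E O A bpq rhoq <= x * (L ^+ 8 * Gq ^+ 2).
Proof.
have /andP [W0 Wx] := Wb_le; have [V3 V2] := V3_le; have r0 := rhoq_ge0; have rl := rhoq_le.
have -> : Jb n m h (Pq R n) kk E O A bpq rhoq = Wb n m h kk E O A bpq *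
  (h * L ^+ 5 * (16 * t + 9) + ((6 * #|V| ^ 3)%:R + 2 * (2 * #|V| ^ 2)%:R) * rhoq).
  by rewrite /Jb /Wb /Pq -/L -/t; exact: Jb_shuffle.
have b0 : 0 <= h * L ^+ 5 * (16 * t + 9) + ((6 * #|V| ^ 3)%:R + 2 * (2 * #|V| ^ 2)%:R) * rhoq.
  by rewrite addr_ge0 ?mulr_ge0 ?addr_ge0 ?mulr_ge0 ?exprn_ge0 ?(ltW h0) ?(ltW L0).
apply/andP; split; first exact: mulr_ge0.
apply: ler_pM => //.
have hG : h <= Gq ^+ 2.
  apply: le_trans nu2_le; rewrite (h_nuq R n : h = _) -/nu.
  by rewrite ler_wiXn2l // ltW.
have t16 : 16 * t <= L by case: sreg.
have L5 : 0 <= L ^+ 5 by rewrite exprn_ge0 // ltW.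
have a : h * L ^+ 5 * (16 * t + 9) <= Gq ^+ 2 * L ^+ 5 * (L * L).
  apply: ler_pM.
  - by apply: mulr_ge0 => //; exact: ltW.
  - by apply: addr_ge0 => //; apply: mulr_ge0.
  - exact: ler_wpM2r.
  - have LL : 100 * L <= L * L by apply: ler_wpM2r => //; exact: ltW.
    by have := L100; lra.
have b : ((6 * #|V| ^ 3)%:R + 2 * (2 * #|V| ^ 2)%:R) * rhoq <= (10 * L ^+ 3) * (L * Gq ^+ 2).
  apply: ler_pM => //.
  have l23 : L ^+ 2 <= L ^+ 3 by rewrite ler_weXn2l.
  rewrite (natrM R 6 (#|V| ^ 3)) (natrM R 2 (#|V| ^ 2)); move: (#|V| ^ 3)%:R (#|V| ^ 2)%:R V3 V2 => y3 y2 V3 V2.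
  by lra.
apply: le_trans (lerD a b) _.
have -> : Gq ^+ 2 * L ^+ 5 * (L * L) + 10 * L ^+ 3 * (L * Gq ^+ 2) = (L ^+ 7 + 10 * L ^+ 4) * Gq ^+ 2 by ring.
apply: ler_wpM2r; first exact: sqr_ge0.
have l7 : 100 * L ^+ 7 <= L ^+ 8 by rewrite [leRHS]exprS ler_wpM2r ?exprn_ge0 // ltW.
have l4 : L ^+ 4 <= L ^+ 7 by rewrite ler_weXn2l.
have l70 : 0 <= L ^+ 7 by rewrite exprn_ge0 // ltW.
lra.
Qed.

Lemma rate_ge0 i : 0 <= h + (m - i)%:R^-1.
Proof. by rewrite addr_ge0 ?invr_ge0 // ltW. Qed.

Lemma drift_sum : \sum_(i < m) drift n m h (etaq R n m) (Pq R n) kk E O A bpq rhoq i <= x * (L ^+ 15 * Gq).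
Proof.
have /andP [W0 Wx] := Wb_le; have [V3 V2] := V3_le; have r0 := rhoq_ge0; have rl := rhoq_le.
have [_ eL _] := card_small; have ze0' := ze0.
set W := Wb n m h kk E O A bpq in W0 Wx.
pose B : R := W * (6 * (L ^+ 7 * ze * L ^+ 5) + (#|V| ^ 2)%:R * (L ^+ 7 * ze) + 2 * #|E|%:R * (#|V| ^ 3)%:R * rhoq).
have B2 : B <= x * (L ^+ 13 * Gq).
  apply: ler_pM => //.
    by rewrite !addr_ge0 // !mulr_ge0 // ?exprn_ge0 // ltW.
  have a1 : 6 * (L ^+ 7 * ze * L ^+ 5) <= 6 * L ^+ 12 * Gq.
    have -> : 6 * (L ^+ 7 * ze * L ^+ 5) = 6 * L ^+ 12 * ze by ring.
    by apply: ler_wpM2l zet_le_Gq; apply: mulr_ge0 => //; apply: exprn_ge0; exact: ltW.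
  have a2 : (#|V| ^ 2)%:R * (L ^+ 7 * ze) <= L ^+ 2 * (L ^+ 7 * Gq).
    apply: ler_pM => //; first by rewrite mulr_ge0 ?exprn_ge0 // ltW.
    by rewrite ler_wpM2l ?zet_le_Gq // exprn_ge0 // ltW.
  have a3 : 2 * #|E|%:R * (#|V| ^ 3)%:R * rhoq <= 2 * L * L ^+ 3 * (L * Gq).
    apply: ler_pM => //; first by apply: ler_pM => //; rewrite ler_wpM2l.
    by apply: le_trans rl _; rewrite ler_wpM2l ?(ltW L0) // Gq2_le.
  apply: le_trans (lerD (lerD a1 a2) a3) _.
  have -> : 6 * L ^+ 12 * Gq + L ^+ 2 * (L ^+ 7 * Gq) + 2 * L * L ^+ 3 * (L * Gq) =
    (6 * L ^+ 12 + L ^+ 9 + 2 * L ^+ 5) * Gq by ring.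
  apply: ler_wpM2r; first exact: ltW.
  have l7 : 100 * L ^+ 12 <= L ^+ 13 by rewrite [leRHS]exprS ler_wpM2r ?exprn_ge0 // ltW.
  have l4 : L ^+ 9 <= L ^+ 12 by rewrite ler_weXn2l.
  have l5 : L ^+ 5 <= L ^+ 12 by rewrite ler_weXn2l.
  have l70 : 0 <= L ^+ 12 by rewrite exprn_ge0 // ltW.
  lra.
apply: (@le_trans _ _ (\sum_(i < m) B * (h + (m - i)%:R^-1))).
  apply: ler_sum => i _; rewrite /drift /delt /harm_rate -/W.
  have i0 : 0 <= (m - i)%:R^-1 :> R by rewrite invr_ge0.
  rewrite drift_shuffle1 -/(Wb n m h kk E O A bpq) -/W /B /etaq /Pq -/L -/ze drift_shuffle2.
  have b0 : 0 <= W * (2 * #|E|%:R * (#|V| ^ 3)%:R * rhoq) 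
    by apply: mulr_ge0 => //; apply: mulr_ge0 => //; apply: mulr_ge0 => //; apply: mulr_ge0.
  apply: add3_le; last by apply: mulr_ge0 => //; exact: ltW.
  apply: mulr_ge0 => //; apply: mulr_ge0 => //; apply: mulr_ge0 => //.
  by apply: mulr_ge0; [apply: exprn_ge0; exact: ltW | exact: ltW].
rewrite -mulr_sumr.
have rs := rate_sum sreg (leqnn m); rewrite -/h -/L in rs.
have s0 : 0 <= \sum_(i < m) (h + (m - i)%:R^-1) by apply: sumr_ge0 => i _; exact: rate_ge0.
apply: (@le_trans _ _ (x * (L ^+ 13 * Gq) * (4 * L))).
  apply: (@le_trans _ _ (x * (L ^+ 13 * Gq) * \sum_(i < m) (h + (m - i)%:R^-1))); first by rewrite ler_wpM2r.
  apply: ler_wpM2l => //; apply: mulr_ge0; first exact: ltW.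
  by apply: mulr_ge0; [apply: exprn_ge0; exact: ltW | exact: ltW].
have -> : x * (L ^+ 13 * Gq) * (4 * L) = x * (4 * L ^+ 14 * Gq) by ring.
apply: ler_wpM2l; first exact: ltW.
apply: ler_wpM2r; first exact: ltW.
rewrite [leRHS]exprS; apply: ler_wpM2r; first by apply: exprn_ge0; exact: ltW.
by apply: le_trans L100; rewrite ler_nat.
Qed.

Lemma nuv_sum : 0 <= \sum_(i < m) nuv m h (Pq R n) i <= L ^+ 8.
Proof.
have L5 : 0 <= L ^+ 5 by rewrite exprn_ge0 // ltW.
have t16 : 16 * t <= L by case: sreg.
have L1' := L100; have t0' := t0; have h0' := h0.
have i0 i : 0 <= (m - i)%:R^-1 :> R by rewrite invr_ge0.
apply/andP; split.
  apply: sumr_ge0 => i _; rewrite /nuv /Pq -/L -/t mulr_ge0 // addr_ge0 //.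
    by apply: mulr_ge0; [exact: ltW | lra].
apply: (@le_trans _ _ (\sum_(i < m) L ^+ 5 * (24 * t + 10) * (h + (m - i)%:R^-1))).
  apply: ler_sum => i _; rewrite /nuv /Pq -/L -/t -mulrA ler_wpM2l //.
  have := i0 i; set y := _^-1 => y0.
  have : 0 <= t * y by rewrite mulr_ge0.
  have -> : (24 * t + 10) * (h + y) = h * (24 * t + 10) + (24 * (t * y) + 10 * y) by ring.
  lra.
rewrite -mulr_sumr; have rs := rate_sum sreg (leqnn m); rewrite -/h -/L in rs.
apply: (@le_trans _ _ (L ^+ 5 * (24 * t + 10) * (4 * L))).
  by rewrite ler_wpM2l // mulr_ge0 //; lra.
rewrite (_ : L ^+ 8 = L ^+ 5 * L ^+ 3); last by rewrite -exprD.
rewrite -mulrA; apply: ler_wpM2l => //.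
apply: (@le_trans _ _ (2 * L * (4 * L))).
  by apply: ler_wpM2r; lra.
have -> : L ^+ 3 = L * (L * L) by ring.
have -> : 2 * L * (4 * L) = 8 * (L * L) by ring.
by apply: ler_wpM2r; [apply: mulr_ge0; exact: ltW | lra].
Qed.

Section OneMap.
Variable phi : {ffun V -> 'I_n}.
Hypothesis injA : {in A &, injective phi}.

Let good (g : nat -> graph n) := forall i, (i < m)%N ->
  goodK h (kapq R n) (etaq R n m) (L ^+ 2) i (g i) /\ goodJ h (kapq R n) kk E O i (g i).
Let lam := x * (L ^+ 20 * Gq).
Let Wdiff (G : graph n) := Wp m h (kapq R n) E O A phi m G - Wp m h (kapq R n) E O A phi 0 finset.set0.

Lemma Wdiff_tail (sg : R) : sg = 1 \/ sg = -1 ->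
  tfp_prob R m (fun g => good g /\ (faith E O A phi (g m) /\ lam <= sg * Wdiff (g m))) <= expR (2 - L ^+ 4).
Proof.
move=> sgE; have /andP [W0 Wx] := Wb_le; have /andP [J0 Jx] := Jb_le; have /andP [u0 ux] := nuv_sum.
have [th0 thJ fin] := tail_arith L100 G0 G1 x0 W0 Wx J0 Jx drift_sum u0 ux.
have n0 : (0 < n)%N by case: sreg => n1 _ _ _; rewrite ltnW.
apply: le_trans (@Wp_tail _ _ _ _ _ _ _ _ _ _ _ _ _ phi _ _ _ (step_regime_scale sreg (leqnn m)) creg_scale spair
  (Ordinal n0) _ _ lam sgE th0 thJ) _.
rewrite ler_expR; apply: le_trans fin; rewrite lerD2r /cstep big_split /= -mulr_sumr.
by rewrite -mulr_suml -mulr_sumr.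
Qed.

(** If the count is further than twice [lam] from the trajectory then, the starting value being
    within [lam] of it, the process has moved by at least [lam] in one of the two directions. *)
Lemma track_tail :
  tfp_prob R m (fun g => good g /\ faith E O A phi (g m) /\
    L ^+ (5 * s + 22) * Gq * N0 <
    `|#|[set psi : {ffun V -> 'I_n} | [&& injectiveb psi, [forall a in A, psi a == phi a],
          [forall e in E, psi @: e \in g m] & [forall e in O, psi @: e \in open_edges (g m)]]]|%:R -
      tau m h O * (kapq R n * m%:R) ^+ #|E| * n%:R ^+ #|~: A| |) <= 2 * expR (2 - L ^+ 4).
Proof.
have [pE pO _ _ _] := spair.
have [vL eL _] := card_small.
have n0 : (0 < n)%N by case: sreg => n1 _ _ _; rewrite ltnW.
have [[b0 kb kh _] _] := creg_scale.
have N0' := Nt_gt0.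
have k0 : 0 <= kapq R n by rewrite mulr_ge0 // exprn_ge0 // ltW.
have near := Wp_start_near pE pO injA n0 m0 k0 kb kh b0 (ltW h0).
have nearL : Nt n m h E O A bpq * ((#|~: A| * #|V|)%:R / n%:R + (#|E| * #|E|)%:R * h) <= lam.
  have nuG := nuq_le_Gq.
  have h1 : h <= Gq.
    by apply: le_trans nuG; rewrite (h_nuq R n : h = _) -/nu -[leRHS]expr1 ler_wiXn2l // ltW.
  have n1 : n%:R^-1 <= Gq.
    apply: le_trans nuG; have nn : n%:R != 0 :> R by rewrite pnatr_eq0 -lt0n.
    have -> : n%:R^-1 = nu ^+ 4 :> R.
      by apply: (mulfI nn); rewrite mulfV // (n_nuq sreg).
    by rewrite -[leRHS]expr1 ler_wiXn2l // ltW.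
  have vA : (#|~: A| * #|V|)%:R <= L * L.
    by rewrite natrM; apply: ler_pM => //; apply: le_trans vL; rewrite ler_nat max_card.
  have eE : (#|E| * #|E|)%:R <= L * L by rewrite natrM; apply: ler_pM.
  have a : (#|~: A| * #|V|)%:R / n%:R <= L * L * Gq by apply: ler_pM => //; rewrite invr_ge0.
  have b : (#|E| * #|E|)%:R * h <= L * L * Gq by apply: ler_pM => //; exact: ltW.
  rewrite /lam /x lam_shuffle1 -/N0; apply: ler_wpM2l; first exact: ltW.
  apply: le_trans (lerD a b) _; rewrite -exprD -mulrDl; apply: ler_wpM2r; first exact: ltW.
  apply: (@le_trans _ _ (L ^+ 3)).
    have -> : L ^+ 3 = L * (L * L) by ring.
    have -> : L * L + L * L = 2 * (L * L) by ring.
    by apply: ler_wpM2r; [apply: mulr_ge0; exact: ltW | apply: le_trans L100; rewrite ler_nat].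
  by rewrite ler_weXn2l // exp_nat2.
apply: (@le_trans _ _ (tfp_prob R m (fun g =>
   (good g /\ (faith E O A phi (g m) /\ lam <= 1 * Wdiff (g m))) \/
   (good g /\ (faith E O A phi (g m) /\ lam <= -1 * Wdiff (g m)))))).
  apply: ler_tfp_prob => g [gg [fg lt]].
  have lamW : lam <= `|Wdiff (g m)|.
    rewrite leNgt; apply/negP => Wl; move: lt; apply/negP; rewrite -leNgt -(Wp_end m h (kapq R n)).
    set w0 := Wp m h _ E O A phi 0 _ in near Wl *.
    apply: le_trans (ler_distD w0 _ _) _.
    rewrite [X in _ + X]distrC.
    apply: (@le_trans _ _ (lam + lam)).
      by apply: lerD; [exact: ltW | exact: le_trans near nearL].
    rewrite /lam /x.
    rewrite lam_shuffle2 -exprD exp_nat3.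
    rewrite !ler_wpM2r ?(ltW N0') ?(ltW G0) // exprS ler_wpM2r ?exprn_ge0 ?(ltW L0) //.
    by move: L100; lra.
  move: lamW; rewrite ler_normr mul1r mulN1r => /orP [] ?; [left | right]; by [].
apply: le_trans (tfp_prob_or _ _ _ _) _.
have := Wdiff_tail (or_introl erefl); have := Wdiff_tail (or_intror erefl).
by rewrite mulr_natl mulr2n => a b; apply: lerD.
Qed.
End OneMap.
End Track.

(** * Lower bounds for Delta in terms of the size of F *)

Section Counts.
Variables (V : finType) (F : graph_structure V).
Implicit Types (A K : {set V}).

Lemma ecountT : ecount F [set: V] = #|gsE F|.
Proof. by apply: eq_card => e; rewrite inE finset.subsetT andbT. Qed.

Lemma ocountT : ocount F [set: V] = #|gsO F|.
Proof. by apply: eq_card => e; rewrite inE finset.subsetT andbT. Qed.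

Lemma v_relT K : v_rel K [set: V] = #|~: K|.
Proof. by rewrite /v_rel cardsT -(cardsC K) addKn. Qed.

Lemma e_relT K : e_rel F K [set: V] = cnt (gsE F) K.
Proof.
rewrite /e_rel ecountT -(cnt_inside (gsE F) K).
by rewrite /inside -/(ecount F K) addKn.
Qed.

Lemma o_relT K : o_rel F K [set: V] = cnt (gsO F) K.
Proof.
rewrite /o_rel ocountT -(cnt_inside (gsO F) K).
by rewrite /inside -/(ocount F K) addKn.
Qed.

Lemma v_relD A K : A \subset K -> v_rel A K = #|K :\: A|.
Proof. by move=> AK; rewrite /v_rel cardsD (finset.setIidPr AK). Qed.

End Counts.

Section Structure.
Variables (V : finType) (F : graph_structure V) (A : {set V}).
Hypothesis gp : graph_structure_pair F A.
Implicit Types (H K : {set V}).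

Lemma structure_pair_of : structure_pair (gsE F) (gsO F) A.
Proof.
case: gp => perm ind; split=> //; [exact: gsE_pairs | exact: gsO_pairs | exact: gs_disjoint].
Qed.

Lemma ecountA : ecount F A = 0%N.
Proof.
apply/eqP; rewrite cards_eq0; apply/eqP/setP => e; rewrite !inE.
case: (boolP (e \in gsE F)) => //= eE; apply/negbTE; apply: gp.2.
by rewrite finset.in_setU eE.
Qed.

Lemma ocountA : ocount F A = 0%N.
Proof.
apply/eqP; rewrite cards_eq0; apply/eqP/setP => e; rewrite !inE.
case: (boolP (e \in gsO F)) => //= eE; apply/negbTE; apply: gp.2.
by rewrite finset.in_setU eE orbT.
Qed.

Lemma e_relA K : e_rel F A K = ecount F K. Proof. by rewrite /e_rel ecountA subn0. Qed.
Lemma o_relA K : o_rel F A K = ocount F K. Proof. by rewrite /o_rel ocountA subn0. Qed.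

Hypothesis iso : no_isolated F.

Lemma card_le_edges : (#|V| <= 2 * (#|gsE F| + #|gsO F|))%N.
Proof.
rewrite -cardsT.
apply: leq_trans (@card_cover_le V {set V} [set: V] (fun e => if e \in gsE F :|: gsO F then e else finset.set0) _) _.
  by move=> x _; have [e eEO xe] := iso x; exists e; rewrite eEO.
rewrite (bigID (fun e => e \in gsE F :|: gsO F)) /= [X in (_ + X)%N]big1 ?addn0; last first.
  by move=> e /negbTE ->; rewrite cards0.
rewrite (eq_bigr (fun=> 2%N)) => [|e eEO]; last first.
  by rewrite eEO; move: eEO; rewrite finset.in_setU => /orP []; [exact: gsE_pairs | exact: gsO_pairs].
rewrite sum_nat_const mulnC leq_mul2l /=.
by rewrite cardsU leq_subr.
Qed.

Lemma card_compl_gt0 : (0 < #|V|)%N -> (0 < #|~: A|)%N.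
Proof.
move=> /card_gt0P [x _]; have [e eEO _] := iso x; have := gp.2 _ eEO.
by rewrite lt0n cards_eq0; apply: contra => /eqP A0; rewrite -(finset.setCK A) A0 finset.setC0 finset.subsetT.
Qed.

Section DeltaBounds.
Variable R : realType.
Implicit Types (C : R).

Definition Sval C H K : R :=
  C ^+ 3 * (v_rel H K)%:R ^+ 2 + 2 * (e_rel F H K)%:R + (o_rel F H K)%:R.

Lemma Sval_ge C H K : 10 <= C ->
  1000 * (v_rel H K)%:R ^+ 2 + 2 * (e_rel F H K)%:R + (o_rel F H K)%:R <= Sval C H K.
Proof.
move=> C10; rewrite /Sval !lerD2r; apply: ler_wpM2r; first exact: sqr_ge0.
have -> : 1000 = 10 ^+ 3 :> R by rewrite -natrX.
by rewrite lerXn2r ?nnegrE //; lra.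
Qed.

(** The base is a nonnegative quantity that is either 0 or at least 1, and the exponent C is at
    least 4. *)
Lemma Delta_pow C H K : 10 <= C -> Sval C H K ^+ 4 <= Delta C F H K.
Proof.
move=> C10; rewrite /Delta -/(Sval C H K); have Sg := Sval_ge H K C10.
have [v0|v0] := posnP (v_rel H K + e_rel F H K + o_rel F H K)%N.
  have /and3P [/eqP a /eqP b /eqP d] : [&& v_rel H K == 0, e_rel F H K == 0 & o_rel F H K == 0]%N.
    by move/eqP: v0; rewrite !addn_eq0 -andbA.
  have -> : Sval C H K = 0 by rewrite /Sval a b d expr2 !mulr0 !addr0.
  by rewrite expr0n powR_ge0.
have S1 : 1 <= Sval C H K.
  apply: le_trans Sg; have e0 : 0 <= (e_rel F H K)%:R :> R by [].
  have : (v_rel H K)%:R <= (v_rel H K)%:R ^+ 2 :> R.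
    by rewrite -natrX ler_nat; case: (v_rel H K) => // j; rewrite -[X in (X <= _)%N]expn1 leq_pexp2l.
  have : 1 <= (v_rel H K + e_rel F H K + o_rel F H K)%:R :> R by rewrite ler1n.
  have v0' : 0 <= (v_rel H K)%:R :> R by [].
  by rewrite !natrD; lra.
rewrite -powR_mulrn; last lra.
by apply: ler_powR => //; lra.
Qed.

Let q : R := (#|gsE F| + #|gsO F|)%:R.

Lemma s_le : (#|V| + #|gsE F| + #|gsO F|)%:R <= 3 * q.
Proof. by rewrite /q -natrM ler_nat; have := card_le_edges; lia. Qed.

Lemma Sval_full C : 10 <= C -> (0 < #|V|)%N ->
  1000 + 2 * #|gsE F|%:R + #|gsO F|%:R <= Sval C A [set: V].
Proof.
move=> C10 V0; have := Sval_ge A [set: V] C10; rewrite e_relA o_relA ecountT ocountT v_relT => Sg.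
have : 1 <= #|~: A|%:R ^+ 2 :> R by rewrite -natrX ler1n expn_gt0 card_compl_gt0.
lra.
Qed.

(* The two pieces of [Delta3] together dominate the fourth power of [q]. *)
Lemma Delta3_ge C H : 10 <= C -> A \proper H ->
  exists2 T : R, T ^+ 4 / 8 <= Delta3 C F A H &
    1000 * (v_rel A H)%:R ^+ 2 + q <= T /\ 1 <= (v_rel A H)%:R ^+ 2 :> R.
Proof.
move=> C10 AH; have AH' := proper_sub AH.
exists (Sval C H [set: V] + Sval C A H).
  have p4 (x y : R) : (x + y) ^+ 4 / 8 <= x ^+ 4 + y ^+ 4.
    have p2 (a b : R) : (a + b) ^+ 2 <= 2 * (a ^+ 2 + b ^+ 2).
      by rewrite -subr_ge0 (_ : _ - _ = (a - b) ^+ 2) ?sqr_ge0 //; ring.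
    have e4 (a : R) : a ^+ 4 = (a ^+ 2) ^+ 2 by rewrite -exprM.
    rewrite !e4; have a1 := p2 x y; have a2 := p2 (x ^+ 2) (y ^+ 2).
    have a3 : ((x + y) ^+ 2) ^+ 2 <= (2 * (x ^+ 2 + y ^+ 2)) ^+ 2.
      by rewrite lerXn2r ?nnegrE ?sqr_ge0 // mulr_ge0 ?addr_ge0 ?sqr_ge0.
    have a4 : (2 * (x ^+ 2 + y ^+ 2)) ^+ 2 = 4 * (x ^+ 2 + y ^+ 2) ^+ 2 by ring.
    by rewrite a4 in a3; lra.
  by apply: le_trans (p4 _ _) _; rewrite /Delta3 lerD ?Delta_pow.
have v1 : (0 < v_rel A H)%N by rewrite /v_rel subn_gt0 proper_card.
split; last by rewrite -natrX ler1n expn_gt0 v1.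
have := Sval_ge H [set: V] C10; have := Sval_ge A H C10.
have ee : (e_rel F H [set: V] + e_rel F A H = #|gsE F|)%N.
  by rewrite e_relA e_relT addnC -(cnt_inside (gsE F) H).
have oO : (o_rel F H [set: V] + o_rel F A H = #|gsO F|)%N.
  by rewrite o_relA o_relT addnC -(cnt_inside (gsO F) H).
rewrite /q -ee -oO !natrD.
have : 0 <= (v_rel H [set: V])%:R ^+ 2 :> R by apply: sqr_ge0.
have : 0 <= (e_rel F H [set: V])%:R :> R by [].
have : 0 <= (e_rel F A H)%:R :> R by [].
by lra.
Qed.
End DeltaBounds.
End Structure.

Lemma s_le_sum (R : realType) (V : finType) (F : graph_structure V) : no_isolated F ->
  (#|V| + #|gsE F| + #|gsO F|)%:R <= 3 * (#|gsE F|%:R + #|gsO F|%:R) :> R.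
Proof. by move=> iso; apply: le_trans (s_le iso R) _; rewrite (natrD R #|gsE F|). Qed.

Section DeltaArithmetic.
Variable R : realType.
Implicit Types (S D T q e o s L v tt : R).

Lemma cubic_bound L T o tt : 0 <= T -> 0 <= L -> L <= 3 * T -> 0 <= o -> o <= T -> 0 <= tt -> 4 * tt <= L ^+ 2 ->
  4 * tt * o <= 9 * T ^+ 3.
Proof.
move=> T0 L0 LT o0 oT t0 tL.
apply: (@le_trans _ _ (L ^+ 2 * T)).
  by apply: ler_pM => //; apply: mulr_ge0.
have -> : 9 * T ^+ 3 = (3 * T) ^+ 2 * T by ring.
apply: ler_wpM2r => //; apply: lerXn2r => //; rewrite nnegrE; exact: mulr_ge0.
Qed.

Lemma Delta_half S D e o : 1000 + 2 * e + o <= S -> 0 <= e -> 0 <= o -> S ^+ 4 <= D ->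
  [/\ Num.sqrt D <= D / 2, 1000 * S ^+ 3 <= D & 1000 * S <= D].
Proof.
move=> SS e0 o0 SD; have S1 : 1000 <= S by lra.
have S3 : 1000 * S ^+ 3 <= D.
  by apply: le_trans SD; rewrite [leRHS]exprS ler_wpM2r // exprn_ge0 //; lra.
have S2 : 1 <= S ^+ 2 by rewrite exprn_ege1 //; lra.
have S1' : S <= S ^+ 3 by rewrite [leRHS]exprS ler_peMr //; lra.
have D4 : 4 <= D by lra.
split=> //; last by lra.
rewrite -[D / 2]ger0_norm; last by lra.
rewrite -sqrtr_sqr ler_sqrt ?sqr_ge0 // expr2; nra.
Qed.

Lemma exp_small S D e o s : 1000 + 2 * e + o <= S -> 0 <= e -> 0 <= o -> S ^+ 4 <= D -> s <= 3 * (e + o) ->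
  5 * s + 22 + e <= D - Num.sqrt D /\ 5 * s + 22 <= D - e - 2.
Proof. by move=> SS e0 o0 SD sq; have [a b c] := Delta_half SS e0 o0 SD; split; lra. Qed.

(** For structures larger than L, the exponents in the error terms outweigh (L/2) e + 4 t^2 o, the
    amount by which the expected count falls below the trivial bound, together with the factor
    n^(-1/4). *)
Lemma exp_large S D e o L tt : 1000 + 2 * e + o <= S -> 0 <= e -> 0 <= o -> S ^+ 4 <= D -> L <= 3 * (e + o) ->
  100 <= L -> 0 <= tt -> 4 * tt <= L ^+ 2 ->
  L / 2 * e + L / 4 <= D - Num.sqrt D /\ L / 2 * e + L / 4 + 4 * tt * o <= D - e - 2.
Proof.
move=> SS e0 o0 SD Lq L1 t0 tL; have [a b c] := Delta_half SS e0 o0 SD.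
have S1 : 1000 <= S by lra.
have LS : L <= 3 * S by lra.
have S2 : S * S <= S ^+ 3 by rewrite !exprS expr0 mulr1 ler_peMl //; [nra | lra].
have l1 : L * e <= 3 * S * S by apply: ler_pM; lra.
have l3 : 4 * tt * o <= 9 * S ^+ 3 by apply: (@cubic_bound L) => //; lra.
have S3 : 0 <= S ^+ 3 by rewrite exprn_ge0 //; lra.
have SS2 : S <= S * S by rewrite ler_peMl //; lra.
split; lra.
Qed.

Lemma exp3_small T D q s v : T ^+ 4 / 8 <= D -> 1000 * v + q <= T -> 1 <= v -> 0 <= q -> s <= 3 * q ->
  5 * s + 1 <= D.
Proof.
move=> TD vT v1 q0 sq; have T1 : 1000 <= T by lra.
have T4 : 1000 * T <= T ^+ 4.
  rewrite [leRHS]exprSr ler_wpM2r //; first by lra.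
  apply: le_trans T1 _; rewrite -[leLHS]expr1 ler_weXn2l //; lra.
lra.
Qed.

Lemma exp3_large T D e o v L tt : T ^+ 4 / 8 <= D -> 1000 * v ^+ 2 + (e + o) <= T -> 1 <= v -> 0 <= e -> 0 <= o ->
  L <= 3 * (e + o) -> 100 <= L -> 0 <= tt -> 4 * tt <= L ^+ 2 ->
  L * v + L / 2 * e + 4 * tt * o <= D.
Proof.
move=> TD vT v1 e0 o0 Lq L1 t0 tL.
have v2 : v <= v ^+ 2 by rewrite expr2 ler_peMl //; lra.
have T1 : 1000 <= T by lra.
have vT' : v <= T by lra.
have T0 : 0 <= T by lra.
have T3 : 1000 * T ^+ 3 <= T ^+ 4 by rewrite [leRHS]exprS ler_wpM2r // exprn_ge0.
have T2 : T * T <= T ^+ 3 by rewrite !exprS expr0 mulr1 ler_peMl //; [rewrite mulr_ge0 | lra].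
have l1 : L * v <= 3 * T * T by apply: ler_pM; lra.
have l2 : L * e <= 3 * T * T by apply: ler_pM; lra.
have l3 : 4 * tt * o <= 9 * T ^+ 3 by apply: (@cubic_bound L) => //; lra.
have : 0 <= T ^+ 3 by rewrite exprn_ge0.
lra.
Qed.

(** Since 2o <= c d with d = 2v - e, the left side is at most d (2 c t^2 - L/2). The bracket is not
    positive, so d >= 1 permits replacing d by 1. This is the origin of c(F,A) and of its
    denominator. *)
Lemma rY_arith L (c t d e v o : R) : d = 2 * v - e -> 1 <= d -> 2 * o <= c * d -> c * t ^+ 2 <= L / 4 ->
  - (L * v - L / 2 * e - 4 * t ^+ 2 * o) <= 2 * (c * t ^+ 2) - L / 2.
Proof.
move=> -> d1 oc ct; have t2 := sqr_ge0 t.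
have a : 2 * o * t ^+ 2 <= c * (2 * v - e) * t ^+ 2 by rewrite ler_wpM2r.
have X0 : 0 <= L / 2 - 2 * (c * t ^+ 2) by lra.
have b : L / 2 - 2 * (c * t ^+ 2) <= (2 * v - e) * (L / 2 - 2 * (c * t ^+ 2)) by rewrite ler_peMl.
have -> : - (L * v - L / 2 * e - 4 * t ^+ 2 * o) =
   - ((2 * v - e) * (L / 2 - 2 * (c * t ^+ 2))) - 2 * (c * (2 * v - e) * t ^+ 2 - 2 * o * t ^+ 2) by field.
lra.
Qed.
End DeltaArithmetic.

(** * Comparison of the weighted process with the trajectories *)

Lemma exp_nat4 (v e o : nat) : ((5 * v).+1 + (e + 2 * o) <= 5 * (v + e + o) + 1)%N.
Proof. lia. Qed.

Lemma mulr4A (R : comRingType) (a b c d : R) : a * b * c * d = a * (b * c * d).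
Proof. by ring. Qed.

Lemma kk_shuffle (R : comRingType) (l p k y B : R) : l * (p * (k * (y * B))) = l * (p * k) * y * B.
Proof. by ring. Qed.

Section Compare.
Variables (R : realType) (n m : nat) (V : finType) (F : graph_structure V) (A : {set V}).
Let L : R := ln n%:R.
Let h : R := n%:R `^ (- (3 / 2)).
Let t : R := tm h m.
Let E := gsE F.
Let O := gsO F.
Hypothesis sreg : scale_regime R n m.
Hypothesis m0 : (0 < m)%N.
Hypothesis gp : graph_structure_pair F A.
Let n1 : (1 < n)%N. Proof. by case: sreg. Qed.
Let n0 : 0 < n%:R :> R. Proof. by rewrite ltr0n ltnW. Qed.
Let L100 : 100 <= L. Proof. by case: sreg. Qed.
Let L0 : 0 < L. Proof. by apply: lt_le_trans L100. Qed.
Let L1 : 1 <= L. Proof. by apply: le_trans L100; rewrite ler1n. Qed.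
Let h0 : 0 < h. Proof. exact: (h_gt0 sreg). Qed.
Let t0 : 0 < t. Proof. by rewrite mulr_gt0 // ltr0n. Qed.

Lemma timeE : time n m%:R = t. Proof. by []. Qed.

Lemma time_max : time n (Num.max m%:R (n32 R n)) = tpos R n m.
Proof.
have := time_n32 n1 (1 : R); rewrite mul1r /time => one.
by rewrite /time maxr_pMl ?(ltW h0) // one.
Qed.

Lemma nuq_expR : nuq R n = expR (- (L / 4)).
Proof. by rewrite /nuq /powR gt_eqF //; congr expR; rewrite -/L; field. Qed.

Lemma natn_expR k : n%:R ^+ k = expR (L * k%:R) :> R.
Proof. by rewrite mulrC expRM_natl lnK ?posrE. Qed.

Lemma inv_sqrtn : (Num.sqrt n%:R)^-1 = nuq R n ^+ 2 :> R.
Proof.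
have s0 : Num.sqrt n%:R != 0 :> R by rewrite gt_eqF // sqrtr_gt0.
by apply: (mulfI s0); rewrite mulfV // (sqrtn_nuq sreg).
Qed.

Lemma Ntilde_unfold (H K : {set V}) : Ntilde F H K n m%:R =
  expR (- (4 * t ^+ 2)) ^+ o_rel F H K * (2 * t / Num.sqrt n%:R) ^+ e_rel F H K * n%:R ^+ v_rel H K.
Proof. by []. Qed.

Lemma Ntilde_full : Ntilde F A [set: V] n m%:R =
  tau m h O * (kapq R n * m%:R) ^+ #|E| * n%:R ^+ #|~: A|.
Proof.
rewrite Ntilde_unfold (e_relA gp) (o_relA gp) ecountT ocountT v_relT.
by rewrite expRN inv_sqrtn (kap_j R n (leqnn m)).
Qed.

Lemma Ntilde_sub (K : {set V}) : Ntilde F K [set: V] n m%:R =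
  (Aw h m)^-1 ^+ cnt O K * (kapq R n * m%:R) ^+ cnt E K * n%:R ^+ #|~: K|.
Proof.
rewrite Ntilde_unfold e_relT o_relT v_relT.
by rewrite expRN inv_sqrtn (kap_j R n (leqnn m)).
Qed.

Lemma Nt_late : 1 <= t -> Nt n m h E O A (bpq R n m) = Ntilde F A [set: V] n m%:R.
Proof.
move=> t1; rewrite Ntilde_full /Nt (kap_j R n (leqnn m)) /bpq /tpos -/h -/t.
by rewrite (max_idPl t1).
Qed.

(** Passing to time 1 costs at most L per edge, by [2 * tpos <= L], and e^4 per open pair. *)
Lemma Nt_early : Nt n m h E O A (bpq R n m) <=
  expR (4 * #|O|%:R) * L ^+ #|E| * Ntilde F A [set: V] n (n32 R n).
Proof.
have [tp1 _ tpL] := tpos_bounds sreg.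
have nu0 := nuq_gt0 sreg.
have := time_n32 n1 (1 : R); rewrite mul1r => one.
rewrite /Ntilde (e_relA gp) (o_relA gp) ecountT ocountT v_relT one expr1n !mulr1 inv_sqrtn -expRM_natl -/O -/E.
have -> (a b c d e : R) : a * b * (c * d * e) = (a * c) * (b * d) * e by ring.
rewrite -expRD (_ : 4 * #|O|%:R + #|O|%:R * - 4 = 0) ?expR0; last by ring.
rewrite -exprMn /Nt; apply: ler_wpM2r; first by rewrite exprn_ge0.
apply: ler_pM.
- by apply: exprn_ge0; rewrite invr_ge0 Aw_ge0.
- by apply: exprn_ge0; rewrite ltW // (bpq_gt0 sreg).
- apply: exprn_ile1; first by rewrite invr_ge0 Aw_ge0.
  by rewrite invf_le1 ?Aw_gt0 // /Aw -[leLHS](@expR0 R) ler_expR mulr_ge0 ?sqr_ge0.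
- apply: lerXn2r; rewrite ?nnegrE.
  + by rewrite ltW // (bpq_gt0 sreg).
  + by apply: mulr_ge0; [exact: ltW | apply: mulr_ge0 => //; exact: sqr_ge0].
  + rewrite /bpq -mulrA mulrCA; apply: ler_wpM2r; first by apply: mulr_ge0 => //; exact: sqr_ge0.
    by apply: le_trans tpL; apply: ler_peMl; [lra | rewrite ler1n].
Qed.

(** What cases (a) and (b) of the theorem provide up to t_A(F). The inequality is weak because t =
    t_A(F) is allowed. *)
Definition trackable : Prop := forall K : {set V}, A \proper K ->
  0 <= expo n F t A K /\ (e_rel F A K < 2 * v_rel A K)%N.

Hypothesis t8 : 8 * t ^+ 2 <= L.

Lemma c_exp_ge2 : 2 <= c_exp R F A.
Proof. exact: bigmax_ge_id. Qed.

(** Nonnegativity of [expo] says that 4 t^2 o is at most (L/2)(2v - e), which is the claim for the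
    ratio at [K]; the value 2 in the maximum is covered by 8 t^2 <= L. *)
Lemma c_exp_time : trackable -> c_exp R F A * t ^+ 2 <= L / 4.
Proof.
move=> tr; have t2 : 0 < t ^+ 2 by rewrite exprn_gt0.
have t8' := t8.
rewrite -ler_pdivlMr //; apply/bigmax_leP; split.
  by rewrite ler_pdivlMr //; move: (t ^+ 2) L t8' => y L' ?; lra.
move=> K AK; have [ex ev] := tr K AK; rewrite /expo (e_relA gp) (o_relA gp) -/L in ex.
rewrite (e_relA gp) -(ltr_nat R) natrM in ev.
have d0 : 0 < 2 * (v_rel A K)%:R - (ecount F K)%:R :> R by rewrite subr_gt0.
rewrite ler_pdivlMr // mulrAC ler_pdivrMr //.
move: ex; move: (t ^+ 2) (v_rel A K)%:R (ecount F K)%:R (ocount F K)%:R L => y a b c L'; lra.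
Qed.

Lemma Gq_le1 : trackable -> Gq n m (c_exp R F A) <= 1.
Proof.
move=> tr; have ct := c_exp_time tr; rewrite /Gq nuq_expR -expRD -/h -/t expR_le1; lra.
Qed.

Lemma rY_track : trackable -> forall K : {set V}, A \proper K ->
  rY n m h E O A (Num.sqrt n%:R) K <= Gq n m (c_exp R F A) ^+ 2.
Proof.
move=> tr K AK; have [ex ev] := tr K AK; have ct := c_exp_time tr.
rewrite (e_relA gp) in ev.
have ev' : (ecount F K).+1%:R <= 2 * (v_rel A K)%:R :> R by rewrite -natrM ler_nat.
have d1 : 1 <= 2 * (v_rel A K)%:R - (ecount F K)%:R :> R by rewrite lerBrDr addrC natr1.
have d0 : 0 < 2 * (v_rel A K)%:R - (ecount F K)%:R :> R by apply: lt_le_trans d1.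
have cK : 2 * (ocount F K)%:R <= c_exp R F A * (2 * (v_rel A K)%:R - (ecount F K)%:R).
  by rewrite -ler_pdivrMr //; rewrite /c_exp; apply: le_bigmax_cond.
have ra := rY_arith erefl d1 cK ct.
have -> : rY n m h E O A (Num.sqrt n%:R) K =
    expR (- (L * (v_rel A K)%:R - L / 2 * (ecount F K)%:R - 4 * t ^+ 2 * (ocount F K)%:R)).
  rewrite /rY -(v_relD (proper_sub AK)) natn_expR (sqrt_expR R n1) -/L /Aw -/t -!expRM_natl -expRN -!expRD.
  by congr expR; rewrite /inside -/(ocount F K) -/(ecount F K); ring.
rewrite /Gq nuq_expR -/h -/t -expRD -expRM_natl ler_expR; apply: le_trans ra _.
by rewrite le_eqVlt; apply/orP; left; apply/eqP; field.
Qed.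

Lemma trackable_of (eps w : R) : t <= w -> (w%:E < t_rel eps F A n)%E -> trackable.
Proof.
move=> tw wA K AK; have := (t_rel_ge (ltW wA)).2 K AK => wK.
by apply: (tstar_le n1 t0); apply: le_trans wK; rewrite lee_fin.
Qed.

Lemma trackable_of' (eps : R) : (t%:E <= t_rel eps F A n)%E -> trackable.
Proof. by move=> tA K AK; apply: (tstar_le n1 t0); exact: (t_rel_ge tA).2. Qed.

Variable phi : {ffun V -> 'I_n}.

Lemma Ncopies_le G : (Ncopies F A G phi)%:R <= n%:R ^+ #|~: A| :> R.
Proof.
rewrite -natrX ler_nat; apply: leq_trans (card_inj_ext_le A phi); apply: subset_leq_card.
by apply/fintype.subsetP => psi; rewrite !inE => /and4P [a b _ _]; rewrite /inj_ext a b.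
Qed.

Lemma Ntilde_le : 0 <= (Ntilde F A [set: V] n m%:R : R) <= n%:R ^+ #|~: A|.
Proof.
have nu0 := nuq_gt0 sreg.
have k0 : 0 <= kapq R n * m%:R by apply: mulr_ge0 => //; apply: mulr_ge0 => //; apply: exprn_ge0; exact: ltW.
have k1 := kap_le1 sreg (leqnn m).
have T0 : 0 <= tau m h O by apply: exprn_ge0; rewrite invr_ge0 Aw_ge0.
rewrite Ntilde_full; apply/andP; split.
  by apply: mulr_ge0; [apply: mulr_ge0 => //; exact: exprn_ge0 | exact: exprn_ge0].
rewrite -[leRHS]mul1r; apply: ler_wpM2r; first exact: exprn_ge0.
have T1 : tau m h O <= 1.
  apply: exprn_ile1; first by rewrite invr_ge0 Aw_ge0.
  by rewrite invf_le1 ?Aw_gt0 // /Aw -[leLHS](@expR0 R) ler_expR mulr_ge0 ?sqr_ge0.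
by rewrite -[leRHS]mulr1; apply: ler_pM => //; [exact: exprn_ge0 | exact: exprn_ile1].
Qed.

Lemma in_pm_norm (x a b : R) : `|x - a| <= b -> in_pm x a b.
Proof. by rewrite ler_norml /in_pm => /andP [? ?]; apply/andP; split; lra. Qed.

Lemma in_pm_trivial G (b : R) : n%:R ^+ #|~: A| <= b ->
  in_pm (Ncopies F A G phi)%:R (Ntilde F A [set: V] n m%:R) b.
Proof.
move=> nb; apply: in_pm_norm; apply: le_trans nb.
have a := Ncopies_le G; have /andP [b0 b1] := Ntilde_le.
have c0 : 0 <= (Ncopies F A G phi)%:R :> R by [].
by rewrite ler_norml; apply/andP; split; lra.
Qed.

Lemma kk_copies (w0 : 'I_n) (H : {set V}) kk G :
  2 * kk%:R <= L ^+ 5 :> R -> (1 <= kk)%N -> goodJ h (kapq R n) kk E O m G ->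
  (forall K : {set V}, A \subset K -> pot n F t H <= pot n F t K) -> A \subset H ->
  (Ncopies F A G phi)%:R <= L ^+ (5 * (#|V| + #|E| + #|O|) + 1) *
     Ntilde F H [set: V] n (Num.max m%:R (n32 R n)).
Proof.
move=> kkL kk1 gJ minH AH.
have [tp1 ttp tpL] := tpos_bounds sreg.
have nu0 := nuq_gt0 sreg.
have kj0 : 0 <= kapq R n * m%:R by apply: mulr_ge0 => //; apply: mulr_ge0 => //; apply: exprn_ge0; exact: ltW.
set B := Ntilde F H _ _ _.
have EO0 : ((E :\: finset.set0) :|: finset.set0 = E /\ O :|: finset.set0 = O)%SET.
  by rewrite finset.setD0 !finset.setU0.
have := gJ finset.set0 finset.set0 finset.set0 A phi w0 (finset.sub0set _).
rewrite !cards0 => /(_ isT isT); rewrite EO0.1 EO0.2 => J.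
apply: le_trans (le_trans _ J) _.
  rewrite ler_nat; apply: subset_leq_card; apply/fintype.subsetP => psi; rewrite !inE => /and4P [a b c d].
  rewrite /extends a b /=; apply/and3P; split.
  - by apply/forallP => x; rewrite finset.in_set0.
  - apply/fintype.subsetP => f; rewrite finset.in_setU => /orP [] /imsetP [e]; last by rewrite finset.in_set0.
    by move=> eE ->; move/forall_inP: c => /(_ e eE).
  - by apply/fintype.subsetP => f /imsetP [e eE ->]; move/forall_inP: d => /(_ e eE).
have B0 : expR (expo n F (tpos R n m) H [set: V]) <= B.
  rewrite /B (Ntilde_expo F n1) time_max; apply: ler_peMl; first exact: expR_ge0.
  by apply: exprn_ege1; lra.
have term (K : {set V}) : A \subset K ->
  (Aw h m)^-1 ^+ cnt O K * (kapq R n * m%:R) ^+ (cnt E K + #|(finset.set0 : {set V}) :\: K|) * n%:R ^+ #|~: K| <=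
  L ^+ (#|E| + 2 * #|O|) * B.
  move=> AK; rewrite finset.set0D cards0 addn0.
  rewrite -Ntilde_sub.
  rewrite (Ntilde_expo F n1) timeE.
  apply: (@le_trans _ _ (L ^+ #|E| * expR (expo n F t H [set: V]))).
    apply: ler_pM; [by apply: exprn_ge0; apply: mulr_ge0 => //; exact: ltW | exact: expR_ge0 | |].
      apply: (@le_trans _ _ (L ^+ e_rel F K [set: V])).
        apply: lerXn2r; rewrite ?nnegrE; [by apply: mulr_ge0 => //; exact: ltW | exact: ltW |].
        by apply: le_trans tpL; apply: ler_wpM2l.
      by rewrite ler_weXn2l // /e_rel ecountT leq_subr.
    by rewrite ler_expR !expo_pot ?finset.subsetT // lerD2l lerN2 minH.
  rewrite exprD -mulrA ler_wpM2l ?exprn_ge0 ?(ltW L0) //.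
  apply: (@le_trans _ _ (expR (4 * #|O|%:R) * expR (expo n F (tpos R n m) H [set: V]))).
    rewrite -expRD ler_expR /expo.
    have oO : (o_rel F H [set: V])%:R <= #|O|%:R :> R by rewrite ler_nat /o_rel ocountT leq_subr.
    have o0 : 0 <= (o_rel F H [set: V])%:R :> R by [].
    (* For t < 1 the comparison is made at time 1 instead of t, which costs at most e^4 per open
       pair. *)
    have : tpos R n m ^+ 2 * (o_rel F H [set: V])%:R <= #|O|%:R + t ^+ 2 * (o_rel F H [set: V])%:R.
      rewrite /tpos -/h -/t; case: (leP t 1) => t1; last by rewrite lerDr.
      rewrite expr1n mul1r; apply: le_trans oO _; rewrite lerDl; apply: mulr_ge0 => //; exact: sqr_ge0.
    by rewrite -!mulrA; lra.
  apply: ler_pM; rewrite ?expR_ge0 //.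
  rewrite exprM [4 * _]mulrC expRM_natl; apply: lerXn2r; rewrite ?nnegrE ?expR_ge0 ?sqr_ge0 //.
  have e4 : expR 4 = expR 1 ^+ 4 :> R by rewrite -expRM_natl mulr1.
  have : expR 1 ^+ 4 <= 4 ^+ 4 :> R by rewrite lerXn2r ?nnegrE ?expR_ge0 // expR1_le4.
  rewrite e4 => le4; apply: le_trans le4 _.
  have : 100 ^+ 2 <= L ^+ 2 by rewrite lerXn2r ?nnegrE ?(ltW L0).
  by rewrite -!natrX => ?; lra.
have B00 : 0 <= B by apply: le_trans B0; exact: expR_ge0.
have kk1' : 1 <= kk%:R :> R by rewrite ler1n.
apply: (@le_trans _ _ (L * \sum_(K : {set V} | A \subset K) kk%:R ^+ #|V| * (L ^+ (#|E| + 2 * #|O|) * B))).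
  apply: ler_pM; rewrite ?expR_ge0 //.
  - rewrite /Bsum sumr_ge0 // => K _; rewrite !mulr_ge0 ?exprn_ge0 ?invr_ge0 ?Aw_ge0 //.
  - by apply: le_trans (expR1_le4 R) _; move: L100; lra.
  - rewrite /Bsum; apply: ler_sum => K AK.
    rewrite mulr4A; apply: ler_pM.
    + exact: exprn_ge0.
    + apply: mulr_ge0; last exact: exprn_ge0.
      by apply: mulr_ge0; apply: exprn_ge0 => //; rewrite invr_ge0 Aw_ge0.
    + by rewrite ler_weXn2l // max_card.
    + exact: term.
rewrite sumr_const -[X in L * X <= _]mulr_natl.
apply: (@le_trans _ _ (L * ((2 ^ #|V|)%:R * (kk%:R ^+ #|V| * (L ^+ (#|E| + 2 * #|O|) * B))))).
  apply: ler_wpM2l; first exact: ltW.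
  apply: ler_wpM2r.
    by apply: mulr_ge0; [exact: exprn_ge0 | apply: mulr_ge0 => //; apply: exprn_ge0; exact: ltW].
  rewrite ler_nat -cardsT -card_powerset; apply: subset_leq_card.
  by apply/fintype.subsetP => K _; rewrite powersetE finset.subsetT.
have -> : L * ((2 ^ #|V|)%:R * (kk%:R ^+ #|V| * (L ^+ (#|E| + 2 * #|O|) * B))) =
   L * (2 * kk%:R) ^+ #|V| * L ^+ (#|E| + 2 * #|O|) * B by rewrite natrX [(2 * _) ^+ _]exprMn; exact: kk_shuffle.
apply: ler_wpM2r => //.
apply: (@le_trans _ _ (L * (L ^+ 5) ^+ #|V| * L ^+ (#|E| + 2 * #|O|))).
  apply: ler_wpM2r; first by rewrite exprn_ge0 // ltW.
  apply: ler_wpM2l; first exact: ltW.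
  by apply: lerXn2r; rewrite ?nnegrE; [exact: mulr_ge0 | apply: exprn_ge0; exact: ltW | exact: kkL].
by rewrite -exprM -exprS -exprD ler_weXn2l // exp_nat4.
Qed.
End Compare.

(** * Large, empty and small structures, and the final union bound *)

Lemma expR_mul_le (R : realType) (a b x y : R) : expR a <= x -> expR b <= y -> expR (a + b) <= x * y.
Proof. by move=> ax bY; rewrite expRD; apply: ler_pM; rewrite ?expR_ge0. Qed.

Lemma powR_ge_expR (R : realType) (L x : R) : expR 1 <= L -> 0 <= x -> expR x <= L `^ x.
Proof.
move=> L1 x0; have L0 : 0 < L by apply: lt_le_trans L1; exact: expR_gt0.
rewrite /powR gt_eqF // ler_expR ler_peMr //.
by rewrite -[leLHS](@expRK R) ler_ln ?posrE ?expR_gt0.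
Qed.

Lemma exp_le_powR (R : realType) (L x : R) k : 1 <= L -> k%:R <= x -> L ^+ k <= L `^ x.
Proof. by move=> L1 kx; rewrite -powR_mulrn; [exact: ler_powR | lra]. Qed.

Lemma small_shuffle (R : comRingType) (y1 g nu e4 y2 : R) : y1 * (g * nu) * (e4 * y2) = g * e4 * nu * (y1 * y2).
Proof. by ring. Qed.

Lemma large_arith1 (R : realType) (x a b dd o4 : R) : a + b <= dd -> x <= o4 + - b + dd + (x - a - o4).
Proof. lra. Qed.

Lemma large_arith2 (R : realType) (x a b c dd : R) : a + b + c <= dd -> x <= 0 + - b + dd + (x - a - c).
Proof. lra. Qed.

Lemma large_arith3 (R : realType) (x y a c a' c' dd : R) : x + a + c <= dd -> a' <= a -> c' <= c ->
  x + y <= dd + (y - a' - c').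
Proof. lra. Qed.

Lemma sub_split (a b v : nat) : (a <= b -> b <= v -> v - a = (b - a) + (v - b))%N.
Proof. lia. Qed.

Lemma err_arith (R : realType) (o t2 C : R) : 0 <= o -> 0 <= t2 -> 10 <= C -> 4 * o <= C * (o + 1) * (t2 + 1).
Proof.
move=> o0 t0 C10; have p : 0 <= o * t2 by apply: mulr_ge0.
have q : 0 <= (C - 4) * ((o + 1) * (t2 + 1)) by apply: mulr_ge0; [lra | apply: mulr_ge0; lra].
have -> : C * (o + 1) * (t2 + 1) = (C - 4) * ((o + 1) * (t2 + 1)) + 4 * (o * t2 + o + t2 + 1) by ring.
lra.
Qed.

Lemma err_arith2 (R : realType) (c o t2 C : R) : 0 <= o -> 0 <= t2 -> 10 <= C -> c <= 2 * o + 2 ->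
  c * t2 + 4 * o <= C * (o + 1) * (t2 + 1).
Proof.
move=> o0 t0 C10 co; have p : 0 <= o * t2 by apply: mulr_ge0.
have q : 0 <= (C - 4) * ((o + 1) * (t2 + 1)) by apply: mulr_ge0; [lra | apply: mulr_ge0; lra].
have r : c * t2 <= (2 * o + 2) * t2 by apply: ler_wpM2r.
have -> : C * (o + 1) * (t2 + 1) = (C - 4) * ((o + 1) * (t2 + 1)) + 4 * (o * t2 + o + t2 + 1) by ring.
have rE : (2 * o + 2) * t2 = 2 * (o * t2) + 2 * t2 by ring.
lra.
Qed.

Section Final.
Variables (R : realType) (n m : nat) (V : finType) (F : graph_structure V) (A : {set V}).
Variables (eps C w : R).
Let L : R := ln n%:R.
Let h : R := n%:R `^ (- (3 / 2)).
Let t : R := tm h m.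
Let E := gsE F.
Let O := gsO F.
Let s := (#|V| + #|E| + #|O|)%N.
Hypothesis sreg : scale_regime R n m.
Hypothesis m0 : (0 < m)%N.
Hypothesis gp : graph_structure_pair F A.
Hypothesis iso : no_isolated F.
Hypothesis t8 : 8 * t ^+ 2 <= L.
Hypothesis C10 : 10 <= C.
Hypothesis w1 : 1 <= w.
Let n1 : (1 < n)%N. Proof. by case: sreg. Qed.
Let n0 : 0 < n%:R :> R. Proof. by rewrite ltr0n ltnW. Qed.
Let L100 : 100 <= L. Proof. by case: sreg. Qed.
Let L0 : 0 < L. Proof. by apply: lt_le_trans L100. Qed.
Let L1 : 1 <= L. Proof. by apply: le_trans L100; rewrite ler1n. Qed.
Let Le : expR 1 <= L. Proof. by apply: le_trans (expR1_le4 R) _; apply: le_trans L100; rewrite ler_nat. Qed.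
Let h0 : 0 < h. Proof. exact: (h_gt0 sreg). Qed.
Let t0 : 0 < t. Proof. by rewrite mulr_gt0 // ltr0n. Qed.
Let e0 : 0 <= #|E|%:R :> R. Proof. by []. Qed.
Let o0 : 0 <= #|O|%:R :> R. Proof. by []. Qed.

Lemma V_pos : (0 < #|E| + #|O|)%N -> (0 < #|V|)%N.
Proof.
have pos (X : {set {set V}}) : (forall e, e \in X -> #|e| = 2%N) -> (0 < #|X|)%N -> (0 < #|V|)%N.
  move=> pX /card_gt0P [e eX]; apply: leq_trans (max_card (mem e)).
  by rewrite (pX e eX).
by rewrite addn_gt0 => /orP []; apply: pos; [exact: gsE_pairs | exact: gsO_pairs].
Qed.

Lemma tt_le : 0 <= t ^+ 2 /\ 4 * tpos R n m ^+ 2 <= L ^+ 2 /\ 4 * t ^+ 2 <= L ^+ 2.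
Proof.
have [tp1 ttp tpL] := tpos_bounds sreg.
have a : 4 * tpos R n m ^+ 2 <= L ^+ 2.
  rewrite (_ : 4 * _ = (2 * tpos R n m) ^+ 2); last by ring.
  by rewrite lerXn2r ?nnegrE ?(ltW L0) //; lra.
have b : t ^+ 2 <= tpos R n m ^+ 2 by rewrite lerXn2r ?nnegrE ?(ltW t0) //; lra.
by rewrite sqr_ge0; split=> //; split=> //; lra.
Qed.

Lemma expo_full x : expo n F x A [set: V] =
  L * #|~: A|%:R - L / 2 * #|E|%:R - 4 * x ^+ 2 * #|O|%:R.
Proof. by rewrite /expo (e_relA gp) (o_relA gp) ecountT ocountT v_relT. Qed.

Section Large.
Hypothesis large : L < s%:R.

Let Lq : L <= 3 * (#|E|%:R + #|O|%:R).
Proof. exact: le_trans (ltW large) (s_le_sum R iso). Qed.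

Let V0 : (0 < #|V|)%N.
Proof.
apply: V_pos; rewrite lt0n; apply/eqP => eo0; have := Lq.
by move/eqP: eo0; rewrite addn_eq0 => /andP [/eqP -> /eqP ->]; rewrite addr0 mulr0 leNgt L0.
Qed.

(** Deterministic: count and trajectory are at most n^|V - A|. Since log n >= e, a power of log n is
    at least the exponential of its exponent, and here the exponents exceed everything that
    separates the error terms from n^|V - A|. *)
Lemma tracked_large (phi : {ffun V -> 'I_n}) G : tracked eps C w F A m G phi.
Proof.
have SF := Sval_full gp iso C10 V0; have DP := Delta_pow F A [set: V] C10.
have [tt0 [tt1 tt2]] := tt_le.
have [xa xb] := exp_large SF e0 o0 DP Lq L100 tt0 tt2.
have Lle : 0 <= L / 2 * #|E|%:R + L / 4.
  by apply: addr_ge0; rewrite ?mulr_ge0 ?(ltW L0) //; apply: divr_ge0; rewrite ?(ltW L0).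
have to0 : 0 <= 4 * t ^+ 2 * #|O|%:R by apply: mulr_ge0 => //; apply: mulr_ge0.
have nuE : n%:R `^ (- (1 / 4)) = expR (- (L / 4)) := nuq_expR sreg.
rewrite /tracked; cbv zeta; rewrite (timeE R n m) -/h -/t; split.
- move=> _ _; apply: (in_pm_trivial sreg gp); rewrite (natn_expR sreg) -/L.
  rewrite (Ntilde_expo F n1) -[n32 R n]mul1r (time_n32 n1) /f_err ocountT -/O nuE.
  set D := Delta C F A [set: V] in xa xb DP *.
  have q1 : expR (4 * #|O|%:R) <= expR (C * (#|O|%:R + 1) * (t ^+ 2 + 1)).
    by rewrite ler_expR; apply: err_arith.
  have q2 := powR_ge_expR Le (le_trans Lle xa).
  have q3 : expR (expo n F 1 A [set: V]) <= (2 * 1) ^+ e_rel F A [set: V] * expR (expo n F 1 A [set: V]) :> R.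
    by apply: ler_peMl; [exact: expR_ge0 | apply: exprn_ege1; rewrite mulr1 ler1n].
  have q := expR_mul_le (expR_mul_le (expR_mul_le q1 (lexx (expR (- (L / 4))))) q2) q3.
  refine (le_trans _ q).
  by rewrite ler_expR expo_full expr1n mulr1; apply: large_arith1.
- move=> wt _; apply: (in_pm_trivial sreg gp); rewrite (natn_expR sreg) -/L.
  rewrite (Ntilde_expo F n1) (timeE R n m) -/h -/t /g_err /gamma_exp ecountT -/E nuE.
  set D := Delta C F A [set: V] in xa xb DP *.
  have q1 : expR 0 <= expR (c_exp R F A * t ^+ 2).
    by rewrite ler_expR mulr_ge0 // (le_trans _ (c_exp_ge2 R F A)).
  have q2 := powR_ge_expR Le (le_trans (addr_ge0 Lle to0) xb).
  have q3 : expR (expo n F t A [set: V]) <= (2 * t) ^+ e_rel F A [set: V] * expR (expo n F t A [set: V]).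
    by apply: ler_peMl; [exact: expR_ge0 | apply: exprn_ege1; have := w1; lra].
  have q := expR_mul_le (expR_mul_le (expR_mul_le q1 (lexx (expR (- (L / 4))))) q2) q3.
  refine (le_trans _ q).
  by rewrite ler_expR expo_full; apply: large_arith2.
- move=> tA H mH; have [AH _] := minset_pot n1 t0 tA mH.
  have [T TD [vT v1]] := Delta3_ge gp C10 AH.
  have v1' : 1 <= (v_rel A H)%:R :> R by rewrite ler1n /v_rel subn_gt0 proper_card.
  have x3 : L * (v_rel A H)%:R + L / 2 * #|E|%:R + 4 * tpos R n m ^+ 2 * #|O|%:R <= Delta3 C F A H.
    by apply: (exp3_large TD _ v1' e0 o0 Lq L100 (sqr_ge0 _) tt1); rewrite -natrD.
  apply: le_trans (Ncopies_le R F A phi G) _; rewrite (natn_expR sreg) -/L.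
  rewrite (Ntilde_expo F n1) (time_max sreg).
  have [tp1 ttp tpL] := tpos_bounds sreg.
  have p0 : 0 <= L * (v_rel A H)%:R + L / 2 * #|E|%:R + 4 * tpos R n m ^+ 2 * #|O|%:R.
    apply: addr_ge0; last by apply: mulr_ge0 => //; apply: mulr_ge0 => //; exact: sqr_ge0.
    by apply: addr_ge0; apply: mulr_ge0 => //; rewrite ?divr_ge0 // ltW.
  have q2 := powR_ge_expR Le (le_trans p0 x3).
  have q3 : expR (expo n F (tpos R n m) H [set: V]) <=
     (2 * tpos R n m) ^+ e_rel F H [set: V] * expR (expo n F (tpos R n m) H [set: V]).
    by apply: ler_peMl; [exact: expR_ge0 | apply: exprn_ege1; lra].
  apply: le_trans (expR_mul_le q2 q3); rewrite ler_expR /expo -/L.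
  have vv : #|~: A|%:R = (v_rel A H)%:R + (v_rel H [set: V])%:R :> R.
    rewrite -v_relT -natrD; congr (_%:R); rewrite /v_rel.
    by apply: sub_split; [rewrite ltnW // proper_card | rewrite cardsT max_card].
  have ee : L / 2 * (e_rel F H [set: V])%:R <= L / 2 * #|E|%:R.
    by rewrite ler_wpM2l ?divr_ge0 ?(ltW L0) // ler_nat /e_rel ecountT leq_subr.
  have oo : 4 * tpos R n m ^+ 2 * (o_rel F H [set: V])%:R <= 4 * tpos R n m ^+ 2 * #|O|%:R.
    apply: ler_wpM2l; first by apply: mulr_ge0 => //; exact: sqr_ge0.
    by rewrite ler_nat /o_rel ocountT leq_subr.
  by rewrite vv mulrDr; exact: large_arith3 x3 ee oo.
Qed.
End Large.

(** Treated apart because the lower bounds for [Delta] need a vertex outside [A]; here there is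
    exactly one copy and the trajectory equals 1. *)
Lemma tracked_empty (phi : {ffun V -> 'I_n}) G : #|V| = 0%N -> tracked eps C w F A m G phi.
Proof.
move=> V0.
have E0 : #|E| = 0%N by apply/eqP; apply: contraT; rewrite -lt0n => p; have := @V_pos; rewrite V0 addn_gt0 p => /(_ isT).
have O0 : #|O| = 0%N by apply/eqP; apply: contraT; rewrite -lt0n => p; have := @V_pos; rewrite V0 addn_gt0 p orbT => /(_ isT).
have Av : #|~: A| = 0%N by apply/eqP; rewrite -leqn0 -V0 max_card.
have no (x : V) : False by have := card0_eq V0 x; rewrite inE.
have N1 : (Ncopies F A G phi)%:R = Ntilde F A [set: V] n m%:R :> R.
  rewrite (Ntilde_full sreg gp) /tau -/E -/O E0 O0 Av !expr0 !mulr1.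
  have -> // : Ncopies F A G phi = 1%N.
  rewrite /Ncopies (_ : [set psi | _] = [set: {ffun V -> 'I_n}]); first by rewrite cardsT card_ffun V0 expn0.
  apply/setP => psi; rewrite !inE; apply/and4P; split.
  - by apply/injectiveP => x; case: (no x).
  - by apply/forallP => x; case: (no x).
  - by apply/forall_inP => e eE; move/eqP: E0; rewrite cards_eq0 => /eqP E0; move: eE; rewrite -/E E0 finset.in_set0.
  - by apply/forall_inP => e eE; move/eqP: O0; rewrite cards_eq0 => /eqP O0; move: eE; rewrite -/O O0 finset.in_set0.
have Np x : 0 <= time n x -> 0 <= Ntilde F A [set: V] n x :> R.
  move=> x0; rewrite (Ntilde_expo F n1); apply: mulr_ge0; last exact: expR_ge0.
  by apply: exprn_ge0; apply: mulr_ge0.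
have ok (b : R) : 0 <= b -> in_pm (Ncopies F A G phi)%:R (Ntilde F A [set: V] n m%:R) b.
  by move=> b0; apply: in_pm_norm; rewrite N1 subrr normr0.
rewrite /tracked; cbv zeta; split.
- move=> _ _; apply: ok; apply: mulr_ge0; last by apply: Np; rewrite -[n32 R n]mul1r (time_n32 n1).
  by rewrite /f_err !mulr_ge0 ?expR_ge0 ?powR_ge0.
- move=> _ _; apply: ok; apply: mulr_ge0; last by apply: Np; exact: ltW.
  by rewrite /g_err !mulr_ge0 ?expR_ge0 ?powR_ge0.
- move=> _ H /minsetP [/andP [AH _] _]; have := proper_card AH.
  by rewrite ltnNge (leq_trans (max_card (mem H))) // V0.
Qed.

(** Before the threshold all denominators 2v - e are at least 1. *)
Lemma c_exp_le : trackable R n m F A -> c_exp R F A <= 2 * #|O|%:R + 2.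
Proof.
move=> tr; apply/bigmax_leP; split; first by have := o0; lra.
move=> K AK; have [_ ev] := tr K AK; rewrite (e_relA gp) in ev.
have ev' : (ecount F K).+1%:R <= 2 * (v_rel A K)%:R :> R by rewrite -natrM ler_nat.
have d1 : 1 <= 2 * (v_rel A K)%:R - (ecount F K)%:R :> R by rewrite -natr1 in ev'; lra.
have oK : (ocount F K)%:R <= #|O|%:R :> R.
  by rewrite ler_nat; apply: subset_leq_card; apply/fintype.subsetP => e; rewrite inE => /andP [].
apply: (@le_trans _ _ (2 * (ocount F K)%:R)); last by lra.
by rewrite ler_pdivrMr; [rewrite ler_peMr // mulr_ge0 | lra].
Qed.

(** The concentration bound has L-exponent 5s + 22, which fits under the exponents of [f_err] (with
    e(F) more for the passage to time 1) and of [g_err]. Past the threshold, [kk_copies] is compared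
    with [Delta3] instead. *)
Lemma tracked_small (phi : {ffun V -> 'I_n}) G kk : (0 < #|V|)%N ->
  2 * kk%:R <= L ^+ 5 :> R -> (1 <= kk)%N -> goodJ h (kapq R n) kk E O m G ->
  (trackable R n m F A -> `|(Ncopies F A G phi)%:R - Ntilde F A [set: V] n m%:R| <=
     L ^+ (5 * s + 22) * Gq n m (c_exp R F A) * Nt n m h E O A (bpq R n m)) ->
  tracked eps C w F A m G phi.
Proof.
move=> V0 kkL kk1 gJ track.
have SF := Sval_full gp iso C10 V0; have DP := Delta_pow F A [set: V] C10.
have sq : s%:R <= 3 * (#|E|%:R + #|O|%:R) := s_le_sum R iso.
have [xa xb] := exp_small SF e0 o0 DP sq.
rewrite /tracked; cbv zeta; rewrite (timeE R n m) -/h -/t; split.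
- move=> /andP [_ tw] wA; have tr : trackable R n m F A := trackable_of sreg m0 tw wA.
  apply: in_pm_norm; apply: le_trans (track tr) _.
  have N32 : 0 <= Ntilde F A [set: V] n (n32 R n) :> R.
    by rewrite (Ntilde_expo F n1) -[n32 R n]mul1r (time_n32 n1) mulr_ge0 ?expR_ge0 ?exprn_ge0.
  have G0 : 0 <= Gq n m (c_exp R F A) by rewrite mulr_ge0 ?expR_ge0 ?powR_ge0.
  apply: (@le_trans _ _ (L ^+ (5 * s + 22) * Gq n m (c_exp R F A) *
     (expR (4 * #|O|%:R) * L ^+ #|E| * Ntilde F A [set: V] n (n32 R n)))).
    by apply: ler_wpM2l (Nt_early sreg gp); apply: mulr_ge0 => //; apply: exprn_ge0; exact: ltW.
  rewrite [leLHS]mulrA; apply: ler_wpM2r => //.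
  have -> : L ^+ (5 * s + 22) * Gq n m (c_exp R F A) * (expR (4 * #|O|%:R) * L ^+ #|E|) =
    (expR (c_exp R F A * t ^+ 2) * expR (4 * #|O|%:R)) * nuq R n * (L ^+ (5 * s + 22) * L ^+ #|E|).
    exact: small_shuffle.
  rewrite /f_err -/(nuq R n) ocountT -/O; apply: ler_pM.
  + by rewrite mulr_ge0 ?powR_ge0 // mulr_ge0 ?expR_ge0.
  + by rewrite mulr_ge0 ?exprn_ge0 // ltW.
  + apply: ler_wpM2r; first exact: powR_ge0.
    rewrite -expRD ler_expR; have cl := c_exp_le tr; have t2 := sqr_ge0 t.
    exact: err_arith2.
  + rewrite -exprD; apply: exp_le_powR => //; apply: le_trans xa.
    by rewrite (natrD R _ #|E|) (natrD R _ 22) (natrM R 5).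
- move=> wt tA; have tr : trackable R n m F A := trackable_of' sreg m0 tA.
  have tge : 1 <= t by apply: le_trans w1 _; exact: ltW.
  apply: in_pm_norm; apply: le_trans (track tr) _; rewrite (Nt_late sreg gp tge).
  apply: ler_wpM2r; first by case/andP: (Ntilde_le sreg gp).
  rewrite mulrC /g_err /Gq -/h -/t -/(nuq R n); apply: ler_wpM2l; first by rewrite mulr_ge0 ?expR_ge0 ?powR_ge0.
  apply: exp_le_powR => //; rewrite /gamma_exp ecountT; apply: le_trans xb.
  by rewrite (natrD R _ 22) (natrM R 5).
- move=> tA H mH; have [AH minH] := minset_pot n1 t0 tA mH.
  have [T TD [vT v1]] := Delta3_ge gp C10 AH.
  have w0 : 'I_n := Ordinal (ltnW n1).
  apply: le_trans (kk_copies sreg m0 phi w0 kkL kk1 gJ minH (proper_sub AH)) _.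
  apply: ler_wpM2r.
    rewrite (Ntilde_expo F n1) (time_max sreg); apply: mulr_ge0; last exact: expR_ge0.
    have [tp1 _ _] := tpos_bounds sreg.
    by apply: exprn_ge0; apply: mulr_ge0 => //; apply: le_trans tp1; exact: ler01.
  apply: exp_le_powR => //.
  have q0 : 0 <= (#|E| + #|O|)%:R :> R by [].
  have := exp3_small TD vT v1 q0 (s_le iso R).
  by rewrite (natrD R _ 1) (natrM R 5).
Qed.

Lemma tfp_prob_False (P : (nat -> graph n) -> Prop) (c : R) : 0 <= c -> (forall g, ~ P g) -> tfp_prob R m P <= c.
Proof.
move=> c0 nP; apply: (@le_trans _ _ (tfp_prob R m (fun g => exists j : 'I_0, P g))).
  by apply: ler_tfp_prob => g /nP.
apply: le_trans (tfp_prob_exists (c := 0) _) _; first by case.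
by rewrite card_ord mul0r.
Qed.

Lemma final_arith (x y : R) : x <= expR (- (3 * L ^+ 2)) -> y <= expR (L ^+ 2) * (2 * expR (2 - L ^+ 4)) ->
  x + y <= expR (- (2 * L) * L).
Proof.
move=> hx hy; have L2 : 100 <= L ^+ 2.
  by apply: le_trans L100 _; rewrite expr2 ler_peMl ?(ltW L0).
have L4 : 100 * L ^+ 2 <= L ^+ 4 
  by rewrite (_ : L ^+ 4 = L ^+ 2 * L ^+ 2); [rewrite ler_wpM2r ?sqr_ge0 | rewrite -exprD].
have two : 2 <= expR 1 :> R by have := expR_ge1Dx (1 : R); lra.
have hy' : y <= expR (- (3 * L ^+ 2)).
  apply: le_trans hy _; apply: (@le_trans _ _ (expR (L ^+ 2) * (expR 1 * expR (2 - L ^+ 4)))).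
    by rewrite ler_wpM2l ?expR_ge0 // ler_wpM2r ?expR_ge0.
  by rewrite -!expRD ler_expR; lra.
apply: (@le_trans _ _ (expR 1 * expR (- (3 * L ^+ 2)))).
  have : 2 * expR (- (3 * L ^+ 2)) <= expR 1 * expR (- (3 * L ^+ 2)) by rewrite ler_wpM2r ?expR_ge0.
  by lra.
rewrite -expRD ler_expR (_ : - (2 * L) * L = - (2 * L ^+ 2)); last by ring.
lra.
Qed.

Hypothesis eps01 : 0 < eps <= 1.
Hypothesis Cw : expR (C * w ^+ 2) <= L.

Lemma main_bound :
  1 - n%:R `^ (- (2 * ln n%:R)) <= tfp_prob R m (fun G : nat -> graph n =>
    ~ event_K eps C w m.-1 G \/
    forall phi : V -> 'I_n, {in A &, injective phi} -> faithful F A (G m) phi ->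
      tracked eps C w F A m (G m) phi).
Proof.
have -> : n%:R `^ (- (2 * ln n%:R)) = expR (- (2 * L) * L) by rewrite /powR gt_eqF.
(* Root maps are turned into finite functions, over which a union bound can be taken. *)
have toF (phi : V -> 'I_n) : phi = [ffun x => phi x] :> (V -> 'I_n) by apply: funext => x; rewrite ffunE.
rewrite tfp_probC lerD2l lerN2.
have [Vz|V0] := posnP #|V|.
  apply: tfp_prob_False; first exact: expR_ge0.
  by move=> g nE; apply: nE; right=> phi _ _; rewrite (toF phi); exact: tracked_empty.
have [small|large] := leP (s%:R : R) L; last first.
  apply: tfp_prob_False; first exact: expR_ge0.
  by move=> g nE; apply: nE; right=> phi _ _; rewrite (toF phi); exact: tracked_large.
have L3 : 0 <= L ^+ 3 by rewrite exprn_ge0 // ltW.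
pose k := (Num.trunc (L ^+ 3)).+1.
have /andP [kt1 kt2] := truncn_itv L3.
have k_ge : L ^+ 3 <= k%:R by exact: ltW.
have k_le : k%:R <= L ^+ 3 + 1 by rewrite /k -natr1 lerD2r.
(* Room for the vertices of [k] copies, the roots, and the outer end of a pendant edge. *)
pose kk := (k * #|V| + #|V| + 1)%N.
have kkL : 2 * kk%:R <= L ^+ 5 :> R := kk_le sreg small k_le erefl.
have kk1 : (1 <= kk)%N by rewrite /kk addn1.
pose good (g : nat -> graph n) := forall i, (i < m)%N ->
  goodK h (kapq R n) (etaq R n m) (L ^+ 2) i (g i) /\ goodJ h (kapq R n) kk E O i (g i).
pose B1 (g : nat -> graph n) := (forall i, (i < m)%N -> goodK h (kapq R n) (etaq R n m) (L ^+ 2) i (g i)) /\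
    exists2 i, (i <= m)%N & ~ goodJ h (kapq R n) kk E O i (g i).
pose B2 (phi : {ffun V -> 'I_n}) (g : nat -> graph n) :=
  (trackable R n m F A /\ {in A &, injective phi}) /\ (good g /\ faith E O A phi (g m) /\
    L ^+ (5 * s + 22) * Gq n m (c_exp R F A) * Nt n m h E O A (bpq R n m) <
    `|#|[set psi : {ffun V -> 'I_n} | [&& injectiveb psi, [forall a in A, psi a == phi a],
          [forall e in E, psi @: e \in g m] & [forall e in O, psi @: e \in open_edges (g m)]]]|%:R -
      tau m h O * (kapq R n * m%:R) ^+ #|E| * n%:R ^+ #|~: A| |).
apply: (@le_trans _ _ (tfp_prob R m (fun g => B1 g \/ exists phi, B2 phi g))).
  apply: ler_tfp_prob => g nE; apply: contrapT => nB; apply: nE.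
  have [evK|] := pselect (event_K eps C w m.-1 g); last by left.
  have gK i : (i < m)%N -> goodK h (kapq R n) (etaq R n m) (L ^+ 2) i (g i).
    by move=> im; apply: (goodK_of_event sreg eps01 _ Cw im evK); have := C10; lra.
  have gJ i : (i <= m)%N -> goodJ h (kapq R n) kk E O i (g i).
    by move=> im; apply: contrapT => nJ; apply: nB; left; split=> //; exists i.
  right=> phi; rewrite (toF phi) => injA fa.
  apply: (tracked_small V0 kkL kk1 (gJ m (leqnn m))) => tr.
  rewrite leNgt; apply/negP => lt; apply: nB; right; exists [ffun x => phi x].
  split=> //; split; first by move=> i im; split; [exact: gK | apply: gJ; exact: ltnW].
  by split=> //; move: lt; rewrite (Ntilde_full sreg gp).
apply: le_trans (tfp_prob_or _ _ _ _) _; apply: final_arith.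
  exact: (goodJ_tail sreg small k_ge k_le erefl).
apply: (@le_trans _ _ (#|{ffun V -> 'I_n}|%:R * (2 * expR (2 - L ^+ 4)))).
  apply: tfp_prob_exists => phi.
  have [[tr injA]|ntr] := pselect (trackable R n m F A /\ {in A &, injective phi}); last first.
    by apply: tfp_prob_False => [|g [/ntr]] //; rewrite mulr_ge0 ?expR_ge0.
  apply: le_trans (track_tail sreg m0 small k_le erefl (structure_pair_of gp) (c_exp_ge2 R F A)
    (Gq_le1 sreg m0 gp t8 tr) (rY_track sreg m0 gp t8 tr) injA).
  by apply: ler_tfp_prob => g [].
apply: ler_wpM2r; first by rewrite mulr_ge0 ?expR_ge0.
rewrite card_ffun card_ord natrX (natn_expR sreg) ler_expR -/L expr2 ler_wpM2l ?(ltW L0) //.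
by apply: le_trans small; rewrite ler_nat /s -addnA leq_addr.
Qed.
End Final.

(** * Asymptotics in n *)

Section Limits.
Variable R : realType.
Local Open Scope classical_set_scope.

Lemma ln_near (M : R) : \forall n \near \oo, M <= ln n%:R.
Proof.
exists (Num.bound (expR M)) => // n /= Nn.
have e0 := expR_ge0 M.
have Mn : expR M <= n%:R by apply: le_trans (ltW (archi_boundP e0)) _; rewrite ler_nat.
by rewrite -[leLHS](@expRK R) ler_ln ?posrE ?expR_gt0 // (lt_le_trans (expR_gt0 M)).
Qed.

Lemma lnln_cvg (C : R) : 0 < C -> Num.sqrt (ln (ln n%:R) / C) @[n --> \oo] --> +oo.
Proof.
move=> C0; apply/cvgryPge => M; near=> n.
have Ln : expR (C * M ^+ 2) <= ln n%:R by near: n; exact: ln_near.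
have Ln0 : 0 < ln n%:R :> R by apply: lt_le_trans Ln; exact: expR_gt0.
apply: le_trans (ler_norm M) _; rewrite -sqrtr_sqr ler_sqrt; last first.
  apply: divr_ge0; last exact: ltW.
  apply: ln_ge0; apply: le_trans Ln; rewrite -[leLHS](@expR0 R) ler_expR.
  by apply: mulr_ge0; [exact: ltW | exact: sqr_ge0].
by rewrite ler_pdivlMr // mulrC -[leLHS](@expRK R) ler_ln ?posrE ?expR_gt0.
Unshelve. all: by end_near.
Qed.

(** As 1/(2 sqrt 2) squared is 1/8, the time satisfies t^2 <= (1/8 - eps/4) L, so [zet] is at most
    exp(-eps L/2). It absorbs L^40 since ln L <= 2 sqrt L and 80 sqrt L <= eps L/2 once sqrt L >=
    160/eps. *)
Lemma regime_near (eps : R) n m : 0 < eps < 1 / 8 -> (160 / eps) ^+ 2 <= ln n%:R -> 100 <= ln n%:R :> R ->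
  (0 < m)%N -> m%:R <= mmax eps n ->
  scale_regime R n m /\ 8 * tm (n%:R `^ (- (3 / 2))) m ^+ 2 <= ln n%:R :> R.
Proof.
move=> /andP [e0 e8]; set L : R := ln n%:R; set h : R := n%:R `^ (- (3 / 2)) => Le L1 m0 mm.
have n1 : (1 < n)%N.
  rewrite ltnNge; apply/negP => n1; have : L <= 0 by apply: ln_le0; rewrite lern1.
  by lra.
have n0 : 0 < n%:R :> R by rewrite ltr0n ltnW.
have h0 : 0 < h by exact: powR_gt0.
have L0 : 0 < L by lra.
set t := tm h m; have t0 : 0 < t by rewrite mulr_gt0 // ltr0n.
pose a : R := (2 * Num.sqrt 2)^-1.
have s2 : 0 < Num.sqrt 2 :> R by rewrite sqrtr_gt0.
have a2 : a ^+ 2 = 1 / 8.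
  by rewrite /a exprVn exprMn sqr_sqrtr // -natrX -natrM mul1r.
have a0 : 0 < a by rewrite invr_gt0 mulr_gt0.
have a4 : 1 / 4 <= a by nra.
have tt : t <= (a - eps) * Num.sqrt L.
  have : m%:R * h <= mmax eps n * h by rewrite ler_wpM2r // ltW.
  rewrite /mmax -mulrA (_ : n32 R n * h = 1) ?mulr1 //.
  rewrite /n32 /h -powRD ?addrN ?powRr0 //; by apply/implyP => _; rewrite gt_eqF.
have ae : 0 < a - eps by lra.
have t2 : t ^+ 2 <= (a - eps) ^+ 2 * L.
  rewrite -[X in _ * X]sqr_sqrtr ?(ltW L0) // -exprMn lerXn2r ?nnegrE ?(ltW t0) //.
  by rewrite mulr_ge0 ?sqrtr_ge0 // ltW.
have ae2 : (a - eps) ^+ 2 <= 1 / 8 - eps / 4.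
  have -> : (a - eps) ^+ 2 = a ^+ 2 - eps * (2 * a - eps) by ring.
  by rewrite a2; nra.
have t2' : t ^+ 2 <= (1 / 8 - eps / 4) * L by apply: le_trans t2 _; rewrite ler_wpM2r // ltW.
have eL : 0 < eps * L by rewrite mulr_gt0.
have t8 : 8 * t ^+ 2 <= L by lra.
split=> //; split=> //; last first.
  have t16 : 0 <= 16 * t by apply: mulr_ge0 => //; exact: ltW.
  have tt16 : (16 * t) ^+ 2 <= L ^+ 2.
    have -> : (16 * t) ^+ 2 = 32 * (8 * t ^+ 2) by ring.
    apply: (@le_trans _ _ (32 * L)); first by apply: ler_wpM2l.
    by rewrite expr2; apply: ler_wpM2r; lra.
  by move: tt16; rewrite ler_pXn2r ?nnegrE ?(ltW L0).
rewrite /zet -/h -/t /nuq /powR gt_eqF // -/L -expRD.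
have -> : L ^+ 40 = expR (40%:R * ln L) by rewrite expRM_natl lnK ?posrE.
rewrite -expRD expR_le1.
pose u := Num.sqrt L; have u0 : 0 < u by rewrite sqrtr_gt0.
have uL : u ^+ 2 = L by rewrite sqr_sqrtr // ltW.
have lnL : ln L <= 2 * u.
  have -> : ln L = 2 * ln u by rewrite -uL lnXn // mulr_natl.
  by rewrite ler_wpM2l //; have := ln_le_half_pow u0; lra.
have ue : 160 / eps <= u.
  rewrite -(@ler_pXn2r _ 2) ?nnegrE ?(ltW u0) ?divr_ge0 ?(ltW e0) // uL //.
have ue' : 160 <= eps * u by move: ue; rewrite ler_pdivrMr // mulrC.
have : 160 * u <= eps * u * u by rewrite ler_wpM2r // ltW.
have -> : eps * u * u = eps * L by rewrite -uL; ring.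
by lra.
Qed.
End Limits.

Local Open Scope classical_set_scope.

Theorem theorem4p1 (R : realType) :
  exists2 eps0 : R, 0 < eps0 & forall eps : R, 0 < eps < eps0 ->
  exists C0 : R, forall C : R, C0 <= C ->
  exists2 omega0 : nat -> R, omega0 n @[n --> \oo] --> +oo &
  forall omega : nat -> R, omega n @[n --> \oo] --> +oo ->
  (\forall n \near \oo, omega n <= omega0 n) ->
  \forall n \near \oo,
  forall (V : finType) (F : graph_structure V) (A : {set V}) (m : nat),
  graph_structure_pair F A -> no_isolated F ->
  (1 <= m)%N -> m%:R <= mmax eps n ->
  tfp_prob R m (fun G : nat -> graph n =>
    ~ event_K eps C (omega n) m.-1 G \/
    forall phi : V -> 'I_n,
      {in A &, injective phi} -> faithful F A (G m) phi ->
      tracked eps C (omega n) F A m (G m) phi)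
  >= 1 - n%:R `^ (- (2 * ln n%:R)).
Proof.
(* The bound 1/8 keeps eps below 1/4, which is at most 1/(2 sqrt 2); the value 10 for C suffices for
   the comparisons of exponents. *)
exists (1 / 8); first by lra.
move=> eps e8; exists 10 => C C10.
have C0 : 0 < C by lra.
(* The largest growth for which exp(C omega^2) <= log n, so that early exponential factors cost one
   logarithm. *)
exists (fun n => Num.sqrt (ln (ln n%:R) / C)); first exact: lnln_cvg.
move=> omega om le_om; near=> n => V F A m gp iso m1 mm.
have Le : (160 / eps) ^+ 2 <= ln n%:R by near: n; exact: ln_near.
have L1 : 100 <= ln n%:R :> R by near: n; exact: ln_near.
have w1 : 1 <= omega n by near: n; move/cvgryPge: om; apply.
have wo : omega n <= Num.sqrt (ln (ln n%:R) / C) by near: n.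
have [sreg t8] := regime_near e8 Le L1 m1 mm.
apply: (main_bound sreg m1 gp iso t8 C10 w1).
  by case/andP: e8 => a b; rewrite a /=; lra.
have Ln0 : 0 < ln n%:R :> R by lra.
rewrite -[leRHS]lnK ?posrE // ler_expR mulrC -ler_pdivlMr //.
have q0 : 0 <= ln (ln n%:R) / C :> R by rewrite divr_ge0 ?ln_ge0 //; lra.
rewrite -(sqr_sqrtr q0) lerXn2r ?nnegrE ?sqrtr_ge0 //; lra.
Unshelve. all: by end_near.
Qed.
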